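(* Let $X=\mathbb{OP}^2\cong E_6/P_1$ be the Cayley plane, and let $\lambda_1,\dots,\lambda_6$ be the fundamental dominant weights of $E_6$. For every integer $r\ge0$ there is the irreducible decomposition $$\mathrm{Sym}^rT_X=\bigoplus_{\substack{i+2j=r\\ i,j\ge0}}E_{i\lambda_2+j(\lambda_6+\lambda_1)}.$$ Hence the fundamental highest weights of $T_X^*$ are $\lambda_2$ and $\lambda_6+\lambda_1$, of degrees $1$ and $2$ respectively.
   Context: Everything is over $\mathbb{C}$. Simple roots $\alpha_i$ and fundamental weights $\lambda_i$ of $G=E_6$ are in Bourbaki order; $P_1$ is the maximal parabolic subgroup attached to $\alpha_1$, with the convention that its Lie algebra $\mathfrak p_1$ contains all negative root spaces, so that the weights of $\mathfrak g/\mathfrak p_1$ are the positive roots involving $\alpha_1$. Homogeneous vector bundles on $G/P_1$ are identified with $P_1$-modules, $T_X$ corresponding to $\mathfrak g/\mathfrak p_1$. $E_\lambda$ denotes the irreducible homogeneous vector bundle (irreducible $P_1$-module) with highest weight $\lambda$ with respect to the Levi part $R$ of $P_1$. Fundamental highest weights: for an $R$-module $V$ such that every irreducible $R$-module occurs at most once in the algebra of polynomials $\mathcal P(V)=\bigoplus_{i\ge0}\mathrm{Sym}^i(V^* )$, let $\Lambda$ be the set of highest weights occurring in $\mathcal P(V)$ and $h_\lambda$ the (unique up to scalar, homogeneous) highest weight vector of weight $\lambda\in\Lambda$. The fundamental highest weights of $V$ are the $\lambda\in\Lambda$ with $h_\lambda$ an irreducible polynomial; the degree of a fundamental highest weight $\omega$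 is $\deg h_\omega$. Those of $T_X^*$ are the ones for $V=(\mathfrak g/\mathfrak p_1)^*$, so $\mathcal P(V)=\bigoplus_r\mathrm{Sym}^r(\mathfrak g/\mathfrak p_1)$. *)

(* Defs.v *)
From HB Require Import structures.
From mathcomp Require Import all_boot all_order all_algebra.
From mathcomp Require Import reals.
From mathcomp Require Import complex.
From mathcomp.multinomials Require Import mpoly.

Set Implicit Arguments.
Unset Strict Implicit.
Unset Printing Implicit Defensive.

Import GRing.Theory Num.Theory.
Local Open Scope ring_scope.

(* Simple roots and fundamental weights of E_6 are numbered 0, ..., 5 in the
   Bourbaki order, so that index i stands for Bourbaki's i.+1.  All weights are
   row vectors of coordinates on the fundamental weights; equivalently, the i-th
   coordinate is the pairing with the i-th simple coroot. *)

Definition cartanE6 (i j : nat) : int :=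
  nth 0 (nth [::]
    [:: [::  2;  0; -1;  0;  0;  0];
        [::  0;  2;  0; -1;  0;  0];
        [:: -1;  0;  2; -1;  0;  0];
        [::  0; -1; -1;  2; -1;  0];
        [::  0;  0;  0; -1;  2; -1];
        [::  0;  0;  0;  0; -1;  2]] i) j.

Definition weight := 'rV[int]_6.

Definition sroot (i : 'I_6) : weight := \row_j cartanE6 i j.

(* In the Bourbaki numbering: fweight k is lambda_k for 1 <= k <= 6. *)
Definition fweight (k : nat) : weight := delta_mx 0 (inord k.-1).

(* The 27 weights of the minuscule representation of highest weight lambda_1:
   starting from lambda_1, subtract alpha_i whenever the i-th coordinate is 1.
   The lowest weight - lambda_6 is reached after 16 steps. *)
Definition lower_weight (m : seq int) : seq (seq int) :=
  [seq [seq nth 0 m j - cartanE6 i j | j <- iota 0 6]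
     | i <- iota 0 6 & nth 0 m i == 1].

Definition weights27 : seq (seq int) :=
  iter 16 (fun s => undup (s ++ flatten (map lower_weight s)))
    [:: [:: 1; 0; 0; 0; 0; 0]].

Lemma size_weights27 : size weights27 = 27%N.
Proof. by vm_compute. Qed.

Definition wt27 (k : 'I_27) : weight := \row_(j < 6) nth 0 (nth [::] weights27 k) j.

(* Lie subalgebra of gl_n generated by X.  Each step adds all brackets; the
   chain of subspaces is stationary after at most dim gl_n = n * n steps. *)
Definition lie_closure (K : fieldType) (n : nat) (X : seq 'M[K]_n) :
    {vspace 'M[K]_n} :=
  iter (n * n) (fun U : {vspace 'M[K]_n} =>
     (U + <<[seq x *m y - y *m x | x <- vbasis U, y <- vbasis U]>>)%VS) <<X>>%VS.

Inductive subgroup_gen (K : fieldType) (n : nat) (S : 'M[K]_n -> Prop) :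
    'M[K]_n -> Prop :=
  | Sgen_in x : S x -> subgroup_gen S x
  | Sgen_1 : subgroup_gen S 1%:M
  | Sgen_M x y : subgroup_gen S x -> subgroup_gen S y -> subgroup_gen S (x *m y)
  | Sgen_V x : subgroup_gen S x -> subgroup_gen S (invmx x).

Definition exponents (r : nat) : finType :=
  {ij : 'I_r.+1 * 'I_r.+1 | (ij.1 + 2 * ij.2 == r)%N}.

Section E6.
Variable R : realType.
Local Notation C := R[i].
Local Notation M27 := 'M[C]_27.

(* Chevalley generators in the minuscule representation (acting on columns):
   e_i v_mu = v_(mu + alpha_i), or 0 when mu + alpha_i is not a weight.
   For a minuscule representation all signs can be taken to be + 1. *)
Definition cheE (i : 'I_6) : M27 := \matrix_(k, l) (wt27 k == wt27 l + sroot i)%:R.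
Definition cheF (i : 'I_6) : M27 := (cheE i)^T.
Definition cheH (i : 'I_6) : M27 := diag_mx (\row_k (wt27 k 0 i)%:~R).

Definition nodes : seq 'I_6 := enum 'I_6.
Definition levi_nodes : seq 'I_6 := [seq i <- nodes | i != ord0].

Definition lieE6 : {vspace M27} :=
  lie_closure (map cheE nodes ++ map cheF nodes).

Definition lieP1 : {vspace M27} :=
  lie_closure (map cheF nodes ++ map cheH nodes ++ map cheE levi_nodes).

(* exp (t e_i), exp (t f_i): in a minuscule representation the root vectors
   have square zero. *)
Definition rootE (i : 'I_6) (t : C) : M27 := 1%:M + t *: cheE i.
Definition rootF (i : 'I_6) (t : C) : M27 := 1%:M + t *: cheF i.
(* alpha_i^vee (t) *)
Definition cochar (i : 'I_6) (t : C) : M27 := diag_mx (\row_k t ^ (wt27 k 0 i)).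

Definition groupP1 : M27 -> Prop := subgroup_gen (fun g =>
  [\/ exists i t, t != 0 /\ g = cochar i t,
      exists i t, g = rootF i t
    | exists i t, i != ord0 /\ g = rootE i t]).

Definition leviP1 : M27 -> Prop := subgroup_gen (fun g =>
  [\/ exists i t, t != 0 /\ g = cochar i t,
      exists i t, i != ord0 /\ g = rootF i t
    | exists i t, i != ord0 /\ g = rootE i t]).

(* The quotient lieE6 / lieP1 is realised on a complement of lieP1 in lieE6,
   the group P_1 acting by Ad followed by the projection along lieP1.  The i-th
   row of adTX g holds the coordinates of the image of the i-th basis vector. *)
Definition TX : {vspace M27} := (lieE6 :\: lieP1)%VS.

Definition adTX (g : M27) : 'M[C]_(\dim TX) :=
  \matrix_(i, j)
    coord (vbasis TX) j
      (addv_pi1 lieE6 lieP1 (g *m (vbasis TX)`_i *m invmx g)).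

(* Sym (lieE6 / lieP1), i.e. the polynomial functions on the dual of
   lieE6 / lieP1: the variable 'X_i is the i-th basis vector of TX. *)
Definition SymTX := {mpoly C[\dim TX]}.

Definition symTX_act (g : M27) (p : SymTX) : SymTX :=
  p \mPo [tuple \sum_j adTX g i j *: 'X_j | i < \dim TX].

Definition SymTX_deg (r : nat) (p : SymTX) : Prop := p \is r.-homog.

Section Modules.
Variables (M : lmodType C) (G : M27 -> Prop) (act : M27 -> M -> M).

Definition is_submodule (N : M -> Prop) : Prop :=
  [/\ N 0,
      forall (c : C) x y, N x -> N y -> N (c *: x + y)
    & forall g x, G g -> N x -> N (act g x)].

Definition is_irreducible (N : M -> Prop) : Prop :=
  [/\ is_submodule N,
      exists x, N x /\ x != 0
    & forall N' : M -> Prop, is_submodule N' -> (forall x, N' x -> N x) ->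
        (forall x, N' x -> x = 0) \/ (forall x, N x -> N' x)].

Definition module_iso (N1 N2 : M -> Prop) : Prop :=
  exists phi : M -> M,
    [/\ forall (c : C) x y, N1 x -> N1 y -> phi (c *: x + y) = c *: phi x + phi y,
        forall g x, G g -> N1 x -> phi (act g x) = act g (phi x),
        forall x, N1 x -> phi x = 0 -> x = 0
      & forall y, N2 y <-> exists x, N1 x /\ phi x = y].

(* Each irreducible G-module occurs at most once in the G-module M. *)
Definition multiplicity_free : Prop :=
  forall N1 N2 : M -> Prop, is_irreducible N1 -> is_irreducible N2 ->
    module_iso N1 N2 -> forall x, N1 x <-> N2 x.

Definition direct_sum (I : finType) (W : I -> M -> Prop) (N : M -> Prop) : Prop :=
  (forall x, N x <->
     exists y : I -> M, (forall i, W i (y i)) /\ x = \sum_i y i) /\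
  (forall y : I -> M, (forall i, W i (y i)) -> \sum_i y i = 0 ->
     forall i, y i = 0).

(* Highest weight vectors with respect to the Levi part of P_1, for the Borel
   subgroup generated by the torus and the positive root subgroups. *)
Definition is_hwv (lambda : weight) (v : M) : Prop :=
  [/\ v != 0,
      forall i t, i != ord0 -> act (rootE i t) v = v
    & forall i t, t != 0 -> act (cochar i t) v = t ^ (lambda 0 i) *: v].

(* N is a copy of E_lambda. *)
Definition is_E (lambda : weight) (N : M -> Prop) : Prop :=
  is_irreducible N /\ exists v, N v /\ is_hwv lambda v.

End Modules.

Definition mpoly_irreducible (n : nat) (p : {mpoly C[n]}) : Prop :=
  [/\ p != 0, p \isn't a GRing.unit
    & forall a b : {mpoly C[n]}, p = a * b ->
        a \is a GRing.unit \/ b \is a GRing.unit].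

(* For the R-module V whose algebra of polynomials is {mpoly C[n]} with the
   action act: lambda is a fundamental highest weight of V, of degree d. *)
Definition is_fundamental_hw (n : nat) (act : M27 -> {mpoly C[n]} -> {mpoly C[n]})
    (lambda : weight) (d : nat) : Prop :=
  exists h : {mpoly C[n]},
    [/\ is_hwv act lambda h, mpoly_irreducible h & h \is d.-homog].

End E6.

(* Main.v *)
From HB Require Import structures.
Require Import Defs.
From Stdlib Require Import Classical.
From mathcomp Require Import all_boot all_order all_algebra.
From mathcomp Require Import reals complex.
From mathcomp.multinomials Require Import ssrcomplements mpoly.
From mathcomp Require Import ring zify.
Set Implicit Arguments.
Unset Strict Implicit.
Unset Printing Implicit Defensive.
Import Order.TTheory GRing.Theory Num.Theory.
Local Open Scope ring_scope.

(** Write [g] and [p] for the Lie algebras of [E_6] and [P_1], acting on the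
    27-dimensional minuscule module, whose highest weight vector has index 0.

    The quotient [g / p] is made explicit first.  No element of [p] raises a
    vector to the highest weight, so the off-diagonal entries of row 0 of a
    matrix in [g] depend only on its class modulo [p] ([P1_row0]).  The 16 root
    vectors [tangent_vector l], one for each positive root involving the first
    simple root, are told apart by these entries, and together with [p] they span
    [g] ([E6_splits]).  Their brackets with the Chevalley generators show that the
    Levi factor acts on [g / p] by a half-spin representation of [Spin(10)] with
    highest weight [lambda_2], and that [f_0], hence the unipotent radical of
    [P_1], acts trivially.  In these coordinates the statement is about the action
    of 16 by 16 matrices on polynomials in 16 variables.

    The symmetric algebra of the half-spin module is decomposed by means of the
    Fischer form, the hermitian form on polynomials for which multiplication by a
    variable is adjoint to derivation.  The raising and lowering operators [e_i]
    and [f_i] are adjoint to each other, so orthogonal complements of submodules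
    are submodules.  Every nonzero submodule contains a highest weight vector.
    Suppose that, up to scalars, the highest weight vectors are a family [h c]
    whose weights are distinct.  Then the submodules generated by the [h c] are
    irreducible ([gen_irreducible]) and pairwise orthogonal ([gen_orth]), and they
    fill every degree ([decomposition]): the complement of their sum in that
    degree contains none of the [h c], hence vanishes.

    It remains to find the highest weight vectors ([killed_weight_hwv]).  Two are
    visible: the coordinate [Xtop] of weight [lambda_2], and a quadratic form
    [quad] of weight [lambda_1 + lambda_6].  On the open set where both are
    nonzero, the positive unipotent elements bring every point to one with two
    nonzero coordinates ([killed_eval]), which the torus brings to a fixed point.
    A highest weight vector is therefore a scalar multiple of [Xtop ^ a * quad ^ b]
    with [a] and [b] integers, and they are nonnegative since neither of the
    hypersurfaces [Xtop = 0] and [quad = 0] contains the other.  Such a monomial is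
    irreducible exactly when it is [Xtop] or [quad], the latter because its rank
    exceeds 2 ([quad_irreducible]).  This gives the fundamental highest weights.
    An isomorphism between two irreducible submodules preserves the weight of
    highest weight vectors, whence multiplicity freeness. *)
(** * Linear substitutions and linear vector fields *)

Section Substitution.
Variable K : fieldType.

(** Identities between algebra morphisms or derivations need only be checked on
    the variables; this principle covers both. *)
Lemma mpoly_alg_ind n (P : {mpoly K[n]} -> Prop) :
  P 1 -> (forall i, P 'X_i) -> (forall p q, P p -> P q -> P (p * q)) ->
  (forall c p q, P p -> P q -> P (c *: p + q)) -> forall p, P p.
Proof.
move=> P1 PX PM PL p.
have P0 : P 0 by have := PL (-1) _ _ P1 P1; rewrite scaleN1r addNr.
elim/mpolyind: p => [|c m p _ _ Pp]; first exact: P0.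
apply: PL => //; rewrite mpolyXE_id.
apply: (big_ind P) => [//|p' q' Pp' Pq'|i _]; first exact: PM.
by elim: (m i) => [|k Pk]; rewrite ?expr0 // exprS; apply: PM.
Qed.

Definition linform n (v : 'I_n -> K) : {mpoly K[n]} := \sum_j v j *: 'X_j.

(** Row [i] of [A] is the image of the variable [i]: linear forms are row vectors
    on which matrices act from the right, so [lsub] reverses products. *)
Definition lsub m n (A : 'M[K]_(m, n)) : {mpoly K[m]} -> {mpoly K[n]} :=
  comp_mpoly [tuple linform (A i) | i < m].

HB.instance Definition _ m n (A : 'M[K]_(m, n)) :=
  GRing.LRMorphism.copy (lsub A) (comp_mpoly [tuple linform (A i) | i < m]).

Lemma lsubX m n (A : 'M[K]_(m, n)) i : lsub A 'X_i = linform (A i).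
Proof. by rewrite /lsub comp_mpolyXU -tnth_nth tnth_mktuple. Qed.

Lemma lsub_lin m n (A : 'M[K]_(m, n)) (v : 'rV_m) :
  lsub A (linform (v 0)) = linform ((v *m A) 0).
Proof.
rewrite /linform raddf_sum /=; under eq_bigr do rewrite linearZ /= lsubX scaler_sumr.
rewrite exchange_big; apply: eq_bigr => k _; rewrite mxE scaler_suml.
by apply: eq_bigr => j _; rewrite scalerA.
Qed.

Lemma linform_row m n (A : 'M[K]_(m, n)) i : linform (A i) = linform ((row i A) 0).
Proof. by apply: eq_bigr => j _; rewrite mxE. Qed.

Lemma lsub_comp m n k (A : 'M[K]_(m, n)) (B : 'M[K]_(n, k)) p :
  lsub B (lsub A p) = lsub (A *m B) p.
Proof.
elim/mpoly_alg_ind: p => [|i|p q Hp Hq|c p q Hp Hq].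
- by rewrite !rmorph1.
- by rewrite !lsubX (linform_row A) lsub_lin (linform_row (A *m B)) row_mul.
- by rewrite !rmorphM /= Hp Hq.
- by rewrite !linearP /= Hp Hq.
Qed.

Lemma lsub1 n (p : {mpoly K[n]}) : lsub 1%:M p = p.
Proof.
elim/mpoly_alg_ind: p => [|i|p q Hp Hq|c p q Hp Hq].
- by rewrite !rmorph1.
- rewrite lsubX /linform (bigD1 i) //= big1 ?addr0 => [|j /negPf ji].
    by rewrite mxE eqxx scale1r.
  by rewrite mxE eq_sym ji scale0r.
- by rewrite !rmorphM /= Hp Hq.
- by rewrite !linearP /= Hp Hq.
Qed.

Lemma lsub_meval m n (A : 'M[K]_(m, n)) p v :
  (lsub A p).@[v] = p.@[fun i => \sum_j A i j * v j].
Proof.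
rewrite /lsub comp_mpoly_meval; apply: meval_eq => i.
rewrite tnth_mktuple /linform raddf_sum /=.
by apply: eq_bigr => j _; rewrite mevalZ mevalXU.
Qed.

Lemma linform_homog n (v : 'I_n -> K) : linform v \is 1.-homog.
Proof.
rewrite /linform; apply: rpred_sum => j _.
by apply: rpredZ; rewrite dhomogX /= mdeg1.
Qed.

Lemma lsub_homog m n (A : 'M[K]_(m, n)) d p :
  p \is d.-homog -> lsub A p \is d.-homog.
Proof.
move=> Hp; rewrite (mpolyE p) raddf_sum big_seq; apply: rpred_sum => u Hu /=.
rewrite linearZ; apply: rpredZ => /=.
have <- : mdeg u = d by apply: (dhomog_mf Hp).
rewrite /lsub comp_mpolyX mdegE.
apply: (big_rec2 (fun q e => q \is e.-homog)) => [|i e q _ Hq]; first exact: dhomog1.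
rewrite tnth_mktuple; apply: dhomogM => //.
by have := dhomogMn (u i) (linform_homog (A i)); rewrite mul1n.
Qed.

(** The derivation extending the action of [A] on linear forms, which is the
    derivative at [t = 0] of [lsub (1%:M + t *: A)]. *)
Definition der n (A : 'M[K]_n) (p : {mpoly K[n]}) : {mpoly K[n]} :=
  \sum_i linform (A i) * p^`M(i).

Lemma der_is_linear n (A : 'M[K]_n) : linear (der A).
Proof.
move=> c p q; rewrite /der scaler_sumr -big_split; apply: eq_bigr => i _ /=.
by rewrite linearP /= mulrDr scalerAr.
Qed.

HB.instance Definition _ n (A : 'M[K]_n) :=
  GRing.isLinear.Build K {mpoly K[n]} {mpoly K[n]} _ (der A) (@der_is_linear n A).

Lemma derZ n (A : 'M[K]_n) c p : der A (c *: p) = c *: der A p.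
Proof. exact: linearZ. Qed.

Lemma derD n (A : 'M[K]_n) p q : der A (p + q) = der A p + der A q.
Proof. exact: linearD. Qed.

Lemma der0 n (A : 'M[K]_n) : der A 0 = 0.
Proof. exact: linear0. Qed.

Lemma lsubZ m n (A : 'M[K]_(m, n)) c p : lsub A (c *: p) = c *: lsub A p.
Proof. exact: linearZ. Qed.

Lemma derM n (A : 'M[K]_n) p q : der A (p * q) = der A p * q + p * der A q.
Proof.
rewrite /der mulr_suml mulr_sumr -big_split; apply: eq_bigr => i _ /=.
by rewrite mderivM; ring.
Qed.

Lemma derC1 n (A : 'M[K]_n) : der A 1 = 0.
Proof. by rewrite /der big1 // => i _; rewrite -mpolyC1 mderivC mulr0. Qed.

Lemma derX n (A : 'M[K]_n) i : der A 'X_i = linform (A i).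
Proof.
rewrite /der (bigD1 i) //= big1 ?addr0 => [|j /negPf ji].
  rewrite mderivX mnmE eqxx scale1r.
  by rewrite (_ : (U_(i) - U_(i))%MM = 0%MM) ?mpolyX0 ?mulr1 //; apply/mnmP => k; rewrite !mnmE subnn.
by rewrite mderivX mnmE eq_sym ji scale0r mulr0.
Qed.

Lemma der_lin n (A : 'M[K]_n) (v : 'rV_n) :
  der A (linform (v 0)) = linform ((v *m A) 0).
Proof.
rewrite /linform raddf_sum /=; under eq_bigr do rewrite linearZ /= derX scaler_sumr.
rewrite exchange_big; apply: eq_bigr => k _; rewrite mxE scaler_suml.
by apply: eq_bigr => j _; rewrite scalerA.
Qed.

Lemma linform0 n : linform (fun _ : 'I_n => 0) = 0.
Proof. by rewrite /linform big1 // => j _; rewrite scale0r. Qed.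

Lemma linformP n c (u v : 'I_n -> K) :
  linform (fun j => c * u j + v j) = c *: linform u + linform v.
Proof.
rewrite /linform scaler_sumr -big_split /=; apply: eq_bigr => j _.
by rewrite scalerDl scalerA.
Qed.

Lemma eq_linform n (u v : 'I_n -> K) : u =1 v -> linform u = linform v.
Proof. by move=> uv; apply: eq_bigr => j _; rewrite uv. Qed.

Lemma der_mxZ n c (A : 'M[K]_n) p : der (c *: A) p = c *: der A p.
Proof.
rewrite /der scaler_sumr; apply: eq_bigr => i _.
rewrite scalerAl; congr (_ * _); rewrite /linform scaler_sumr.
by apply: eq_bigr => j _; rewrite mxE scalerA.
Qed.

(** The bracket is reversed because matrices act from the right. *)
Lemma der_comm n (A B : 'M[K]_n) p :
  der A (der B p) - der B (der A p) = der (B *m A - A *m B) p.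
Proof.
elim/mpoly_alg_ind: p => [|i|p q Hp Hq|c p q Hp Hq].
- by rewrite !derC1 !linear0 ?subrr ?oppr0 ?addr0.
- rewrite !derX (linform_row A) (linform_row B) !der_lin -!row_mul.
  rewrite -[X in _ - X]scale1r -scaleNr addrC.
  rewrite -(linformP _ (row i (A *m B) 0) (row i (B *m A) 0)).
  by apply: eq_linform => j; rewrite !mxE mulN1r addrC.
- rewrite !derM !raddfD /= !derM -Hp -Hq; ring.
- by rewrite !linearP /= -Hp -Hq scalerDr addrACA.
Qed.

Lemma lsub_der n (G A B : 'M[K]_n) p :
  A *m G = G *m B -> lsub G (der A p) = der B (lsub G p).
Proof.
move=> AG; elim/mpoly_alg_ind: p => [|i|p q Hp Hq|c p q Hp Hq].
- by rewrite rmorph1 !derC1 linear0.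
- by rewrite derX lsubX (linform_row A) (linform_row G) lsub_lin der_lin -!row_mul AG.
- by rewrite rmorphM !derM rmorphD !rmorphM /= Hp Hq.
- by rewrite !linearP /= Hp Hq.
Qed.
End Substitution.

(** * Exponentials of square-zero matrices *)

Section Exponential.
Variables (K : fieldType) (n : nat) (A : 'M[K]_n).
Hypothesis K0 : [pchar K] =i pred0.
Hypothesis A2 : A *m A = 0.

(** The substitution [lsub (1%:M + t *: A)] with [t] an indeterminate.  As [A]
    has square zero, [subt p] solves the differential equation [subt_deriv] of the
    one-parameter group, so its coefficients are those of an exponential series,
    which is finite because [subt p] is a polynomial in [t]. *)
Definition subt (p : {mpoly K[n]}) : {poly {mpoly K[n]}} :=
  mmap (polyC \o @mpolyC n K) (fun i => ('X_i)%:P + (linform (A i))%:P * 'X) p.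

HB.instance Definition _ := GRing.RMorphism.copy subt
  (mmap (polyC \o @mpolyC n K) (fun i => ('X_i)%:P + (linform (A i))%:P * 'X)).

Lemma subtX i : subt 'X_i = ('X_i)%:P + (linform (A i))%:P * 'X.
Proof. by rewrite /subt mmapX mmap1U. Qed.

Lemma subtZ c p : subt (c *: p) = (c%:MP)%:P * subt p.
Proof. by rewrite /subt mmapZ. Qed.

Local Opaque subt.
Lemma subt_linform (v : 'rV_n) :
  subt (linform (v 0)) = (linform (v 0))%:P + (linform ((v *m A) 0))%:P * 'X.
Proof.
rewrite -der_lin /linform (raddf_sum (der A)) !raddf_sum mulr_suml -big_split /=.
apply: eq_bigr => j _; rewrite subtZ subtX derZ derX.
by rewrite -!mul_mpolyC !rmorphM /= mulrDr mulrA.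
Qed.

Lemma subt_deriv p : (subt p)^`() = subt (der A p).
Proof.
elim/mpoly_alg_ind: p => [|i|p q Hp Hq|c p q Hp Hq].
- by rewrite derC1 rmorph1 rmorph0 derivC.
- have E0 : linform ((0 : 'rV[K]_n) 0) = 0.
    by rewrite -[RHS](linform0 K n); apply: eq_linform => j; rewrite mxE.
  rewrite derX (linform_row A) subt_linform -row_mul A2 row0 E0 mul0r addr0.
  rewrite subtX derivD derivM !derivC derivX mul0r !add0r mulr1.
  by rewrite (linform_row A).
- rewrite (rmorphM subt) derivM derM (rmorphD subt) !(rmorphM subt).
  by rewrite [X in X * _ + _]Hp [X in _ + _ * X]Hq.
- rewrite (rmorphD subt) /= subtZ derivD derivM derivC mul0r add0r.
  rewrite derD derZ (rmorphD subt) /= subtZ.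
  by rewrite [X in _ * X + _]Hp [X in _ + X]Hq.
Qed.

Lemma subt_horner t p : (subt p).[t%:MP] = lsub (1%:M + t *: A) p.
Proof.
elim/mpoly_alg_ind: p => [|i|p q Hp Hq|c p q Hp Hq].
- by rewrite !rmorph1 hornerC.
- rewrite subtX lsubX !hornerE mulrC mul_mpolyC -[in LHS](lsub1 'X_i) lsubX.
  rewrite addrC -linformP; apply: eq_linform => j; rewrite !mxE; ring.
- by rewrite (rmorphM subt) hornerM [X in X * _]Hp [X in _ * X]Hq (rmorphM (lsub _)).
- rewrite (rmorphD subt) /= subtZ hornerD hornerM hornerC mul_mpolyC.
  rewrite (rmorphD (lsub _)) /= lsubZ.
  by rewrite [X in _ *: X + _ = _]Hp [X in _ + X = _]Hq.
Qed.

Lemma subt_coef k p : (subt p)`_k = (k`!%:R)^-1 *: iter k (der A) p.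
Proof.
have H : (subt p)`_k *+ k`! = iter k (der A) p.
  elim: k p => [|k IH] p.
    rewrite fact0 mulr1n /= -horner_coef0 -(mpolyC0 n K) subt_horner scale0r addr0.
    exact: lsub1.
  by rewrite iterSr -IH -subt_deriv coef_deriv -mulrnA factS.
by rewrite -H -scaler_nat scalerA mulVf ?scale1r // (proj1 (pcharf0P K) K0) -lt0n fact_gt0.
Qed.

Lemma lsub_exp p : exists N, forall m t, (N <= m)%N -> lsub (1%:M + t *: A) p =
  \sum_(k < m) t ^+ k *: ((k`!%:R)^-1 *: iter k (der A) p).
Proof.
exists (size (subt p)) => m t Nm; rewrite -subt_horner (horner_coef_wide _ Nm).
apply: eq_bigr => k _; rewrite subt_coef -rmorphXn /= mulrC.
by rewrite mul_mpolyC.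
Qed.
End Exponential.

Section Subspaces.
Variables (K : numFieldType) (M : lmodType K).

Definition subspace (N : M -> Prop) : Prop :=
  N 0 /\ forall (c : K) x y, N x -> N y -> N (c *: x + y).

Lemma subspaceZ N c x : subspace N -> N x -> N (c *: x).
Proof. by case=> N0 NL Nx; rewrite -[_ *: _]addr0; apply: NL. Qed.

Lemma subspaceD N x y : subspace N -> N x -> N y -> N (x + y).
Proof. by case=> N0 NL Nx Ny; rewrite -[x]scale1r; apply: NL. Qed.

Lemma subspace_sum N I (r : seq I) (P : pred I) (f : I -> M) :
  subspace N -> (forall i, P i -> N (f i)) -> N (\sum_(i <- r | P i) f i).
Proof.
move=> sN; apply: (big_ind N); first by case: sN.
by move=> x y; apply: subspaceD.
Qed.

Lemma subspaceB N x y : subspace N -> N x -> N y -> N (x - y).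
Proof. by move=> sN Nx Ny; rewrite addrC -scaleN1r; apply: (proj2 sN). Qed.

(** By induction on [n]: the value at [2 * t] minus [2 ^ n] times the value at [t]
    has no term of degree [n], and its other coefficients are multiplied by the
    nonzero scalars [2 ^ k - 2 ^ n]. *)
Lemma subspace_coef N n (v : nat -> M) : subspace N ->
  (forall t : K, t != 0 -> N (\sum_(k < n) t ^+ k *: v k)) ->
  forall k, (k < n)%N -> N (v k).
Proof.
move=> sN; elim: n v => [//|n IH] v Hv.
have n2 (k : nat) : (2 ^+ k != 0 :> K) by rewrite expf_neq0 // pnatr_eq0.
have Nlow k : (k < n)%N -> N (v k).
  move=> kn; have inj2 : 2 ^+ k - 2 ^+ n != 0 :> K.
    rewrite subr_eq0 -!natrX eqr_nat; apply: contraTneq kn => H.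
    by rewrite -(ltn_exp2l _ _ (ltnSn 1)) H ltnn.
  have := IH (fun k => (2 ^+ k - 2 ^+ n) *: v k) _ k kn.
  move=> H; have {}H : N ((2 ^+ k - 2 ^+ n) *: v k).
    apply: H => t t0.
    have := subspaceB sN (Hv (2 * t) _) (subspaceZ (2 ^+ n) sN (Hv t t0)).
    rewrite mulf_neq0 ?pnatr_eq0 // => /(_ isT).
    rewrite !big_ord_recr /= scalerDr opprD addrACA !scalerA -exprMn subrr addr0.
    rewrite scaler_sumr -sumrB (eq_bigr (fun i : 'I_n => t ^+ i *: ((2 ^+ i - 2 ^+ n) *: v i))) //.
    by move=> i _; rewrite !scalerA -scalerBl exprMn; congr (_ *: _); ring.
  have := subspaceZ (2 ^+ k - 2 ^+ n)^-1 sN H.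
  by rewrite scalerA mulVf // scale1r.
move=> k; rewrite ltnS leq_eqVlt => /predU1P[->|/Nlow //].
have := Hv 1 (oner_neq0 _); rewrite big_ord_recr /= expr1n scale1r => H.
have Hs : N (\sum_(i < n) 1 ^+ i *: v i).
  by apply: subspace_sum => // i _; apply: subspaceZ => //; apply: Nlow.
by have := subspaceB sN H Hs; rewrite addrC addrK.
Qed.
End Subspaces.

(** The derivative is the coefficient of [t], so no limit is needed to pass from
    the group to its Lie algebra. *)
Lemma stable_der (K : numFieldType) n (A : 'M[K]_n) (N : {mpoly K[n]} -> Prop) p :
  A *m A = 0 -> subspace N ->
  (forall t, N (lsub (1%:M + t *: A) p)) -> N (der A p).
Proof.
move=> A2 sN Np; have [m Hm] := lsub_exp (pchar_num K) A2 p.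
have H := subspace_coef (n := m.+2)
  (v := fun k => (k`!%:R)^-1 *: iter k (der A) p) sN.
have {}H : N ((1`!%:R)^-1 *: iter 1 (der A) p).
  by apply: (H _ 1%N) => // t _; rewrite -Hm // -addn2 leq_addr.
by move: H; rewrite /= factS fact0 muln1 invr1 scale1r.
Qed.

(** * Torus weights of monomials *)

Section Torus.
Variables (K : fieldType) (n : nat).

Lemma lsub_diagX (d : 'rV[K]_n) m :
  lsub (diag_mx d) 'X_[m] = (\prod_i d 0 i ^+ m i) *: 'X_[m].
Proof.
rewrite mpolyXE_id rmorph_prod -scaler_prod; apply: eq_bigr => i _.
rewrite rmorphXn /= lsubX -exprZn; congr (_ ^+ _).
rewrite /linform (bigD1 i) //= big1 ?addr0 => [|j /negPf ji].
  by rewrite mxE eqxx mulr1n.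
by rewrite mxE eq_sym ji mulr0n scale0r.
Qed.

Lemma mcoeff_lsub_diag (d : 'rV[K]_n) p m :
  (lsub (diag_mx d) p)@_m = (\prod_i d 0 i ^+ m i) * p@_m.
Proof.
elim/mpolyind: p => [|c u p _ _ Hp]; first by rewrite rmorph0 !mcoeff0 mulr0.
rewrite rmorphD /= lsubZ lsub_diagX !mcoeffD !mcoeffZ Hp mcoeffX mulrDr.
by congr (_ + _); case: eqP => [->|_]; rewrite ?mulr0 ?mulr1 //= mulrC.
Qed.

Definition mwt (w : 'I_n -> int) (m : 'X_{1..n}) : int := \sum_i w i *+ m i.

Lemma mwtE w (m : 'X_{1..n}) (t : K) : t != 0 -> \prod_i (t ^ w i) ^+ m i = t ^ mwt w m.
Proof.
move=> t0; rewrite /mwt; elim/big_rec2: _ => [|i a b _ ->]; first by rewrite expr0z.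
by rewrite expfzDr // exprnP exprz_exp -mulr_natr natz.
Qed.

Definition tor (w : 'I_n -> int) (t : K) : 'M[K]_n := diag_mx (\row_i t ^ w i).

Lemma mcoeff_tor (w : 'I_n -> int) (t : K) p m : t != 0 -> (lsub (tor w t) p)@_m = t ^ mwt w m * p@_m.
Proof.
move=> t0; rewrite mcoeff_lsub_diag -mwtE //; congr (_ * _).
by apply: eq_bigr => i _; rewrite mxE.
Qed.

Definition cartan (w : 'I_n -> int) : 'M[K]_n := diag_mx (\row_i (w i)%:~R).

Lemma mcoeff_euler i (p : {mpoly K[n]}) m : ('X_i * p^`M(i))@_m = p@_m *+ m i.
Proof.
have [m0|mi] := eqVneq (m i) 0%N.
  rewrite m0 mulr0n mulrC; apply/eqP; rewrite mcoeff_eq0; apply/negP.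
  move=> /msuppM_le /allpairsP [[u v] /= [_]].
  by rewrite msuppX inE => /eqP -> E1; move: m0; rewrite E1 mnmDE mnm1E eqxx addn1.
have E : (m - U_(i) + U_(i))%MM = m by rewrite submK // lep1mP.
have -> : ('X_i * p^`M(i))@_m = (p^`M(i) * 'X_i)@_(U_(i) + (m - U_(i))).
  by rewrite mulrC addmC E.
by rewrite mcoeffMX mcoeff_deriv E mnmBE mnm1E eqxx subn1 prednK ?lt0n.
Qed.

Lemma mcoeff_der_cartan (w : 'I_n -> int) p m :
  (der (cartan w) p)@_m = (mwt w m)%:~R * p@_m.
Proof.
have E i : linform (cartan w i) = (w i)%:~R *: 'X_i :> {mpoly K[n]}.
  rewrite /linform (bigD1 i) //= big1 ?addr0 => [|j /negPf ji].
    by rewrite !mxE eqxx mulr1n.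
  by rewrite !mxE eq_sym ji mulr0n scale0r.
rewrite /der raddf_sum /mwt rmorph_sum mulr_suml; apply: eq_bigr => i _ /=.
by rewrite E -scalerAl mcoeffZ mcoeff_euler rmorphMn /= mulrnAl mulrnAr.
Qed.
End Torus.

(** A linear vector field replaces one variable of a monomial by another one.
    This is how weights and heights of monomials are followed. *)
Lemma mcoeff_der_neq0 (K : fieldType) n (A : 'M[K]_n) (p : {mpoly K[n]}) m :
  (der A p)@_m != 0 ->
  exists l k u, [/\ A l k != 0, m = (u + U_(k))%MM & p@_(u + U_(l)) != 0].
Proof.
move=> Hm; apply: NNPP => none; case/negP: Hm; apply/eqP.
rewrite /der raddf_sum big1 // => l _; rewrite /linform mulr_suml raddf_sum /=.
apply: big1 => k _; rewrite -scalerAl mcoeffZ mulrC.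
have [->|Alk] := eqVneq (A l k) 0; first by rewrite mulr0.
apply/eqP; rewrite mulf_eq0 (negPf Alk) orbF mcoeff_eq0; apply/negP.
rewrite mulrC => /msuppM_le /allpairsP [[u v] /= [Hu]].
rewrite msuppX inE => /eqP -> E; apply: none; exists l, k, u; split=> //.
by apply: contraTneq Hu => H0; rewrite mcoeff_msupp mcoeff_deriv H0 mul0rn eqxx.
Qed.

Lemma der_homog (K : fieldType) n (A : 'M[K]_n) d (p : {mpoly K[n]}) :
  p \is d.-homog -> der A p \is d.-homog.
Proof.
move=> Hp; apply/dhomogP => m; rewrite mcoeff_msupp.
move=> /mcoeff_der_neq0 [l [k [u [_ -> Hu]]]].
have <- : mdeg (u + U_(l)) = d by apply: (dhomog_mf Hp); rewrite mcoeff_msupp.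
by rewrite /= !mdegD !mdeg1.
Qed.

(** * The Fischer form *)

Section FischerForm.
Variables (K : numClosedFieldType) (n : nat).
Local Notation S := {mpoly K[n]}.

Definition mfact (m : 'X_{1..n}) : nat := \prod_i (m i)`!.

(** Monomials are orthogonal; the factorials make multiplication by a variable
    adjoint to derivation. *)
Definition fischer (p q : S) : K :=
  \sum_(m <- msupp p) (mfact m)%:R * p@_m * (q@_m)^*.

(** Summing over all monomials of bounded degree gives a range that does not
    depend on the polynomials, as linearity and symmetry require. *)
Lemma fischerwE k (p q : S) : (msize p <= k)%N ->
  fischer p q = \sum_(m : 'X_{1..n < k}) (mfact m)%:R * p@_m * (q@_m)^*.
Proof.
move=> pk; set I : subFinType _ := 'X_{1..n < k}.
rewrite /fischer (big_mksub I) ?msupp_uniq //=; first last.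
  by move=> x /msize_mdeg_lt/leq_trans; apply.
rewrite big_rmcond //= => i; rewrite mcoeff_msupp negbK => /eqP ->.
by rewrite mulr0 mul0r.
Qed.

Lemma fischer_linear q : linear (fun p : S => fischer p q : K^o).
Proof.
move=> c p1 p2; set k := maxn (msize (c *: p1 + p2)) (maxn (msize p1) (msize p2)).
rewrite !(@fischerwE k) ?leq_maxl ?leq_max ?leqnn ?orbT //.
rewrite scaler_sumr -big_split /=; apply: eq_bigr => m _.
by rewrite mcoeffD mcoeffZ /GRing.scale /=; ring.
Qed.

Lemma fischerC (p q : S) : fischer p q = (fischer q p)^*.
Proof.
set k := maxn (msize p) (msize q).
rewrite !(@fischerwE k) ?leq_maxl ?leq_maxr // rmorph_sum; apply: eq_bigr => m _ /=.
by rewrite !rmorphM /= conjCK conjC_nat; ring.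
Qed.

Lemma fischerPl c p1 p2 q :
  fischer (c *: p1 + p2) q = c * fischer p1 q + fischer p2 q.
Proof. exact: (fischer_linear q c p1 p2). Qed.

Lemma fischer0l q : fischer 0 q = 0.
Proof. by have := fischerPl (-1) 0 0 q; rewrite scaler0 addr0 mulN1r addNr. Qed.

Lemma fischer0r p : fischer p 0 = 0.
Proof. by rewrite fischerC fischer0l rmorph0. Qed.

Lemma fischerDl p1 p2 q : fischer (p1 + p2) q = fischer p1 q + fischer p2 q.
Proof. by have := fischerPl 1 p1 p2 q; rewrite scale1r mul1r. Qed.

Lemma fischerZl c p q : fischer (c *: p) q = c * fischer p q.
Proof. by rewrite -[_ *: _]addr0 fischerPl fischer0l addr0. Qed.

Lemma fischerPr p c q1 q2 :
  fischer p (c *: q1 + q2) = c^* * fischer p q1 + fischer p q2.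
Proof. by rewrite fischerC fischerPl rmorphD rmorphM /= -!fischerC. Qed.

Lemma fischerZr c p q : fischer p (c *: q) = c^* * fischer p q.
Proof. by rewrite fischerC fischerZl rmorphM /= -fischerC. Qed.

Lemma fischer_suml I (r : seq I) (P : pred I) (f : I -> S) q :
  fischer (\sum_(i <- r | P i) f i) q = \sum_(i <- r | P i) fischer (f i) q.
Proof.
elim/big_rec2: _ => [|i x y _ <-]; first exact: fischer0l.
by rewrite fischerDl.
Qed.

Lemma fischer_sumr I (r : seq I) (P : pred I) (f : I -> S) p :
  fischer p (\sum_(i <- r | P i) f i) = \sum_(i <- r | P i) fischer p (f i).
Proof.
rewrite fischerC fischer_suml rmorph_sum; apply: eq_bigr => i _ /=.
by rewrite -fischerC.
Qed.

Lemma fischer_eq0 (p : S) : fischer p p = 0 -> p = 0.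
Proof.
move=> pp; apply/mpolyP => m; rewrite mcoeff0.
have [mp|/memN_msupp_eq0 //] := boolP (m \in msupp p).
have : (mfact m)%:R * p@_m * (p@_m)^* == 0.
  move: pp; rewrite /fischer big_seq => /eqP.
  rewrite psumr_eq0 => [/allP/(_ _ mp)|m' _]; first by rewrite mp.
  by rewrite -mulrA -normCK mulr_ge0 ?ler0n // exprn_ge0.
rewrite -mulrA -normCK mulf_eq0 pnatr_eq0 expf_eq0 normr_eq0 /= => /orP[/eqP H0|/eqP //].
have : (0 < mfact m)%N by apply: prodn_gt0 => i; apply: fact_gt0.
by rewrite H0.
Qed.

Lemma fischer_mulX i (p q : S) : fischer ('X_i * p) q = fischer p q^`M(i).
Proof.
elim/mpolyind: p => [|c m p _ _ Hp]; first by rewrite mulr0 !fischer0l.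
rewrite mulrDr -scalerAr !fischerPl Hp; congr (_ * _ + _).
rewrite -mpolyXD /fischer !msuppX !big_seq1 !mcoeffX !eqxx !mulr1.
rewrite mcoeff_deriv rmorphMn /= addmC mulrnAr -mulrnAl -mulrnA.
congr (_%:R * _).
rewrite /mfact (bigD1 i) //= [in RHS](bigD1 i) //= mnmDE mnm1E eqxx addn1 factS.
rewrite [RHS]mulnC mulnA; congr (_ * _)%N; apply: eq_bigr => j /negPf ji.
by rewrite mnmDE mnm1E eq_sym ji addn0.
Qed.

Lemma fischer_deriv i (p q : S) : fischer p^`M(i) q = fischer p ('X_i * q).
Proof. by rewrite fischerC -fischer_mulX -fischerC. Qed.

(** Multiplications and derivations are adjoint, and exchanging them transposes the
    matrix. *)
Lemma fischer_der (A : 'M[K]_n) p q : (forall i j, (A i j)^* = A i j) ->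
  fischer (der A p) q = fischer p (der A^T q).
Proof.
move=> rA; rewrite /der fischer_suml fischer_sumr.
under eq_bigr do rewrite /linform mulr_suml fischer_suml.
under [RHS]eq_bigr do rewrite /linform mulr_suml fischer_sumr.
rewrite exchange_big; apply: eq_bigr => j _; apply: eq_bigr => i _.
by rewrite -!scalerAl fischerZl fischerZr fischer_mulX fischer_deriv mxE rA.
Qed.

Lemma fischer_tor (w : 'I_n -> int) t p q : t != 0 ->
  fischer (lsub (tor w t) p) q = fischer p (lsub (tor w t^*) q).
Proof.
move=> t0; have : t^* != 0 by rewrite conjC_eq0.
move uE : (t^* ) => u u0; have {}uE : u^* = t by rewrite -uE conjCK.
set k := maxn (msize (lsub (tor w t) p)) (msize p).
rewrite !(@fischerwE k) ?leq_maxl ?leq_maxr //; apply: eq_bigr => m _.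
rewrite [X in _ * X * _ = _]mcoeff_tor // [X in _ = _ * X^*]mcoeff_tor //.
have E : (u ^ mwt w m)^* = t ^ mwt w m by rewrite -uE; exact: fmorphXz.
by rewrite rmorphM /= E; ring.
Qed.
End FischerForm.

(** * Highest weight theory in a polynomial algebra *)

Section HighestWeightTheory.
Variables (K : numClosedFieldType) (n : nat) (I : eqType) (J : finType).
Local Notation S := {mpoly K[n]}.
(* The [E i] are raising operators with transposes [F i], and [w j] gives the
   weights of the variables under the j-th one-parameter subgroup of the torus.
   Each [E i] lowers [dep] by one, which bounds the length of products of raising
   operators.  The bracket in [EF] is reversed like that in [der_comm]. *)
Variables (E : I -> 'M[K]_n) (w : J -> 'I_n -> int).
Variables (node : I -> J) (a : I -> J -> int) (dep : 'I_n -> nat).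
Local Notation F i := (E i)^T.
Hypothesis E2 : forall i, E i *m E i = 0.
Hypothesis Ereal : forall i l m, (E i l m)^* = E i l m.
Hypothesis Ewt : forall i j l m, E i l m != 0 -> w j m = w j l + a i j.
Hypothesis EF : forall i k,
  F k *m E i - E i *m F k = if i == k then cartan K (w (node i)) else 0.
Hypothesis Edep : forall i l m, E i l m != 0 -> dep l = (dep m).+1.

Definition stable (N : S -> Prop) : Prop :=
  [/\ subspace N,
      forall i t p, N p -> N (lsub (1%:M + t *: E i) p),
      forall i t p, N p -> N (lsub (1%:M + t *: F i) p)
    & forall j t p, t != 0 -> N p -> N (lsub (tor (w j) t) p)].

Let F2 i : F i *m F i = 0. Proof. by rewrite -trmx_mul E2 trmx0. Qed.

Lemma stable_E N i p : stable N -> N p -> N (der (E i) p).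
Proof. by case=> sN NE _ _ Np; apply: stable_der => // t; apply: NE. Qed.

Lemma stable_F N i p : stable N -> N p -> N (der (F i) p).
Proof. by case=> sN _ NF _ Np; apply: stable_der => // t; apply: NF. Qed.

Lemma lsub_stable (A : 'M[K]_n) N t p : A *m A = 0 -> subspace N ->
  (forall q, N q -> N (der A q)) -> N p -> N (lsub (1%:M + t *: A) p).
Proof.
move=> A2 sN Nd Np; have [m /(_ _ _ (leqnn m)) ->] := lsub_exp (pchar_num K) A2 p.
apply: subspace_sum => // k _; do 2!apply: subspaceZ => //.
by elim: (k : nat) => //= k' IH; apply: Nd.
Qed.

(** Conversely, stability under the group follows from stability under the Lie
    algebra, because the exponential series are finite. *)
Lemma der_stable N : subspace N ->
  (forall i p, N p -> N (der (E i) p)) -> (forall i p, N p -> N (der (F i) p)) ->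
  (forall j t p, t != 0 -> N p -> N (lsub (tor (w j) t) p)) -> stable N.
Proof.
by move=> sN NE NF NT; split=> // i t p Np; apply: lsub_stable => // q; auto.
Qed.

(** The component of weight [c] under the j-th one-parameter subgroup. *)
Definition wcomp j c (p : S) : S :=
  \sum_(m <- msupp p | mwt (w j) m == c) p@_m *: 'X_[m].

Lemma mcoeff_wcomp j c p m :
  (wcomp j c p)@_m = if mwt (w j) m == c then p@_m else 0.
Proof.
rewrite /wcomp raddf_sum /=.
have [mp|mp] := boolP (m \in msupp p); last first.
  rewrite (memN_msupp_eq0 mp) if_same big1_seq // => u /andP[_ up].
  rewrite mcoeffZ mcoeffX; case: eqP up mp => [->->//|_ _ _]; by rewrite mulr0.
rewrite big_mkcond (bigD1_seq m) ?msupp_uniq //= big1 ?addr0 => [|u /negPf um].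
  by case: ifP => // _; rewrite mcoeffZ mcoeffX eqxx mulr1.
by case: ifP => // _; rewrite mcoeffZ mcoeffX um mulr0.
Qed.

(** The torus multiplies the weight components by distinct powers of [t], so they
    can be separated by [subspace_coef]; the shift by the bound [B] makes all the
    exponents nonnegative. *)
Lemma tor_stable_wcomp N j c p : subspace N ->
  (forall t, t != 0 -> N (lsub (tor (w j) t) p)) -> N (wcomp j c p).
Proof.
move=> sN NT; pose B := \max_(m <- msupp p) `|mwt (w j) m|%N.
have HB m : m \in msupp p -> (`|mwt (w j) m| <= B)%N.
  by move=> mp; rewrite /B (bigD1_seq m) ?msupp_uniq //= leq_maxl.
have H k : (k < (B + B).+1)%N -> N (wcomp j (k%:Z - B%:Z) p).
  apply: (subspace_coef (v := fun k => wcomp j (k%:Z - B%:Z) p) sN) => t t0.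
  suff -> : \sum_(k0 < (B + B).+1) t ^+ k0 *: wcomp j (k0%:Z - B%:Z) p =
      t ^+ B *: lsub (tor (w j) t) p by apply: subspaceZ => //; apply: NT.
  apply/mpolyP => m; rewrite raddf_sum mcoeffZ mcoeff_tor //=.
  under eq_bigr do rewrite mcoeffZ mcoeff_wcomp.
  have [mp|mp] := boolP (m \in msupp p); last first.
    by rewrite (memN_msupp_eq0 mp) !mulr0 big1 // => i _; rewrite if_same mulr0.
  have := HB m mp; set e := mwt _ m => eB.
  have kP : (`|(e + B%:Z)%R| < (B + B).+1)%N by lia.
  rewrite (bigD1 (Ordinal kP)) //= big1 ?addr0 => [|i /eqP ik]; last first.
    case: eqP => [H|]; rewrite ?mulr0 //; case: ik; apply: val_inj => /=; lia.
  rewrite ifT; last by apply/eqP; lia.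
  rewrite mulrA; congr (_ * _); rewrite !exprnP -expfzDr //; congr (t ^ _); lia.
case: (leqP `|c| B) => cB.
  have -> : c = (`|(c + B%:Z)%R|%N)%:Z - B%:Z by lia.
  by apply: H; lia.
suff -> : wcomp j c p = 0 by case: sN.
apply/mpolyP => m; rewrite mcoeff_wcomp mcoeff0; case: eqP => // mc.
by apply: memN_msupp_eq0; apply/negP => /HB; rewrite mc leqNgt cB.
Qed.

Definition weightvec (p : S) (mu : J -> int) : Prop :=
  forall j m, p@_m != 0 -> mwt (w j) m = mu j.

Lemma weightvec_tor p mu j t : t != 0 -> weightvec p mu ->
  lsub (tor (w j) t) p = t ^ mu j *: p.
Proof.
move=> t0 wp; apply/mpolyP => m; rewrite mcoeff_tor // mcoeffZ.
by have [->|/wp ->] := eqVneq p@_m 0; rewrite ?mulr0.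
Qed.

(** Take the weight component containing the leading monomial. *)
Lemma exists_weightvec N p : subspace N ->
  (forall j t q, t != 0 -> N q -> N (lsub (tor (w j) t) q)) -> N p -> p != 0 ->
  exists q mu, [/\ N q, q != 0 & weightvec q mu].
Proof.
move=> sN NT Np p0; pose m0 := mlead p; pose mu j := mwt (w j) m0.
pose q s := foldr (fun j => wcomp j (mu j)) p s.
have qE s m : (q s)@_m = if all (fun j => mwt (w j) m == mu j) s then p@_m else 0.
  by elim: s => //= j s IH; rewrite mcoeff_wcomp IH; case: ifP.
exists (q (enum J)), mu; split.
- elim: (enum J) => //= j s IH; apply: tor_stable_wcomp => // t t0.
  exact: NT.
- apply/eqP => /mpolyP/(_ m0); rewrite qE mcoeff0 ifT; last by apply/allP.
  by move/eqP; rewrite mleadc_eq0 (negPf p0).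
- move=> j m; rewrite qE; case: ifP => [/allP H _|]; last by rewrite eqxx.
  by apply/eqP; apply: H; rewrite mem_enum.
Qed.

Definition Ekill (p : S) : Prop := forall i, der (E i) p = 0.

(** Raising operators lower the total depth of all monomials, so applying them as
    long as the result is nonzero comes to an end. *)
Lemma exists_Ekill N p : stable N -> N p -> p != 0 ->
  exists q, [/\ N q, q != 0 & Ekill q].
Proof.
move=> stN; pose mdep (m : 'X_{1..n}) := (\sum_l m l * dep l)%N.
have mdepD u l : mdep (u + U_(l))%MM = (mdep u + dep l)%N.
  rewrite /mdep (eq_bigr (fun k => u k * dep k + (l == k) * dep k)%N); last first.
    by move=> k _; rewrite mnmDE mnm1E mulnDl.
  rewrite big_split /= (bigD1 l) //= [X in (_ + X)%N](bigD1 l) //= eqxx mul1n.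
  rewrite [X in (dep l + X)%N]big1 ?addn0 // => k; rewrite eq_sym => /negPf ->.
  by rewrite mul0n.
have [d] : exists d, forall m, p@_m != 0 -> (mdep m <= d)%N.
  exists (\max_(m <- msupp p) mdep m) => m; rewrite -mcoeff_msupp => mp.
  by rewrite (bigD1_seq m) ?msupp_uniq //= leq_maxl.
elim: d p => [|d IH] p Hd Np p0.
  exists p; split=> // i; apply/mpolyP => m; rewrite mcoeff0; apply/eqP.
  apply: contraT => /mcoeff_der_neq0 [l [k [u [/Edep lk _ /Hd]]]].
  by rewrite mdepD lk addnS.
case: (classic (Ekill p)) => [kp|]; first by exists p.
move/not_all_ex_not => [i /eqP pi]; apply: (IH (der (E i) p)) => //.
  move=> m /mcoeff_der_neq0 [l [k [u [/Edep lk -> /Hd]]]].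
  by rewrite !mdepD lk addnS ltnS.
exact: stable_E.
Qed.

Lemma E_tor i j t : t != 0 ->
  E i *m tor (w j) t = tor (w j) t *m (t ^ a i j *: E i).
Proof.
move=> t0; apply/matrixP => l m; rewrite mul_mx_diag mul_diag_mx !mxE.
have [->|lm] := eqVneq (E i l m) 0; first by rewrite !(mul0r, mulr0).
by rewrite (Ewt j lm) expfzDr //; ring.
Qed.

Lemma F_tor i j t : t != 0 ->
  F i *m tor (w j) t = tor (w j) t *m (t ^ (- a i j) *: F i).
Proof.
move=> t0; apply/matrixP => m l; rewrite mul_mx_diag mul_diag_mx !mxE.
have [->|lm] := eqVneq (E i l m) 0; first by rewrite !(mul0r, mulr0).
have -> : w j l = w j m - a i j by rewrite (Ewt j lm) addrK.
by rewrite expfzDr //; ring.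
Qed.

Lemma F_cartan i j :
  F i *m cartan K (w j) - cartan K (w j) *m F i = - (a i j)%:~R *: F i.
Proof.
rewrite mul_mx_diag mul_diag_mx; apply/matrixP => m l; rewrite !mxE.
have [->|lm] := eqVneq (E i l m) 0; first by rewrite !(mul0r, mulr0) subr0.
by rewrite (Ewt j lm) rmorphD /=; ring.
Qed.

Lemma Ekill_tor j t p : t != 0 -> Ekill p -> Ekill (lsub (tor (w j) t) p).
Proof.
move=> t0 kp i; have := lsub_der p (E_tor i j t0).
rewrite kp rmorph0 der_mxZ => /esym/eqP.
by rewrite scaler_eq0 expfz_eq0 (negPf t0) andbF => /eqP.
Qed.

Lemma exists_hwv N p : stable N -> N p -> p != 0 ->
  exists q mu, [/\ N q, q != 0, Ekill q & weightvec q mu].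
Proof.
move=> stN Np p0; have [q [Nq q0 kq]] := exists_Ekill stN Np p0.
have [sN _ _ NT] := stN.
have := @exists_weightvec (fun q => N q /\ Ekill q) q.
case=> //; first split.
- by split=> [|i]; [case: sN | rewrite der0].
- move=> c x y [Nx kx] [Ny ky]; split; first by case: sN => _; apply.
  by move=> i; rewrite derD derZ kx ky scaler0 addr0.
- by move=> j t x t0 [Nx kx]; split; [apply: NT | apply: Ekill_tor].
- by move=> x [mu [[Nx kx] x0 wx]]; exists x, mu.
Qed.

(* The highest weight vectors are assumed to be known: up to scalars they are the
   [h c], and they have distinct weights. *)
Variables (P : eqType) (h : P -> S) (lam : P -> J -> int) (deg : P -> nat).
Hypothesis h_neq0 : forall c, h c != 0.
Hypothesis h_kill : forall c, Ekill (h c).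
Hypothesis h_weight : forall c, weightvec (h c) (lam c).
Hypothesis h_homog : forall c, h c \is (deg c).-homog.
Hypothesis h_hwv : forall v mu, v != 0 -> Ekill v -> weightvec v mu ->
  exists c z, v = z *: h c.
Hypothesis lam_inj : forall c d, lam c =1 lam d -> c = d.

Lemma stable_has_h N p : stable N -> N p -> p != 0 -> exists c, N (h c).
Proof.
move=> stN Np p0; have [q [mu [Nq q0 kq wq]]] := exists_hwv stN Np p0.
have [c [z qE]] := h_hwv q0 kq wq; exists c.
have z0 : z != 0 by apply: contraNneq q0 => z0; rewrite qE z0 scale0r.
rewrite -[h c]scale1r -(mulVf z0) -scalerA -qE.
by case: stN => sN _ _ _; apply: subspaceZ.
Qed.

(** The submodule generated by [h c].  It is spanned by lowering operators
    alone: the raising operators and the torus preserve this span, because they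
    commute with lowering operators up to terms of the torus or scalars, as used in
    [gen_E] and [gen_tor]. *)
Inductive gen c : S -> Prop :=
| gen_h : gen c (h c)
| gen_lin z p q : gen c p -> gen c q -> gen c (z *: p + q)
| gen_F i p : gen c p -> gen c (der (F i) p).

Lemma gen_subspace c : subspace (gen c).
Proof.
split; last by move=> z p q; apply: gen_lin.
by have := gen_lin (-1) (gen_h c) (gen_h c); rewrite scaleN1r addNr.
Qed.

Lemma gen_cartan c j p : gen c p -> gen c (der (cartan K (w j)) p).
Proof.
elim=> [|z p1 q1 _ H1 _ H2|i p1 gp1 H1].
- have -> : der (cartan K (w j)) (h c) = (lam c j)%:~R *: h c.
    apply/mpolyP => m; rewrite mcoeff_der_cartan mcoeffZ.
    by have [->|/h_weight ->] := eqVneq (h c)@_m 0; rewrite ?mulr0.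
  by apply: subspaceZ; [apply: gen_subspace | apply: gen_h].
- by rewrite derD derZ; apply: gen_lin.
- have -> : der (cartan K (w j)) (der (F i) p1) = der (F i) (der (cartan K (w j)) p1)
       + der (F i *m cartan K (w j) - cartan K (w j) *m F i) p1.
    by rewrite -der_comm addrC subrK.
  rewrite F_cartan der_mxZ addrC.
  by apply: gen_lin; apply: gen_F.
Qed.

Lemma gen_E c i p : gen c p -> gen c (der (E i) p).
Proof.
elim=> [|z p1 q1 _ H1 _ H2|k p1 gp1 H1].
- by rewrite h_kill; case: (gen_subspace c).
- by rewrite derD derZ; apply: gen_lin.
- have -> : der (E i) (der (F k) p1) = der (F k) (der (E i) p1)
       + der (F k *m E i - E i *m F k) p1 by rewrite -der_comm addrC subrK.
  apply: (subspaceD (gen_subspace c)); first exact: gen_F.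
  rewrite EF; case: ifP => _; first exact: gen_cartan.
  have -> : der 0 p1 = 0 by rewrite -(scale0r (E i)) der_mxZ scale0r.
  by case: (gen_subspace c).
Qed.

Lemma gen_tor c j t p : t != 0 -> gen c p -> gen c (lsub (tor (w j) t) p).
Proof.
move=> t0; elim=> [|z p1 q1 _ H1 _ H2|i p1 gp1 H1].
- rewrite (weightvec_tor _ t0 (@h_weight c)).
  by apply: subspaceZ; [apply: gen_subspace | apply: gen_h].
- by rewrite rmorphD /= lsubZ; apply: gen_lin.
- rewrite (lsub_der _ (F_tor i j t0)) der_mxZ.
  by apply: subspaceZ; [apply: gen_subspace | apply: gen_F].
Qed.

Lemma gen_stable c : stable (gen c).
Proof.
apply: der_stable; first exact: gen_subspace.
- by move=> i p; apply: gen_E.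
- by move=> i p; apply: gen_F.
- by move=> j t p; apply: gen_tor.
Qed.

Lemma gen_min c N p : stable N -> N (h c) -> gen c p -> N p.
Proof.
move=> stN Nh; elim=> // [z p1 q1 _ N1 _ N2|i p1 _ N1]; last exact: stable_F.
by case: stN => [[_ sN] _ _ _]; apply: sN.
Qed.

Lemma gen_homog c p : gen c p -> p \is (deg c).-homog.
Proof.
elim=> [|z p1 q1 _ H1 _ H2|i p1 _ H1] //; last exact: der_homog.
by rewrite rpredD // rpredZ.
Qed.

Lemma h_orth c d : c != d -> fischer (h c) (h d) = 0.
Proof.
move=> /eqP cd; rewrite /fischer big1 // => m _.
have [->|cm] := eqVneq (h c)@_m 0; first by rewrite mulr0 mul0r.
have [->|dm] := eqVneq (h d)@_m 0; first by rewrite rmorph0 mulr0.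
by case: cd; apply: lam_inj => j; rewrite -(h_weight j cm) -(h_weight j dm).
Qed.

(** Lowering operators are adjoint to raising operators, which kill [v]. *)
Lemma Ekill_orth v c p : Ekill v -> fischer v (h c) = 0 -> gen c p ->
  fischer v p = 0.
Proof.
move=> kv vh; elim=> // [z p1 q1 _ H1 _ H2|i p1 _ _].
  by rewrite fischerPr H1 H2 mulr0 addr0.
by rewrite -fischer_der // kv fischer0l.
Qed.

Lemma fischer_derF i p q : fischer (der (F i) p) q = fischer p (der (E i) q).
Proof. by rewrite fischer_der ?trmxK // => l m; rewrite mxE Ereal. Qed.

Lemma gen_orth c d p q : c != d -> gen c p -> gen d q -> fischer p q = 0.
Proof.
move=> cd gp; elim: gp q => [|z p1 q1 _ H1 _ H2|i p1 _ H1] q gq.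
- exact: (Ekill_orth (@h_kill c) (h_orth cd)).
- by rewrite fischerPl H1 // H2 // mulr0 addr0.
- by rewrite fischer_derF H1 //; apply: gen_E.
Qed.

(** A nonzero submodule contains some [h d]; if [d] differs from [c], then [h d]
    is orthogonal to all of [gen c], in particular to itself. *)
Lemma gen_irreducible c N p : stable N -> (forall q, N q -> gen c q) ->
  N p -> p != 0 -> forall q, gen c q -> N q.
Proof.
move=> stN Nc Np p0; have [d Nd] := stable_has_h stN Np p0.
suff dc : d = c by move=> q; apply: gen_min => //; rewrite -dc.
apply/eqP; apply: contraT => dc; have := gen_orth dc (gen_h d) (Nc _ Nd).
by move/fischer_eq0/eqP; rewrite (negPf (h_neq0 d)).
Qed.

(** Orthogonal projection onto a space of polynomials with bounded support,
    one monomial of the support at a time. *)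
Lemma orthogonal_projection (s : seq 'X_{1..n}) (N : S -> Prop) : subspace N ->
  (forall p m, N p -> p@_m != 0 -> m \in s) ->
  forall p, exists2 q, N q & forall x, N x -> fischer (p - q) x = 0.
Proof.
elim: s N => [|m0 s IH] N sN Ns p.
  exists 0; first by case: sN.
  move=> x Nx; suff -> : x = 0 by rewrite fischer0r.
  by apply/mpolyP => m; rewrite mcoeff0; apply/eqP; apply: contraT => /(Ns _ _ Nx).
pose N' x := N x /\ x@_m0 = 0.
have sN' : subspace N'.
  split; first by split; [case: sN | rewrite mcoeff0].
  move=> c x y [Nx x0] [Ny y0]; split; first by case: sN => _; apply.
  by rewrite mcoeffD mcoeffZ x0 y0 mulr0 addr0.
have N's x m : N' x -> x@_m != 0 -> m \in s.
  move=> [Nx x0] xm; have := Ns _ _ Nx xm; rewrite inE => /predU1P[mm|//].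
  by rewrite mm x0 eqxx in xm.
have {}IH := IH _ sN' N's.
case: (classic (exists2 x, N x & x@_m0 != 0)) => [[x Nx x0]|none]; last first.
  have [q [Nq _] Hq] := IH p; exists q => // x Nx; apply: Hq; split=> //.
  by apply/eqP; apply: contraT => x0; case: none; exists x.
have [y [Ny y0] Hy] := IH x; pose x' := x - y.
have Nx' : N x' by apply: subspaceB.
have x'0 : x'@_m0 = x@_m0 by rewrite mcoeffB y0 subr0.
have fx' : fischer x' x' != 0.
  by apply: contraNneq x0 => /fischer_eq0 xx; rewrite -x'0 xx mcoeff0.
have [q [Nq q0] Hq] := IH p; pose c := fischer p x' / fischer x' x'.
exists (c *: x' + q); first by case: sN => _; apply.
move=> z Nz; pose d := z@_m0 / x@_m0.
have N'z : N' (z - d *: x').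
  split; first by apply: subspaceB => //; apply: subspaceZ.
  by rewrite mcoeffB mcoeffZ x'0 divfK // subrr.
have qx' : fischer q x' = 0 by rewrite fischerC Hy ?rmorph0.
have E1 : fischer (p - (c *: x' + q)) x' = 0.
  rewrite -scaleN1r addrC fischerPl fischerPl qx' addr0 /c.
  by rewrite divfK // mulN1r addNr.
have E2' : fischer (p - (c *: x' + q)) (z - d *: x') = 0.
  have -> : p - (c *: x' + q) = (- c) *: x' + (p - q).
    by rewrite opprD scaleNr addrCA.
  by rewrite fischerPl Hq // Hy // mulr0 addr0.
have -> : z = d *: x' + (z - d *: x') by rewrite addrC subrK.
by rewrite fischerPr E1 E2' mulr0 addr0.
Qed.

Section Decomposition.
Variables (r : nat) (T : finType) (psi : T -> P).
Hypothesis psi_inj : injective psi.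
Hypothesis psi_deg : forall c, deg c = r <-> exists t, psi t = c.

(** The complement of the sum in degree [r] is stable.  If it were nonzero it would
    contain some [h d]; this [h d] has degree [r], so it also lies in the sum and
    is orthogonal to itself. *)
Lemma decomposition p : p \is r.-homog ->
  exists y : T -> S, (forall t, gen (psi t) (y t)) /\ p = \sum_t y t.
Proof.
move=> pr; pose N q := exists y : T -> S, (forall t, gen (psi t) (y t)) /\ q = \sum_t y t.
have gsub t := gen_subspace (psi t).
have sN : subspace N.
  split; first by exists (fun=> 0); split=> [t|]; [case: (gsub t) | rewrite big1].
  move=> c x y [x' [gx ->]] [y' [gy ->]]; exists (fun t => c *: x' t + y' t).
  by split=> [t|]; [apply: gen_lin | rewrite scaler_sumr big_split].
have gr t q : gen (psi t) q -> q \is r.-homog.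
  by move/gen_homog; have -> : deg (psi t) = r by apply/psi_deg; exists t.
have gN t q : gen (psi t) q -> N q.
  move=> gq; exists (fun u => if u == t then q else 0); split.
    by move=> u; case: eqP => [->//|_]; case: (gsub u).
  by rewrite -big_mkcond big_pred1_eq.
have Nr q : N q -> q \is r.-homog.
  by move=> [y [gy ->]]; apply: rpred_sum => t _; apply: gr (gy t).
have [q Nq Hq] : exists2 q, N q & forall x, N x -> fischer (p - q) x = 0.
  apply: (@orthogonal_projection [seq val m | m : 'X_{1..n < r.+1}]) => // x m Nx xm.
  have mr : (mdeg m < r.+1)%N.
    by rewrite ltnS (dhomog_mf (Nr x Nx) (x := m)) ?mcoeff_msupp.
  by apply/mapP; exists (BMultinom mr); rewrite ?mem_enum.
suff : p - q = 0 by move/eqP; rewrite subr_eq0 => /eqP ->.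
apply/eqP; apply: contraT => pq0.
pose N' x := x \is r.-homog /\ forall t y, gen (psi t) y -> fischer x y = 0.
have stN' : stable N'.
  apply: der_stable.
  - split; first by split=> [|t y _]; [rewrite rpred0 | rewrite fischer0l].
    move=> c x y [xr Hx] [yr Hy]; split; first by rewrite rpredD // rpredZ.
    by move=> t z gz; rewrite fischerPl (Hx t) // (Hy t) // mulr0 addr0.
  - move=> i x [xr Hx]; split; first exact: der_homog.
    by move=> t y gy; rewrite fischer_der // (Hx t) //; apply: gen_F.
  - move=> i x [xr Hx]; split; first exact: der_homog.
    by move=> t y gy; rewrite fischer_derF (Hx t) //; apply: gen_E.
  - move=> j u x u0 [xr Hx]; split; first exact: lsub_homog.
    by move=> t y gy; rewrite fischer_tor // (Hx t) //; apply: gen_tor; rewrite ?conjC_eq0.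
have N'pq : N' (p - q).
  split; first by rewrite rpredB // Nr.
  by move=> t y gy; apply: Hq; apply: gN gy.
have [d [hr Hd]] := stable_has_h stN' N'pq pq0.
have /psi_deg [t td] : deg d = r by apply: (dhomog_uniq (h_neq0 d)).
have := Hd t (h d); rewrite td => /(_ (gen_h d)) /fischer_eq0/eqP.
by rewrite (negPf (h_neq0 d)).
Qed.

Lemma decomposition_direct (y : T -> S) :
  (forall t, gen (psi t) (y t)) -> \sum_t y t = 0 -> forall t, y t = 0.
Proof.
move=> gy y0 t; apply: fischer_eq0.
rewrite -[RHS](fischer0r (y t)) -y0 fischer_sumr (bigD1 t) //= big1 ?addr0 // => u ut.
by apply: gen_orth (gy t) (gy u); rewrite (inj_eq psi_inj) eq_sym.
Qed.
End Decomposition.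
End HighestWeightTheory.

(** * Sparse integer matrices *)

Section SparseMatrices.

(** Integer matrices given by lists of entries, on which products and equality
    can be computed. *)
Definition sparse : Type := seq ((nat * nat) * int).

Definition scoef (s : sparse) (i j : nat) : int :=
  foldr (fun x r => if x.1 == (i, j) then x.2 + r else r) 0 s.

Definition smul (s s' : sparse) : sparse :=
  [seq ((x.1.1, y.1.2), x.2 * y.2) | x <- s, y <- [seq y <- s' | x.1.2 == y.1.1]].

Definition sneg (s : sparse) : sparse := [seq (x.1, - x.2) | x <- s].

Definition strans (s : sparse) : sparse := [seq ((x.1.2, x.1.1), x.2) | x <- s].

Definition sbrack (s s' : sparse) : sparse := smul s s' ++ sneg (smul s' s).

Definition sin (n : nat) (s : sparse) : bool := all (fun x => (x.1.1 < n) && (x.1.2 < n))%N s.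

(** Duplicate positions add up, so equality is tested on the coefficients. *)
Definition seqb (s s' : sparse) : bool :=
  all (fun k => scoef s k.1 k.2 == scoef s' k.1 k.2) (map fst (s ++ s')).

Lemma sin_trans n s : sin n (strans s) = sin n s.
Proof. by elim: s => //= x s ->; congr (_ && _); rewrite andbC. Qed.

Lemma sin_cat n s s' : sin n (s ++ s') = sin n s && sin n s'.
Proof. exact: all_cat. Qed.

Lemma sin_neg n s : sin n (sneg s) = sin n s.
Proof. exact: all_map. Qed.

Lemma sin_mul n s s' : sin n s -> sin n s' -> sin n (smul s s').
Proof.
move=> /allP Hs /allP Hs'; apply/allP => x /allpairsPdep [u [v [us]]].
rewrite mem_filter => /andP[_ vs] -> /=.
by have /andP[-> _] := Hs _ us; have /andP[_ ->] := Hs' _ vs.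
Qed.

Lemma sin_brack n s s' : sin n s -> sin n s' -> sin n (sbrack s s').
Proof. by move=> H H'; rewrite sin_cat sin_neg !sin_mul. Qed.

Variables (K : fieldType) (n : nat).

Definition smx (s : sparse) : 'M[K]_n := \matrix_(i, j) (scoef s i j)%:~R.

Lemma scoef_cat s s' i j : scoef (s ++ s') i j = scoef s i j + scoef s' i j.
Proof.
elim: s => [|x s IH] /=; first by rewrite add0r.
by rewrite IH; case: ifP => // _; rewrite addrA.
Qed.

Lemma scoef_notin s i j : (i, j) \notin map fst s -> scoef s i j = 0.
Proof.
elim: s => //= x s IH; rewrite inE negb_or => /andP[/negPf xij /IH ->].
by rewrite eq_sym xij.
Qed.

Lemma smx_cat s s' : smx (s ++ s') = smx s + smx s'.
Proof. by apply/matrixP => i j; rewrite !mxE scoef_cat rmorphD. Qed.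

Lemma smx_neg s : smx (sneg s) = - smx s.
Proof.
apply/matrixP => i j; rewrite !mxE -rmorphN; congr (_%:~R).
elim: s => [|x s IH] /=; first by rewrite oppr0.
by rewrite IH; case: ifP => // _; rewrite opprD.
Qed.

Lemma smx_trans s : smx (strans s) = (smx s)^T.
Proof.
apply/matrixP => i j; rewrite !mxE; congr (_%:~R).
elim: s => //= [[[k l] c] s IH] /=.
by rewrite IH !xpair_eqE andbC.
Qed.

Lemma smx_nil : smx [::] = 0.
Proof. by apply/matrixP => i j; rewrite !mxE. Qed.

Lemma smx1 k l c : smx [:: ((k, l), c)] =
  \matrix_(i, j) (if (k == i) && (l == j) then c%:~R else 0).
Proof.
by apply/matrixP => i j; rewrite !mxE /= xpair_eqE addr0; case: ifP.
Qed.

Lemma smx_mul s s' : sin n s -> smx (smul s s') = smx s *m smx s'.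
Proof.
elim: s => [|[[k l] c] s IH] /= ; first by rewrite smx_nil mul0mx.
move=> /andP[/andP[kn ln] /IH {}IH].
have -> : smul ((k, l, c) :: s) s' =
  [seq ((k, y.1.2), c * y.2) | y <- s' & l == y.1.1] ++ smul s s' by [].
rewrite smx_cat IH -cat1s smx_cat mulmxDl; congr (_ + _).
rewrite smx1 /=; apply/matrixP => i j; rewrite !mxE.
rewrite (bigD1 (Ordinal ln)) //= big1 ?addr0 => [|u]; last first.
  by rewrite -val_eqE /= => /negPf ul; rewrite !mxE (eq_sym l) ul andbF mul0r.
rewrite !mxE eqxx andbT /= {IH}; elim: s' => [|[[k' l'] c'] s' IHs] /=.
  by rewrite mulr0.
case: (eqVneq l k') => [<-|lk'] /=; last first.
  by rewrite IHs xpair_eqE (eq_sym k') (negPf lk').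
rewrite !xpair_eqE eqxx /=; case: (k == i) IHs => /= IHs; last by rewrite IHs !mul0r.
by case: (l' == j); rewrite ?rmorphD ?rmorphM /= ?mulrDr IHs.
Qed.

Lemma smx_brack s s' : sin n s -> sin n s' ->
  smx (sbrack s s') = smx s *m smx s' - smx s' *m smx s.
Proof. by move=> sn sn'; rewrite smx_cat smx_neg !smx_mul. Qed.

Lemma smx_eq s s' : seqb s s' -> smx s = smx s'.
Proof.
move=> /allP H; apply/matrixP => i j; rewrite !mxE; congr (_%:~R).
have [ij|] := boolP ((nat_of_ord i, nat_of_ord j) \in map fst (s ++ s')).
  exact/eqP/(H _ ij).
rewrite map_cat mem_cat negb_or => /andP[hs hs'].
by rewrite !scoef_notin.
Qed.

Lemma smx_neq0 s i j : smx s i j != 0 ->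
  (nat_of_ord i, nat_of_ord j) \in map fst s.
Proof.
rewrite mxE; apply: contraNT => /scoef_notin ->.
by rewrite rmorph0.
Qed.

Lemma scoef_const (e : seq (nat * nat)) (c : int) k l : uniq e ->
  scoef [seq (x, c) | x <- e] k l = if (k, l) \in e then c else 0.
Proof.
elim: e => //= x e IH /andP[xe ue]; rewrite IH // inE eq_sym.
by case: eqP => [->|_] //=; rewrite (negPf xe) addr0.
Qed.

Lemma smx_diag (f : nat -> int) :
  smx [seq ((k, k), f k) | k <- iota 0 n] = diag_mx (\row_k (f k)%:~R).
Proof.
apply/matrixP => l m; rewrite !mxE.
have E s : uniq s -> scoef [seq ((k, k), f k) | k <- s] l m =
    if (nat_of_ord l \in s) && (l == m) then f l else 0.
  elim: s => //= k s IH /andP[ks us]; rewrite IH // inE xpair_eqE -val_eqE /=.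
  move: ks; have [-> ks|//] := eqVneq k (nat_of_ord l).
  by rewrite (negPf ks) /= addr0.
rewrite E ?iota_uniq // mem_iota ltn_ord /=.
by case: eqP => [->|_]; rewrite ?mulr1n ?mulr0n.
Qed.

Lemma smx_row_sum (V : lmodType K) (s : sparse) (l : nat) (Y : nat -> V)
    (ln : (l < n)%N) : sin n s ->
  \sum_m smx s (Ordinal ln) m *: Y m =
  foldr (fun x r => if x.1.1 == l then x.2%:~R *: Y x.1.2 + r else r) 0 s.
Proof.
elim: s => [_|[[k m] c] s IH /= /andP[/andP[kn mn] /IH <-]].
  by rewrite big1 // => j _; rewrite mxE scale0r.
case: eqP => [->|kl]; last first.
  apply: eq_bigr => j _; rewrite !mxE /= xpair_eqE.
  by case: eqP kl => // -> [].
rewrite [LHS](bigD1 (Ordinal mn)) //= [in RHS](bigD1 (Ordinal mn)) //=.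
rewrite !mxE /= eqxx rmorphD /= scalerDl -addrA; congr (_ + (_ + _)).
apply: eq_bigr => j; rewrite -val_eqE => /negPf jm; rewrite !mxE /= xpair_eqE.
by rewrite eq_sym in jm; rewrite jm andbF.
Qed.
End SparseMatrices.

Lemma eq_rows (f g : nat -> int) n :
  (\row_(j < n) f j == \row_(j < n) g j) = all (fun j => f j == g j) (iota 0 n).
Proof.
apply/eqP/allP => [H j|H].
  rewrite mem_iota => /= jn; move/rowP/(_ (Ordinal jn)): H.
  by rewrite !mxE => /eqP.
by apply/rowP => j; rewrite !mxE; apply/eqP/H; rewrite mem_iota /=.
Qed.

Lemma all_ord (P : pred nat) n : all P (iota 0 n) -> forall i : 'I_n, P i.
Proof. by move=> /allP H i; apply: H; rewrite mem_iota /=. Qed.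

(** * The half-spin module *)

Definition spin_nodes : seq nat := [:: 1; 2; 3; 4; 5]%N.

(** The weights of the half-spin module are the 16 roots involving the first
    simple root; [spin_index] lists the weights of the 27-dimensional module
    which are [lambda_1] minus one of these roots. *)
Definition spin_index : seq nat :=
  [:: 1; 2; 3; 4; 5; 6; 7; 8; 9; 10; 11; 13; 14; 16; 18; 20]%N.

Definition spin_weights : seq (seq int) :=
  [:: [::  2;  0; -1;  0;  0;  0]; [::  1;  0;  1; -1;  0;  0];
      [::  1; -1;  0;  1; -1;  0]; [::  1;  1;  0;  0; -1;  0];
      [::  1; -1;  0;  0;  1; -1]; [::  1;  1;  0; -1;  1; -1];
      [::  1; -1;  0;  0;  0;  1]; [::  1;  0; -1;  1;  0; -1];
      [::  1;  1;  0; -1;  0;  1]; [::  0;  0;  1;  0;  0; -1];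
      [::  1;  0; -1;  1; -1;  1]; [::  0;  0;  1;  0; -1;  1];
      [::  1;  0; -1;  0;  1;  0]; [::  0;  0;  1; -1;  1;  0];
      [::  0; -1;  0;  1;  0;  0]; [::  0;  1;  0;  0;  0;  0]].

Definition spin_wt (j l : nat) : int := nth 0 (nth [::] spin_weights l) j.

(** The pairs [(k, l)] such that weight [l] is weight [k] plus the simple root
    number [i]. *)
Definition spin_edges (i : nat) : seq (nat * nat) := nth [::]
  [:: [::];
      [:: (2, 3); (4, 5); (6, 8); (14, 15)];
      [:: (0, 1); (7, 9); (10, 11); (12, 13)];
      [:: (1, 2); (5, 7); (8, 10); (13, 14)];
      [:: (2, 4); (3, 5); (10, 12); (11, 13)];
      [:: (4, 6); (5, 8); (7, 10); (9, 11)]]%N i.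

(** The number of simple roots separating a weight from the highest one, which
    has index 15. *)
Definition spin_depth (l : nat) : nat :=
  nth 0%N [:: 10; 9; 8; 7; 7; 6; 6; 5; 5; 4; 4; 3; 3; 2; 1; 0]%N l.

(** The sign is that of the brackets [[e_i, x]] in the basis [tangent_vector],
    built up from brackets [[x, e_i]]. *)
Definition spinE (i : nat) : sparse := [seq (e, -1) | e <- spin_edges i].

Definition spinH (i : nat) : sparse := [seq ((l, l), spin_wt i l) | l <- iota 0 16].

Definition spin_sq_check : bool :=
  all (fun i => sin 16 (spinE i) && seqb (smul (spinE i) (spinE i)) [::]) (iota 0 6).

Definition spin_wt_check : bool :=
  all (fun i => all (fun j => all (fun e =>
    spin_wt j e.2 == spin_wt j e.1 + cartanE6 i j) (spin_edges i)) (iota 0 6)) (iota 0 6).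

Definition spin_comm_check : bool :=
  all (fun i => all (fun k =>
    seqb (sbrack (strans (spinE k)) (spinE i)) (if i == k then spinH i else [::]))
    spin_nodes) spin_nodes.

Definition spin_depth_check : bool :=
  all (fun i => all (fun e => spin_depth e.1 == (spin_depth e.2).+1) (spin_edges i))
    (iota 0 6).

Lemma spin_sq : spin_sq_check. Proof. by vm_compute. Qed.
Lemma spin_wt_ok : spin_wt_check. Proof. by vm_compute. Qed.
Lemma spin_comm : spin_comm_check. Proof. by vm_compute. Qed.
Lemma spin_depth_ok : spin_depth_check. Proof. by vm_compute. Qed.

Section Spin.
Variable K : numClosedFieldType.
Local Notation S := {mpoly K[16]}.

Definition Emx (i : nat) : 'M[K]_16 := smx K 16 (spinE i).
Definition spw (j : 'I_6) (l : 'I_16) : int := spin_wt j l.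

Lemma spinE_in (i : 'I_6) : sin 16 (spinE i).
Proof. by have /andP[] := all_ord spin_sq i. Qed.

Lemma Emx_sq (i : 'I_6) : Emx i *m Emx i = 0.
Proof.
have /andP[si /(smx_eq K 16)] := all_ord spin_sq i.
by rewrite smx_mul // smx_nil.
Qed.

Lemma Emx_real i l m : (Emx i l m)^* = Emx i l m.
Proof. by rewrite mxE -[LHS]/(Num.conj _) rmorph_int. Qed.

Lemma Emx_edge i l m : Emx i l m != 0 ->
  (nat_of_ord l, nat_of_ord m) \in spin_edges i.
Proof. by move/smx_neq0; rewrite -map_comp map_id. Qed.

Lemma Emx_wt (i j : 'I_6) l m : Emx i l m != 0 -> spw j m = spw j l + cartanE6 i j.
Proof.
move/Emx_edge => lm; apply/eqP.
exact: (allP (all_ord (all_ord spin_wt_ok i) j) _ lm).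
Qed.

Lemma Emx_depth (i : 'I_6) l m : Emx i l m != 0 -> spin_depth l = (spin_depth m).+1.
Proof.
by move/Emx_edge => lm; apply/eqP; apply: (allP (all_ord spin_depth_ok i) _ lm).
Qed.

Lemma smx_spinH (i : 'I_6) : smx K 16 (spinH i) = cartan K (spw i).
Proof. exact: smx_diag. Qed.

Lemma Emx_comm (i k : 'I_6) : i != ord0 -> k != ord0 ->
  (Emx k)^T *m Emx i - Emx i *m (Emx k)^T = if i == k then cartan K (spw i) else 0.
Proof.
move=> i0 k0; have spn (u : 'I_6) : u != ord0 -> nat_of_ord u \in spin_nodes.
  by case: u => [[|[|[|[|[|[|]]]]]] ?].
have ti : sin 16 (strans (spinE k)) by rewrite sin_trans spinE_in.
rewrite -smx_trans -smx_brack ?spinE_in //.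
rewrite (smx_eq K 16 (allP (allP spin_comm _ (spn _ i0)) _ (spn _ k0))).
by rewrite -val_eqE; case: ifP => _; rewrite ?smx_nil ?smx_spinH.
Qed.
End Spin.

(** * Highest weight vectors of the symmetric algebra of the half-spin module *)

(** For [l] other than 6 and 15: simple roots, numbered from 0, whose sum is the
    difference between weight [l] and weight 15 if this difference is a root, and
    between weight [l] and weight 6 otherwise. *)
Definition root_word (l : nat) : seq nat := nth [::]
  [:: [:: 5; 4; 3; 2]; [:: 5; 4; 3]; [:: 5; 4]; [:: 1; 3; 4; 2; 3; 5; 4]; [:: 5];
      [:: 1; 3; 4; 2; 3; 5]; [::]; [:: 1; 3; 4; 2; 5]; [:: 1; 3; 4; 2; 3];
      [:: 1; 3; 4; 5]; [:: 1; 3; 4; 2]; [:: 1; 3; 4]; [:: 1; 3; 2]; [:: 1; 3];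
      [:: 1]; [::]]%N l.

Definition root_vector (l : nat) : sparse :=
  if root_word l is i :: s then foldl (fun r j => sbrack r (spinE j)) (spinE i) s
  else [::].

(** The conditions under which the coordinates in [s] can be cleared one by one by
    means of the nonzero coordinate [piv].  For each [l] in [s] the root vector has
    square zero; its row [l] has the single nonzero entry [piv], so that a multiple
    of it clears coordinate [l]; it has no other nonzero row in [s] and none in
    [fixed], so those coordinates do not change; and its rows in [kept] involve
    only columns in [kept], so that coordinates which vanish there still do. *)
Definition clear_check (piv : nat) (fixed kept s : seq nat) : bool :=
  all (fun l => let g := root_vector l in
    [&& (l < 16)%N, all (fun i => i \in spin_nodes) (root_word l), seqb (smul g g) [::],
        scoef g l piv != 0,
        all (fun m => (m == piv) || (scoef g l m == 0)) (iota 0 16),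
        all (fun k => (k == l) || all (fun m => scoef g k m == 0) (iota 0 16)) s,
        all (fun k => all (fun m => scoef g k m == 0) (iota 0 16)) fixed
      & all (fun k => all (fun m => (m \in kept) || (scoef g k m == 0)) (iota 0 16)) kept])
  s.

Definition cleared15 : seq nat := [:: 3; 5; 7; 8; 9; 10; 11; 12; 13; 14]%N.
Definition cleared6 : seq nat := [:: 0; 1; 2; 4]%N.

Lemma clear_check15 : clear_check 15 [:: 15] [::] cleared15. Proof. by vm_compute. Qed.
Lemma clear_check6 : clear_check 6 [:: 15; 6] cleared15 cleared6. Proof. by vm_compute. Qed.

Lemma lsub_fix (K : fieldType) n (A : 'M[K]_n) t p : [pchar K] =i pred0 ->
  A *m A = 0 -> der A p = 0 -> lsub (1%:M + t *: A) p = p.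
Proof.
move=> K0 A2 Ap; have [m /(_ m.+1 t (leqnSn m)) ->] := lsub_exp K0 A2 p.
rewrite big_ord_recl /= fact0 invr1 !scale1r big1 ?addr0 // => k _.
rewrite -iterS iterSr Ap (_ : iter k (der A) 0 = 0) ?scaler0 //.
by elim: (k : nat) => //= k' ->; rewrite der0.
Qed.

(** A polynomial function is zero if it vanishes everywhere: the polynomials
    vanishing everywhere are stable under the torus, and a monomial does not
    vanish at the point with all coordinates 1. *)
Lemma meval_eq0 (K : numClosedFieldType) n (p : {mpoly K[n]}) :
  (forall x, p.@[x] = 0) -> p = 0.
Proof.
move=> p0; apply/eqP; apply: contraT => pn0.
pose N (q : {mpoly K[n]}) := forall x, q.@[x] = 0.
have sN : subspace N.
  split=> [x|c x y Nx Ny z]; first by rewrite meval0.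
  by rewrite mevalD mevalZ Nx Ny mulr0 addr0.
pose w (j i : 'I_n) : int := (i == j)%:Z.
have NT j t q : t != 0 -> N q -> N (lsub (tor (w j) t) q).
  by move=> _ Nq x; rewrite lsub_meval.
have [q [mu [Nq q0 wq]]] := exists_weightvec sN NT p0 pn0.
have wE j (m : 'X_{1..n}) : mwt (w j) m = (m j)%:Z.
  rewrite /mwt (bigD1 j) //= big1 ?addr0 => [|i /negPf ij].
    by rewrite /w eqxx pmulrn mulrzz mul1r.
  by rewrite /w ij mul0rn.
have qE : q = q@_(mlead q) *: 'X_[mlead q].
  apply/mpolyP => m; rewrite mcoeffZ mcoeffX.
  case: eqP => [->|ne]; rewrite ?mulr1 // mulr0; apply/eqP; apply: contraT => qm.
  case: ne; apply/mnmP => j; have := wq j m qm.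
  have := wq j (mlead q); rewrite mleadc_eq0 => /(_ q0) <-.
  by rewrite !wE => -[].
have := Nq (fun=> 1); rewrite qE mevalZ mevalX big1 ?mulr1 => [|i _]; last exact: expr1n.
by move/eqP; rewrite mleadc_eq0 (negPf q0).
Qed.

(** Hidden behind an opaque proof, so that these indices are only compared through
    their values. *)
Lemma spin_ord_subproof (k : nat) : {i : 'I_16 | (k < 16)%N -> i = k :> nat}.
Proof. by exists (inord k) => k16; apply: inordK. Qed.

Definition spin_ord (k : nat) : 'I_16 := sval (spin_ord_subproof k).

Lemma spin_ordK k : (k < 16)%N -> spin_ord k = k :> nat.
Proof. exact: (svalP (spin_ord_subproof k)). Qed.

Lemma exprz2_inj (K : numFieldType) (a b : int) : 2%:R ^ a = 2%:R ^ b :> K -> a = b.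
Proof.
have two0 : 2%:R != 0 :> K by rewrite pnatr_eq0.
have H (k : nat) : 2%:R ^+ k.+1 != 1 :> K.
  by rewrite -natrX pnatr_eq1 -(expn0 2) eqn_exp2l.
move=> E; apply/eqP; rewrite -subr_eq0.
have : 2%:R ^ (a - b) = 1 :> K by rewrite expfzDr // E -expfzDr // subrr expr0z.
case: (a - b) => [[|k]|k] //; first by move=> /eqP; rewrite (negPf (H k)).
by rewrite NegzE -exprz_inv /= => /eqP; rewrite -exprnP exprVn invr_eq1 (negPf (H k)).
Qed.

Section SpinHighestWeights.
Variable K : numClosedFieldType.
Local Notation S := {mpoly K[16]}.
Local Notation o := spin_ord.

Definition Xtop : S := 'X_(o 15).

(** The symmetric square of the half-spin module contains the ten-dimensional
    vector representation of [Spin(10)]; this is its highest weight vector. *)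
Definition quad : S :=
  'X_(o 6) * 'X_(o 15) - 'X_(o 8) * 'X_(o 14) + 'X_(o 10) * 'X_(o 13)
  - 'X_(o 11) * 'X_(o 12).

Definition hwv (c : nat * nat) : S := Xtop ^+ c.1 * quad ^+ c.2.

(** Annihilated by the positive part of the Levi Lie algebra. *)
Definition killed (p : S) : Prop := forall i, i \in spin_nodes -> der (Emx K i) p = 0.

Lemma linform_Emx (i l : nat) : (l < 16)%N -> sin 16 (spinE i) ->
  linform (Emx K i (o l)) =
  foldr (fun e r => if e.1 == l then - 'X_(o e.2) + r else r) 0 (spin_edges i) :> S.
Proof.
move=> l16; rewrite /Emx /spinE /linform; elim: (spin_edges i) => [_|e s IH /= /andP[ein sn]].
  by rewrite /= big1 // => j _; rewrite mxE scale0r.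
rewrite -(IH sn) -cat1s smx_cat.
transitivity (\sum_j (smx K 16 [:: (e, -1)] (o l) j *: 'X_j
   + smx K 16 [seq (e, -1) | e <- s] (o l) j *: 'X_j) : S).
  by apply: eq_bigr => j _; rewrite mxE scalerDl.
rewrite big_split /=; case: e ein => [k m] /= /andP[k16 m16]; rewrite smx1.
case: eqP => [kl|kl]; last first.
  rewrite big1 ?add0r // => j _; rewrite mxE spin_ordK //.
  by case: eqP kl => //= _ _; rewrite scale0r.
congr (_ + _); rewrite (bigD1 (o m)) //= big1 ?addr0 => [|j jm].
  by rewrite mxE !spin_ordK // kl !eqxx scaleN1r.
rewrite mxE ifF ?scale0r //; apply/negbTE; apply: contra jm => /andP[_ /eqP mj].
by apply/eqP/val_inj; rewrite /= spin_ordK // mj.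
Qed.

Lemma killed_Xtop : killed Xtop.
Proof.
move=> i; rewrite !inE /Xtop derX.
move=> /or4P[/eqP->|/eqP->|/eqP->|/orP[/eqP->|/eqP->]];
  by rewrite linform_Emx.
Qed.

Lemma killed_quad : killed quad.
Proof.
move=> i Hi; have D l : (l < 16)%N -> der (Emx K i) 'X_(o l) =
    foldr (fun e r => if e.1 == l then - 'X_(o e.2) + r else r) 0 (spin_edges i) :> S.
  by move=> l16; rewrite derX linform_Emx //; move: Hi; rewrite !inE;
    do 4![case/orP => [/eqP->//|]] => /eqP->.
rewrite /quad !(raddfB, raddfD) /= !derM.
rewrite (D 6 isT) (D 8 isT) (D 10 isT) (D 11 isT) (D 12 isT) (D 13 isT) (D 14 isT) (D 15 isT).
move: Hi {D}; rewrite !inE.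
move=> /or4P[/eqP->|/eqP->|/eqP->|/orP[/eqP->|/eqP->]];
  rewrite /=; ring.
Qed.

Lemma killedM p q : killed p -> killed q -> killed (p * q).
Proof. by move=> kp kq i Hi; rewrite derM kp // kq // mulr0 mul0r addr0. Qed.

Lemma killed1 : killed 1.
Proof. by move=> i _; rewrite derC1. Qed.

Lemma killed_hwv c : killed (hwv c).
Proof.
have kX p k : killed p -> killed (p ^+ k).
  by move=> kp; elim: k => [|k IH]; rewrite ?expr0 ?exprS; [apply: killed1 | apply: killedM].
by apply: killedM; apply: kX; [apply: killed_Xtop | apply: killed_quad].
Qed.

(** The coordinates of [c.1] times [lambda_2] plus [c.2] times
    [lambda_1 + lambda_6], with indices starting from 0. *)
Definition eta (c : nat * nat) (j : 'I_6) : int :=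
  c.1%:Z * (j == 1 :> nat) + c.2%:Z * ((j == 0 :> nat) || (j == 5 :> nat)).

(** The powers of 2 are distinct, so the value [t = 2] alone determines the weight. *)
Lemma tor_weightvec (p : S) mu :
  (forall j t, t != 0 -> lsub (tor (spw j) t) p = t ^ mu j *: p) -> weightvec spw p mu.
Proof.
move=> H j m pm; have two0 : 2%:R != 0 :> K by rewrite pnatr_eq0.
have /mpolyP/(_ m) := H j 2%:R two0; rewrite mcoeff_tor // mcoeffZ.
by move/(mulIf pm)/exprz2_inj.
Qed.

Lemma tor_X j t l : lsub (tor (spw j) t) 'X_l = t ^ spw j l *: 'X_l :> S.
Proof.
rewrite lsubX /linform (bigD1 l) //= big1 ?addr0 => [|k /negPf kl].
  by rewrite !mxE eqxx mulr1n.
by rewrite !mxE eq_sym kl mulr0n scale0r.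
Qed.

Lemma tor_Xtop j t : lsub (tor (spw j) t) Xtop = t ^ eta (1, 0)%N j *: Xtop.
Proof.
rewrite /Xtop tor_X /spw spin_ordK //; congr (t ^ _ *: _).
by case: j => [[|[|[|[|[|[|]]]]]] ?].
Qed.

Lemma tor_quad j t : t != 0 -> lsub (tor (spw j) t) quad = t ^ eta (0, 1)%N j *: quad.
Proof.
move=> t0; have E k l : (k, l) \in [:: (6, 15); (8, 14); (10, 13); (11, 12)]%N ->
    lsub (tor (spw j) t) ('X_(o k) * 'X_(o l)) = t ^ eta (0, 1)%N j *: ('X_(o k) * 'X_(o l)).
  move=> kl; rewrite rmorphM /= !tor_X -scalerAl -scalerAr scalerA -expfzDr //.
  congr (t ^ _ *: _); move: kl; rewrite !inE /spw.
  by case/or4P => /eqP [-> ->]; rewrite !spin_ordK //; case: j => [[|[|[|[|[|[|]]]]]] ?].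
by rewrite /quad !(raddfB, raddfD) /= !E // -!scalerBr -scalerDr -scalerBr.
Qed.

Lemma tor_hwv c j t : t != 0 -> lsub (tor (spw j) t) (hwv c) = t ^ eta c j *: hwv c.
Proof.
move=> t0; rewrite /hwv rmorphM !rmorphXn /= tor_Xtop tor_quad // !exprZn.
rewrite -scalerAl -scalerAr scalerA; congr (_ *: _).
rewrite !exprnP !exprz_exp -expfzDr //; congr (t ^ _).
by rewrite /eta /=; ring.
Qed.

Lemma hwv_weight c : weightvec spw (hwv c) (eta c).
Proof. by apply: tor_weightvec => j t t0; apply: tor_hwv. Qed.

Lemma Xtop_homog : Xtop \is 1.-homog.
Proof. by rewrite dhomogX /= mdeg1. Qed.

Lemma quad_homog : quad \is 2.-homog.
Proof.
have E k l : 'X_(o k) * 'X_(o l) \is 2.-homog.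
  by rewrite -mpolyXD dhomogX /= mdegD !mdeg1.
by rewrite !(rpredB, rpredD) ?E.
Qed.

Lemma hwv_homog c : hwv c \is (c.1 + 2 * c.2)%N.-homog.
Proof.
apply: dhomogM; last exact: dhomogMn quad_homog.
by have := dhomogMn c.1 Xtop_homog; rewrite mul1n.
Qed.

(** The normal form of a point: [a] is its highest coordinate, and [b] the one
    which is multiplied by it in [quad]. *)
Definition pt (a b : K) (i : 'I_16) : K :=
  if i == 15 :> nat then a else if i == 6 :> nat then b else 0.

Lemma Xtop_eval x : Xtop.@[x] = x (o 15).
Proof. exact: mevalXU. Qed.

Lemma quad_eval x : quad.@[x] = x (o 6) * x (o 15) - x (o 8) * x (o 14)
  + x (o 10) * x (o 13) - x (o 11) * x (o 12).
Proof. by rewrite /quad !(mevalB, mevalD, mevalM, mevalXU). Qed.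

Lemma hwv_eval c x : (hwv c).@[x] = x (o 15) ^+ c.1 * quad.@[x] ^+ c.2.
Proof. by rewrite /hwv mevalM !rmorphXn /= Xtop_eval. Qed.

Lemma Xtop_neq0 : Xtop != 0.
Proof.
apply/eqP => /(congr1 (fun p => p.@[fun=> 1])); rewrite Xtop_eval meval0.
by move/eqP; rewrite oner_eq0.
Qed.

Lemma quad_neq0 : quad != 0.
Proof.
apply/eqP => /(congr1 (fun p => p.@[pt 1 1])); rewrite quad_eval meval0 /pt !spin_ordK //=.
by rewrite mulr1 !mul0r !subr0 addr0 => /eqP; rewrite oner_eq0.
Qed.

Lemma hwv_neq0 c : hwv c != 0.
Proof. by rewrite mulf_neq0 // expf_neq0 ?Xtop_neq0 ?quad_neq0. Qed.

Lemma eta_inj c d : eta c =1 eta d -> c = d.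
Proof.
case: c d => [a b] [a' b'] H; have := H (inord 0); have := H (inord 1).
rewrite /eta !inordK //= !mulr1 !mulr0 !addr0 !add0r.
by move=> [->] [->].
Qed.
End SpinHighestWeights.

(** * Classification of the highest weight vectors *)

Section Classification.
Variable K : numClosedFieldType.
Local Notation S := {mpoly K[16]}.
Local Notation o := spin_ord.

Definition rv (l : nat) : 'M[K]_16 := smx K 16 (root_vector l).

(** Root vectors are iterated brackets of the [Emx i], so they kill what these
    kill. *)
Lemma root_vector_killed (p : S) l : killed p ->
  all (fun i => i \in spin_nodes) (root_word l) ->
  sin 16 (root_vector l) /\ der (rv l) p = 0.
Proof.
have spin i : i \in spin_nodes -> sin 16 (spinE i).
  by rewrite !inE; do 4![case/orP => [/eqP->//|]] => /eqP->.
move=> kp; rewrite /rv /root_vector; case: (root_word l) => [|i s] /=.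
  move=> _; split=> //.
  by rewrite smx_nil -(scale0r (0 : 'M_16)) der_mxZ scale0r.
move=> /andP[Hi]; elim/last_ind: s => [_|s j IH].
  by split; [apply: spin | apply: kp].
rewrite all_rcons => /andP[Hj /IH [sn dp]]; rewrite -cats1 foldl_cat /=.
split; first by rewrite sin_brack ?spin.
by rewrite smx_brack ?spin // -der_comm dp (kp j Hj) !der0 subrr.
Qed.

Definition mv (A : 'M[K]_16) t (x : 'I_16 -> K) i : K :=
  x i + t * \sum_j A i j * x j.

Lemma eval_mv (p : S) l t x : killed p ->
  all (fun i => i \in spin_nodes) (root_word l) ->
  seqb (smul (root_vector l) (root_vector l)) [::] ->
  p.@[mv (rv l) t x] = p.@[x].
Proof.
move=> kp wl /(smx_eq K 16); have [sn dp] := root_vector_killed kp wl.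
rewrite smx_mul // smx_nil => sq0.
rewrite -[in RHS](lsub_fix t (pchar_num K) sq0 dp) lsub_meval.
apply: meval_eq => i; rewrite /mv [RHS](eq_bigr (fun j => (i == j)%:R * x j + t * (rv l i j * x j))).
  rewrite big_split /= mulr_sumr; congr (_ + _).
  rewrite (bigD1 i) //= big1 ?addr0 ?eqxx ?mul1r // => j /negPf ji.
  by rewrite eq_sym ji mul0r.
by move=> j _; rewrite !mxE mulrDl mulrA.
Qed.

(** Each coordinate [l] in [s] is cleared by the root vector number [l]; the value
    of a killed polynomial does not change. *)
Lemma clear_coordinates (piv : nat) (fixed kept s : seq nat) :
  clear_check piv fixed kept s -> (piv < 16)%N -> piv \in fixed ->
  forall x : 'I_16 -> K, x (o piv) != 0 ->
    (forall i : 'I_16, nat_of_ord i \in kept -> x i = 0) ->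
  exists y : 'I_16 -> K,
    [/\ forall p : S, killed p -> p.@[y] = p.@[x],
        forall i : 'I_16, nat_of_ord i \in fixed -> y i = x i,
        forall i : 'I_16, nat_of_ord i \in kept -> y i = 0
      & forall i : 'I_16, nat_of_ord i \in s -> y i = 0].
Proof.
move=> /allP chk p16 pfix x xp xk.
have : {subset s <= s} by [].
elim: {1 3}s => [_|l s' IH sub]; first by exists x.
case: IH => [k ks|y [py fy ky sy]]; first by apply: sub; rewrite inE ks orbT.
have ls : l \in s by apply: sub; rewrite inE eqxx.
have /and5P[l16 wl sq piv0 /and4P[rowl rows rowf rowk]] := chk _ ls.
have row0 (i : 'I_16) : all (fun m => scoef (root_vector l) i m == 0) (iota 0 16) ->
    forall t z, mv (rv l) t z i = z i.
  move=> /all_ord H t z; rewrite /mv big1 ?mulr0 ?addr0 // => j _.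
  by rewrite mxE (eqP (H j)) mul0r.
have yp : y (o piv) = x (o piv) by apply: fy; rewrite spin_ordK.
pose e : K := (scoef (root_vector l) l piv)%:~R.
have e0 : e != 0 by rewrite intr_eq0.
pose t := - (y (o l) / (e * x (o piv))).
have cleared : mv (rv l) t y (o l) = 0.
  rewrite /mv (bigD1 (o piv)) //= big1 ?addr0 => [|j jp].
    by rewrite mxE !spin_ordK // -/e yp /t mulNr divfK ?subrr // mulf_neq0.
  rewrite mxE spin_ordK //; have /orP[/eqP jp'|/eqP ->] := all_ord rowl j.
    by case/eqP: jp; apply: val_inj; rewrite /= spin_ordK.
  by rewrite mul0r.
exists (mv (rv l) t y); split.
- by move=> p kp; rewrite eval_mv // py.
- by move=> i Hi; rewrite row0 ?fy //; apply: (allP rowf).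
- move=> i Hi; rewrite /mv ky // big1 ?mulr0 ?addr0 // => j _.
  have /orP[jk|/eqP H] := all_ord (allP rowk _ Hi) j; first by rewrite ky // mulr0.
  by rewrite mxE H mul0r.
- move=> i; rewrite inE => /predU1P[il|Hi].
    by have -> : i = o l by apply: val_inj; rewrite /= spin_ordK.
  have is' : nat_of_ord i \in s by apply: sub; rewrite inE Hi orbT.
  have /orP[/eqP il|H] := allP rows _ is'; last by rewrite row0 ?sy.
  by have -> : i = o l by apply: val_inj; rewrite /= spin_ordK.
Qed.

(** The highest coordinate clears ten others.  Then [quad] has the single term
    [x 6 * x 15], so coordinate 6 is nonzero and clears the four remaining ones. *)
Lemma killed_eval (p : S) x : killed p -> x (o 15) != 0 -> (quad K).@[x] != 0 ->
  p.@[x] = p.@[pt (x (o 15)) ((quad K).@[x] / x (o 15))].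
Proof.
move=> kp x15 qx.
have [|y [py fy _ y1]] := clear_coordinates clear_check15 isT isT x15; first by [].
have y15 : y (o 15) = x (o 15) by apply: fy; rewrite spin_ordK.
have qy : y (o 6) * x (o 15) = (quad K).@[x].
  rewrite -py; last exact: killed_quad.
  rewrite quad_eval y15 (y1 (o 8)) ?(y1 (o 10)) ?(y1 (o 11)) ?spin_ordK //.
  by rewrite !mul0r !subr0 addr0.
have y6 : y (o 6) != 0 by apply: contraNneq qx => y6; rewrite -qy y6 mul0r.
have [z [pz fz kz z2]] := clear_coordinates clear_check6 isT isT y6 y1.
rewrite -py // -pz //; apply: meval_eq => i; rewrite /pt.
case: eqP => [i15|n15].
  have -> : i = o 15 by apply: val_inj; rewrite /= spin_ordK.
  by rewrite fz ?spin_ordK.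
case: eqP => [i6|n6].
  have -> : i = o 6 by apply: val_inj; rewrite /= spin_ordK.
  by rewrite fz ?spin_ordK // -qy mulfK.
have [i1|] := boolP (nat_of_ord i \in cleared15); first exact: kz.
move=> i1; apply: z2; move: n15 n6 i1 (ltn_ord i).
by case: (nat_of_ord i) => [|[|[|[|[|[|[|[|[|[|[|[|[|[|[|[|]]]]]]]]]]]]]]]].
Qed.

(** The torus brings the two nonzero coordinates of the normal form to 1.  The
    weights number 15 and 6 pair to 1 and -1 with the coroot number 1, and to 0
    and 1 with the coroot number 0. *)
Lemma killed_weight_eval (p : S) mu : killed p -> weightvec spw p mu ->
  forall x, x (o 15) != 0 -> (quad K).@[x] != 0 ->
  p.@[x] = p.@[pt 1 1] * x (o 15) ^ mu (inord 1) * (quad K).@[x] ^ mu (inord 0).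
Proof.
move=> kp wp x x15 qx; rewrite killed_eval //.
have T j t y : t != 0 -> p.@[fun i => t ^ spw j i * y i] = t ^ mu j * p.@[y].
  move=> t0; rewrite -mevalZ -(weightvec_tor j t0 wp) lsub_meval.
  apply: meval_eq => i; rewrite (bigD1 i) //= big1 ?addr0 => [|k /negPf ki].
    by rewrite !mxE eqxx mulr1n.
  by rewrite !mxE eq_sym ki mulr0n mul0r.
set u := x (o 15); set q := (quad K).@[x].
have u0 : u != 0 by []. have q0 : q != 0 by [].
have -> : p.@[pt u (q / u)] = u ^ mu (inord 1) * p.@[pt 1 q].
  rewrite -T //; apply: meval_eq => i; rewrite /pt /spw inordK //.
  case: eqP => [->|_]; first by rewrite mulr1 expr1z.
  by case: eqP => [->|_]; [rewrite mulrC -exprN1 | rewrite mulr0].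
have -> : p.@[pt 1 q] = q ^ mu (inord 0) * p.@[pt 1 1].
  rewrite -T //; apply: meval_eq => i; rewrite /pt /spw inordK //.
  case: eqP => [->|_]; first by rewrite mulr1 expr0z.
  by case: eqP => [->|_]; [rewrite mulr1 expr1z | rewrite mulr0].
by rewrite mulrA mulrC mulrA.
Qed.

Lemma generic_eq (p q : S) :
  (forall x, x (o 15) != 0 -> (quad K).@[x] != 0 -> p.@[x] = q.@[x]) -> p = q.
Proof.
move=> H; apply/eqP; rewrite -subr_eq0.
have : (p - q) * (Xtop K * quad K) = 0.
  apply: meval_eq0 => x; rewrite !mevalM mevalB Xtop_eval.
  have [->|x15] := eqVneq (x (o 15)) 0; first by rewrite mul0r mulr0.
  have [->|qx] := eqVneq (quad K).@[x] 0; first by rewrite !mulr0.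
  by rewrite H // subrr mul0r.
by move/eqP; rewrite !mulf_eq0 (negPf (Xtop_neq0 K)) (negPf (quad_neq0 K)) !orbF.
Qed.

(** By [killed_weight_eval], [p] is a multiple of [Xtop ^ a * quad ^ b] for integers
    [a] and [b].  Clearing denominators gives an identity of polynomials, and its
    value at a point of exactly one of the hypersurfaces [Xtop = 0] and [quad = 0]
    shows that [a] and [b] are not negative. *)
Lemma killed_weight_hwv (p : S) mu : p != 0 -> killed p -> weightvec spw p mu ->
  exists c z, p = z *: hwv K c.
Proof.
move=> p0 kp wp; set z := p.@[pt 1 1]; have E := killed_weight_eval kp wp.
pose pos (a : int) : nat := if a is Posz k then k else 0%N.
pose neg (a : int) : nat := if a is Negz k then k.+1 else 0%N.
have posneg (v : K) a : v != 0 -> v ^ a * v ^+ neg a = v ^+ pos a.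
  case: a => k v0; rewrite /pos /neg /=; first by rewrite expr0 mulr1.
  by rewrite NegzE -exprnN expr0 mulVf // expf_neq0.
pose a := mu (inord 1); pose b := mu (inord 0).
have Epoly : p * hwv K (neg a, neg b) = z *: hwv K (pos a, pos b).
  apply: generic_eq => x x15 qx; rewrite mevalM mevalZ !hwv_eval E //= -/a -/b.
  rewrite -!posneg //; ring.
have z0 : z != 0.
  apply: contraNneq p0 => z0; move: Epoly; rewrite z0 scale0r => /eqP.
  by rewrite mulf_eq0 (negPf (hwv_neq0 K _)) orbF.
(* A point where [Xtop] vanishes and [quad] is 1. *)
have na : neg a = 0%N.
  case Ea: a => [//|k]; move: Epoly; rewrite Ea /= => /(congr1 (fun p => p.@[
     fun i : 'I_16 => if i == 11 :> nat then 1 else if i == 12 :> nat then -1 else 0])).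
  rewrite mevalM mevalZ !hwv_eval quad_eval !spin_ordK //= exprS.
  rewrite !(mul0r, mulr0, addr0, add0r, oppr0, mulrN1, opprK, mul1r, expr0, expr1n, mulr1).
  by move/eqP; rewrite eq_sym (negPf z0).
(* A point where [quad] vanishes and [Xtop] is 1. *)
have nb : neg b = 0%N.
  case Eb: b => [//|k]; move: Epoly; rewrite Eb /= => /(congr1 (fun p => p.@[pt 1 0])).
  rewrite mevalM mevalZ !hwv_eval quad_eval /pt !spin_ordK //= exprS !expr1n.
  rewrite !(mul0r, mulr0, subr0, addr0) expr0 !mulr1.
  by move/eqP; rewrite eq_sym (negPf z0).
exists (pos a, pos b), z; rewrite -Epoly na nb.
by rewrite /hwv !expr0 !mulr1.
Qed.
End Classification.

(** * Lie algebras generated by matrices *)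

Section LieClosure.
Variables (K : fieldType) (n : nat).
Local Notation M := 'M[K]_n.

Definition brk (x y : M) : M := x *m y - y *m x.

Lemma brk_jacobi x y z : brk (brk x y) z = brk x (brk y z) - brk y (brk x z).
Proof.
rewrite /brk !(mulmxBl, mulmxBr) !mulmxA !opprB !addrA.
set a := x *m y *m z; set b := y *m x *m z; set c := z *m x *m y.
set d := z *m y *m x; set e := x *m z *m y; set f := y *m z *m x.
rewrite -[RHS]addr0; apply/eqP; rewrite -subr_eq0; apply/eqP/matrixP => i j.
by rewrite !mxE; ring.
Qed.

Lemma brkC x y : brk x y = - brk y x.
Proof. by rewrite /brk opprB. Qed.

Lemma brkDr x y c z : brk x (c *: y + z) = c *: brk x y + brk x z.
Proof.
rewrite /brk mulmxDr mulmxDl -scalemxAr -scalemxAl scalerBr opprD.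
by rewrite addrACA.
Qed.

Lemma brkDl x y c z : brk (c *: y + z) x = c *: brk y x + brk z x.
Proof. by rewrite brkC brkDr opprD -scalerN -!brkC. Qed.

Lemma brk0r x : brk x 0 = 0.
Proof. by rewrite /brk mulmx0 mul0mx subrr. Qed.

Lemma brk0l x : brk 0 x = 0.
Proof. by rewrite brkC brk0r oppr0. Qed.

Lemma brk_sumr x I (r : seq I) (P : pred I) (f : I -> M) :
  brk x (\sum_(i <- r | P i) f i) = \sum_(i <- r | P i) brk x (f i).
Proof.
elim/big_rec2: _ => [|i y z _ <-]; first exact: brk0r.
by have := brkDr x (f i) 1 z; rewrite !scale1r.
Qed.

Lemma brkZr x c y : brk x (c *: y) = c *: brk x y.
Proof. by have := brkDr x y c 0; rewrite !addr0 brk0r addr0. Qed.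

Lemma brkZl x c y : brk (c *: x) y = c *: brk x y.
Proof. by rewrite brkC brkZr -scalerN -brkC. Qed.

Lemma brk_suml x I (r : seq I) (P : pred I) (f : I -> M) :
  brk (\sum_(i <- r | P i) f i) x = \sum_(i <- r | P i) brk (f i) x.
Proof.
by rewrite brkC brk_sumr -sumrN; apply: eq_bigr => i _; rewrite -brkC.
Qed.

Definition lie_step (U : {vspace M}) : {vspace M} :=
  (U + <<[seq x *m y - y *m x | x <- vbasis U, y <- vbasis U]>>)%VS.

Lemma lie_stepS U : (U <= lie_step U)%VS.
Proof. exact: addvSl. Qed.

Lemma lie_step_brk (U : {vspace M}) x y : x \in U -> y \in U -> brk x y \in lie_step U.
Proof.
move=> xU yU; rewrite (coord_vbasis xU) (coord_vbasis yU) brk_suml.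
apply: memv_suml => i _; rewrite brkZl brk_sumr memvZ //; apply: memv_suml => j _.
rewrite brkZr memvZ //; apply: (subvP (addvSr _ _)); apply: memv_span.
by apply: allpairs_f; rewrite mem_nth ?size_tuple.
Qed.

Definition lie_chain (X : seq M) k : {vspace M} := iter k lie_step <<X>>%VS.

Lemma lie_chain_mono X k m : (k <= m)%N -> (lie_chain X k <= lie_chain X m)%VS.
Proof.
move=> /subnK <-; elim: (m - k)%N => //= j IH.
exact: subv_trans IH (lie_stepS _).
Qed.

(** Until the chain becomes stationary the dimension grows at each step, and it
    cannot exceed [n * n]. *)
Lemma lie_chain_stationary X : lie_chain X (n * n).+1 = lie_chain X (n * n).
Proof.
suff [k kn E] : exists2 k, (k <= n * n)%N & lie_chain X k.+1 = lie_chain X k.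
  have E' m : lie_chain X (m + k) = lie_chain X k.
    elim: m => // m IH; rewrite addSn.
    by rewrite -[RHS]E [LHS]/(lie_step (lie_chain X (m + k))) IH.
  rewrite -(subnK kn) E' -[LHS]/(lie_step (lie_chain X (n * n - k + k))) E'.
  exact: E.
apply: NNPP => none.
have dimS k : (k <= n * n)%N -> (k < \dim (lie_chain X k.+1))%N.
  elim: k => [|k IH] kn.
    rewrite lt0n dimv_eq0; apply/eqP => H1; apply: none; exists 0%N => //.
    apply/eqP; rewrite H1 eq_sym -subv0 -H1.
    exact: lie_chain_mono.
  have k1 : (k <= n * n)%N by apply: ltnW.
  apply: leq_ltn_trans (IH k1) _; rewrite ltn_neqAle dimvS ?andbT ?lie_chain_mono //.
  apply/eqP => H; apply: none; exists k.+1 => //; apply/esym/eqP.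
  by rewrite eqEdim lie_chain_mono //= H.
have := dimS _ (leqnn _); rewrite ltnNge.
by have /dimvS := subvf (lie_chain X (n * n).+1); rewrite dimvf /dim /= => ->.
Qed.

Lemma lie_closure_gen (X : seq M) x : x \in X -> x \in lie_closure X.
Proof.
by move=> xX; apply: (subvP (lie_chain_mono X (leq0n (n * n)))); apply: memv_span.
Qed.

Lemma lie_closure_brk (X : seq M) x y :
  x \in lie_closure X -> y \in lie_closure X -> brk x y \in lie_closure X.
Proof.
move=> xL yL; have := lie_step_brk xL yL.
by rewrite -[lie_step _]/(lie_chain X (n * n).+1) lie_chain_stationary.
Qed.

Lemma lie_closure_ind (X : seq M) (P : M -> Prop) : P 0 ->
  (forall c x y, P x -> P y -> P (c *: x + y)) ->
  (forall x y, P x -> P y -> P (brk x y)) -> (forall x, x \in X -> P x) ->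
  forall x, x \in lie_closure X -> P x.
Proof.
move=> P0 PL PB PX.
have Pspan s : (forall x, x \in s -> P x) -> forall x, x \in <<s>>%VS -> P x.
  move=> Ps x /(coord_span (X := in_tuple s)) ->.
  apply: (big_ind P) => //; first by move=> u v; have := PL 1 u v; rewrite scale1r.
  move=> i _; rewrite -[_ *: _]addr0; apply: PL => //.
  by apply: Ps; apply: mem_nth.
rewrite /lie_closure; elim: (n * n)%N => [|k IH] x /=; first exact: Pspan.
move=> /memv_addP [u uU [v vV ->]]; rewrite -[u]scale1r; apply: PL; first exact: IH.
apply: Pspan vV => z /allpairsP [[a b] /= [/vbasis_mem ain /vbasis_mem bin ->]].
by apply: PB; apply: IH.
Qed.

Lemma brk_conj (g : M) x y : g \in unitmx ->
  g *m brk x y *m invmx g = brk (g *m x *m invmx g) (g *m y *m invmx g).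
Proof.
move=> gu; rewrite /brk mulmxBr mulmxBl !mulmxA; congr (_ - _).
  by rewrite -(mulmxA (g *m x)) mulVmx // mulmx1.
by rewrite -(mulmxA (g *m y)) mulVmx // mulmx1.
Qed.

Lemma conjDr (g : M) c x y :
  g *m (c *: x + y) *m invmx g = c *: (g *m x *m invmx g) + g *m y *m invmx g.
Proof. by rewrite mulmxDr mulmxDl -scalemxAr -scalemxAl. Qed.

Lemma invmxM (g h : M) : g \in unitmx -> h \in unitmx ->
  invmx (g *m h) = invmx h *m invmx g.
Proof.
move=> gu hu; have ghu : g *m h \in unitmx by rewrite unitmx_mul gu.
apply: (can_inj (mulKmx ghu)); rewrite mulmxV // mulmxA -(mulmxA g) mulmxV //.
by rewrite mulmx1 mulmxV.
Qed.

Lemma conjM (g h : M) z : g \in unitmx -> h \in unitmx ->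
  g *m h *m z *m invmx (g *m h) = g *m (h *m z *m invmx h) *m invmx g.
Proof.
by move=> gu hu; rewrite invmxM // !mulmxA.
Qed.

Lemma exp_inv (A : M) t : A *m A = 0 -> (1%:M + t *: A) \in unitmx /\
  invmx (1%:M + t *: A) = 1%:M - t *: A.
Proof.
move=> A2; have H : (1%:M + t *: A) *m (1%:M - t *: A) = 1%:M.
  rewrite mulmxDl mul1mx mulmxBr mulmx1 -scalemxAl -scalemxAr A2 !scaler0 subr0.
  by rewrite subrK.
have [u _] := mulmx1_unit H; split=> //.
by apply: (can_inj (mulKmx u)); rewrite mulmxV // H.
Qed.

(** The exponential of the adjoint action of [t *: A], whose cube is zero. *)
Lemma conj_exp (A : M) t x : [pchar K] =i pred0 -> A *m A = 0 ->
  (1%:M + t *: A) *m x *m invmx (1%:M + t *: A)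
    = x + t *: brk A x + (t ^+ 2 / 2%:R) *: brk A (brk A x).
Proof.
move=> K0 A2; have [_ ->] := exp_inv t A2.
have two0 : 2%:R != 0 :> K by rewrite (proj1 (pcharf0P K) K0).
have -> : brk A (brk A x) = - 2%:R *: (A *m x *m A).
  rewrite /brk !(mulmxBl, mulmxBr) !mulmxA A2 mul0mx sub0r -[x *m A *m A]mulmxA A2 mulmx0 subr0.
  by rewrite scaleNr scaler_nat mulr2n opprD.
rewrite scalerA mulrN divfK // /brk !(mulmxDl, mulmxBr, mul1mx, mulmx1).
rewrite -!scalemxAl -!scalemxAr scalerBr.
apply/matrixP => i j; rewrite !mxE; ring.
Qed.

(** A matrix shifting the weights by [d] is an eigenvector of conjugation by the
    torus. *)
Lemma conj_diag (w : 'I_n -> int) (A : M) (d : int) t : t != 0 ->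
  (forall k m, A k m != 0 -> w k = w m + d) ->
  diag_mx (\row_k t ^ w k) *m A *m invmx (diag_mx (\row_k t ^ w k)) = t ^ d *: A.
Proof.
move=> t0 H; set D := diag_mx _.
have Du : D \in unitmx.
  by rewrite unitmxE det_diag unitfE prodf_seq_neq0; apply/allP => k _ /=; rewrite mxE expfz_neq0.
have -> : D *m A = (t ^ d *: A) *m D.
  rewrite mul_diag_mx mul_mx_diag; apply/matrixP => k m; rewrite !mxE.
  have [->|km] := eqVneq (A k m) 0; first by rewrite !(mulr0, mul0r).
  by rewrite (H k m km) expfzDr //; ring.
by rewrite -mulmxA mulmxV // mulmx1.
Qed.
End LieClosure.

Section Projections.
Variables (K : fieldType) (vT : vectType K) (U V : {vspace vT}).

Lemma addv_pi1_decomp w : w \in (U + V)%VS ->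
  exists2 q, q \in V & w = addv_pi1 U V w + q.
Proof. by move=> /addv_pi1_pi2 {1}<-; exists (addv_pi2 U V w); rewrite ?memv_pi2. Qed.

Lemma addv_pi1_eq0 w : w \in V -> w \in (U + V)%VS -> addv_pi1 U V w = 0.
Proof.
move=> wV /addv_pi1_pi2; rewrite addv_pi2_id // => /eqP.
by rewrite -subr_eq0 addrK => /eqP.
Qed.
End Projections.

(** * The quotient of the Lie algebras *)

(** The Chevalley generators and the root vectors are tabulated as sparse matrices,
    on which all the brackets that matter can be computed. *)
Definition edges27 (i : nat) : seq (nat * nat) := nth [::]
  [:: [:: (0, 1); (10, 12); (13, 15); (16, 17); (18, 19); (20, 22)];
      [:: (3, 4); (5, 6); (7, 9); (18, 20); (19, 22); (21, 23)];
      [:: (1, 2); (8, 10); (11, 13); (14, 16); (19, 21); (22, 23)];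
      [:: (2, 3); (6, 8); (9, 11); (16, 18); (17, 19); (23, 24)];
      [:: (3, 5); (4, 6); (11, 14); (13, 16); (15, 17); (24, 25)];
      [:: (5, 7); (6, 9); (8, 11); (10, 13); (12, 15); (25, 26)]]%N i.

Definition E27 (i : nat) : sparse := [seq (e, 1) | e <- edges27 i].
Definition F27 (i : nat) : sparse := strans (E27 i).

(** [tangent_vector l] is a root vector for the [l]-th root involving the first
    simple root, normalized by its entry in row 0. *)
Definition tangent_word (l : nat) : seq nat := nth [::]
  [:: [::]; [:: 2]; [:: 2; 3]; [:: 2; 3; 1]; [:: 2; 3; 4]; [:: 2; 3; 1; 4];
      [:: 2; 3; 4; 5]; [:: 2; 3; 1; 4; 3]; [:: 2; 3; 4; 5; 1];
      [:: 2; 3; 1; 4; 3; 2]; [:: 2; 3; 1; 4; 3; 5]; [:: 2; 3; 1; 4; 3; 5; 2];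
      [:: 2; 3; 1; 4; 3; 5; 4]; [:: 2; 3; 1; 4; 3; 5; 4; 2];
      [:: 2; 3; 1; 4; 3; 5; 4; 2; 3]; [:: 2; 3; 1; 4; 3; 5; 4; 2; 3; 1]]%N l.

Definition tangent_vector (l : nat) : sparse :=
  foldl (fun s i => sbrack s (E27 i)) (E27 0) (tangent_word l).

Definition edges27_check : bool :=
  let W := weights27 in
  all (fun i => all (fun k => all (fun l =>
    (all (fun j => nth 0 (nth [::] W k) j == nth 0 (nth [::] W l) j + cartanE6 i j) (iota 0 6))
      == ((k, l) \in edges27 i)) (iota 0 27)) (iota 0 27)) (iota 0 6).

Definition EF27_check : bool :=
  all (fun i => [&& sin 27 (E27 i), seqb (smul (E27 i) (E27 i)) [::]
    & (i == 0%N) || seqb (sbrack (F27 0) (E27 i)) [::]]) (iota 0 6).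

Definition H27_check : bool :=
  let W := weights27 in
  all (fun i => seqb (sbrack (E27 i) (F27 i))
    [seq ((k, k), nth 0 (nth [::] W k) i) | k <- iota 0 27]) (iota 0 6).

(** The brackets of the Chevalley generators with the root vectors are those of
    the half-spin module.  For [e_0] they are all zero, in agreement with the empty
    list of edges. *)
Definition tangent_E_check : bool :=
  all (fun i => all (fun l => seqb (sbrack (E27 i) (tangent_vector l))
    (foldr (fun e s => if e.1 == l then sneg (tangent_vector e.2) ++ s else s) [::]
       (spin_edges i))) (iota 0 16)) (iota 0 6).

Definition tangent_F_check : bool :=
  all (fun i => all (fun l => seqb (sbrack (F27 i) (tangent_vector l))
    (foldr (fun e s => if e.2 == l then sneg (tangent_vector e.1) ++ s else s) [::]
       (spin_edges i))) (iota 0 16)) spin_nodes.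

Definition tangent_wt_check : bool :=
  let W := weights27 in
  all (fun l => all (fun x => all (fun j =>
    nth 0 (nth [::] W x.1.1) j == nth 0 (nth [::] W x.1.2) j + spin_wt j l) (iota 0 6))
    (tangent_vector l)) (iota 0 16).

Definition tangent_row_check : bool :=
  all (fun l => all (fun m =>
    scoef (tangent_vector l) 0 m == if m == nth 0%N spin_index l then 1 else 0)
    (iota 0 27)) (iota 0 16).

(** Row 0 belongs to the highest weight, to which none of the generators of [lieP1]
    raises another weight. *)
Definition row0_check : bool :=
  all (fun i => all (fun m => scoef (F27 i) 0 m == 0) (iota 0 27)
    && ((i == 0%N) || all (fun m => scoef (E27 i) 0 m == 0) (iota 0 27))) (iota 0 6).

Lemma edges27_ok : edges27_check. Proof. by vm_compute. Qed.
Lemma EF27_ok : EF27_check. Proof. by vm_compute. Qed.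
Lemma H27_ok : H27_check. Proof. by vm_compute. Qed.
Lemma tangent_E_ok : tangent_E_check. Proof. by vm_compute. Qed.
Lemma tangent_F_ok : tangent_F_check. Proof. by vm_compute. Qed.
Lemma tangent_wt_ok : tangent_wt_check. Proof. by vm_compute. Qed.
Lemma tangent_row_ok : tangent_row_check. Proof. by vm_compute. Qed.
Lemma row0_ok : row0_check. Proof. by vm_compute. Qed.

Section Tangent.
Variable R : realType.
Local Notation C := R[i].
Local Notation M := 'M[C]_27.
Local Notation E := (cheE R).
Local Notation F := (cheF R).
Local Notation H := (cheH R).
Local Notation g27 := (smx C 27).
Local Notation tv l := (g27 (tangent_vector l)).
Local Notation o27 l := (inord (nth 0%N spin_index l) : 'I_27).

Lemma cheE_sparse (i : 'I_6) : E i = g27 (E27 i).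
Proof.
apply/matrixP => k l; rewrite !mxE scoef_const; last first.
  by have /= := all_ord (P := fun i => uniq (edges27 i)) (n := 6) isT i.
have -> : (wt27 k == wt27 l + sroot i) = all (fun j => nth 0 (nth [::] weights27 k) j
     == nth 0 (nth [::] weights27 l) j + cartanE6 i j) (iota 0 6).
  rewrite -eq_rows; have -> : wt27 l + sroot i =
      \row_(j < 6) (nth 0 (nth [::] weights27 l) j + cartanE6 i j).
    by apply/rowP => j; rewrite !mxE.
  by [].
by rewrite (eqP (all_ord (all_ord (all_ord edges27_ok i) k) l)); case: ifP.
Qed.

Lemma cheF_sparse (i : 'I_6) : F i = g27 (F27 i).
Proof. by rewrite /cheF cheE_sparse smx_trans. Qed.

Lemma E27_in (i : 'I_6) : sin 27 (E27 i).
Proof. by have /and3P[] := all_ord EF27_ok i. Qed.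

Lemma F27_in (i : 'I_6) : sin 27 (F27 i).
Proof. by rewrite sin_trans E27_in. Qed.

Lemma tangent_word_ord (l : nat) i : i \in tangent_word l -> exists2 j : 'I_6, i = j & j != ord0.
Proof.
move=> Hi; have : all (fun i => (0 < i < 6)%N) (tangent_word l).
  have [l16|l16] := ltnP l 16; last by move: Hi; rewrite /tangent_word nth_default.
  by have := all_ord (P := fun l => all (fun i => (0 < i < 6)%N) (tangent_word l))
    (n := 16) isT (Ordinal l16).
by move/allP/(_ _ Hi) => /andP[i0 i6]; exists (Ordinal i6); rewrite // -val_eqE /= -lt0n.
Qed.

Lemma tangent_vector_in l : sin 27 (tangent_vector l).
Proof.
rewrite /tangent_vector; have := @tangent_word_ord l.
elim/last_ind: (tangent_word l) => [_|s i IH Hs] /=; first exact: (E27_in ord0).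
have [|j -> _] := Hs i; first by rewrite mem_rcons inE eqxx.
rewrite foldl_rcons sin_brack ?E27_in // IH // => k ks.
by apply: Hs; rewrite mem_rcons inE ks orbT.
Qed.

Lemma E_sq (i : 'I_6) : E i *m E i = 0.
Proof.
rewrite cheE_sparse -smx_mul ?E27_in //.
by have /and3P[_ /(smx_eq C 27) -> _] := all_ord EF27_ok i; rewrite smx_nil.
Qed.

Lemma F_sq (i : 'I_6) : F i *m F i = 0.
Proof. by rewrite /cheF -trmx_mul E_sq trmx0. Qed.

Lemma brk_sparse s s' : sin 27 s -> sin 27 s' -> brk (g27 s) (g27 s') = g27 (sbrack s s').
Proof. by move=> ss ss'; rewrite smx_brack. Qed.

Lemma brk_EF (i : 'I_6) : brk (E i) (F i) = H i.
Proof.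
rewrite cheE_sparse cheF_sparse brk_sparse ?E27_in ?F27_in //.
rewrite (smx_eq C 27 (all_ord H27_ok i)) smx_diag.
by congr diag_mx; apply/rowP => k; rewrite !mxE.
Qed.

Lemma brk_F0E (i : 'I_6) : i != ord0 -> brk (F ord0) (E i) = 0.
Proof.
move=> i0; rewrite cheE_sparse cheF_sparse brk_sparse ?E27_in ?F27_in //.
have /and3P[_ _ /orP[/eqP H0|/(smx_eq C 27) ->]] := all_ord EF27_ok i.
  by move: i0; rewrite -val_eqE /= H0.
exact: smx_nil.
Qed.

Lemma brk_E_tangent (i : 'I_6) (l : 'I_16) :
  brk (E i) (tv l) = \sum_m Emx C i l m *: tv m.
Proof.
rewrite cheE_sparse brk_sparse ?E27_in ?tangent_vector_in //.
rewrite (smx_eq C 27 (all_ord (all_ord tangent_E_ok i) l)).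
have -> : l = Ordinal (ltn_ord l) by apply: val_inj.
rewrite (smx_row_sum (fun m => tv m)) ?spinE_in // /spinE /=.
elim: (spin_edges i) => [|e s IH] /=; first exact: smx_nil.
by case: eqP => _; rewrite ?smx_cat IH // smx_neg scaleN1r.
Qed.

Lemma brk_F_tangent (i : 'I_6) (l : 'I_16) : i != ord0 ->
  brk (F i) (tv l) = \sum_m (Emx C i)^T l m *: tv m.
Proof.
move=> i0; rewrite cheF_sparse brk_sparse ?F27_in ?tangent_vector_in //.
have i0' : nat_of_ord i \in spin_nodes.
  by move: i0; rewrite -val_eqE; case: i => [[|[|[|[|[|[|]]]]]] ?].
rewrite (smx_eq C 27 (all_ord (allP tangent_F_ok _ i0') l)) /Emx -smx_trans.
have -> : l = Ordinal (ltn_ord l) by apply: val_inj.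
rewrite (smx_row_sum (fun m => tv m)) ?sin_trans ?spinE_in // /spinE /=.
elim: (spin_edges i) => [|e s IH] /=; first exact: smx_nil.
by case: eqP => _; rewrite ?smx_cat IH // smx_neg scaleN1r.
Qed.

Lemma tangent_row (l : 'I_16) (m : 'I_27) :
  tv l 0 m = (nat_of_ord m == nth 0%N spin_index l)%:R.
Proof.
rewrite mxE (eqP (all_ord (all_ord tangent_row_ok l) m)).
by case: ifP.
Qed.

Lemma tangent_wt (j : 'I_6) (l : 'I_16) (k m : 'I_27) : tv l k m != 0 ->
  wt27 k 0 j = wt27 m 0 j + spw j l.
Proof.
move/smx_neq0/mapP => [[[k' m'] c] xin [kk mm]]; rewrite !mxE; apply/eqP.
have := all_ord (allP (all_ord tangent_wt_ok l) _ xin) j.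
by rewrite /= -kk -mm.
Qed.

Local Notation L := (lieE6 R).
Local Notation P1 := (lieP1 R).

Let K0 : [pchar C] =i pred0 := pchar_num C.

Local Opaque lie_closure.

Lemma E6_brk x y : x \in L -> y \in L -> brk x y \in L.
Proof. exact: lie_closure_brk. Qed.

Lemma P1_brk x y : x \in P1 -> y \in P1 -> brk x y \in P1.
Proof. exact: lie_closure_brk. Qed.

Lemma E_in_E6 i : E i \in L.
Proof. by apply: lie_closure_gen; rewrite mem_cat map_f // mem_enum. Qed.

Lemma F_in_E6 i : F i \in L.
Proof. by apply: lie_closure_gen; rewrite mem_cat map_f ?orbT // mem_enum. Qed.

Lemma E_in_P1 i : i != ord0 -> E i \in P1.
Proof.
move=> i0; apply: lie_closure_gen; rewrite !mem_cat (map_f E (x := i)) ?orbT //.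
by rewrite mem_filter i0 mem_enum.
Qed.

Lemma F_in_P1 i : F i \in P1.
Proof. by apply: lie_closure_gen; rewrite !mem_cat map_f // mem_enum. Qed.

Lemma H_in_P1 i : H i \in P1.
Proof. by apply: lie_closure_gen; rewrite !mem_cat (map_f H) ?orbT // mem_enum. Qed.

Lemma P1_ind (P : M -> Prop) : P 0 -> (forall c x y, P x -> P y -> P (c *: x + y)) ->
  (forall x y, P x -> P y -> P (brk x y)) -> (forall i, P (F i)) -> (forall i, P (H i)) ->
  (forall i, i != ord0 -> P (E i)) -> forall x, x \in P1 -> P x.
Proof.
move=> P0 PL PB PF PH PE; apply: lie_closure_ind => // x.
rewrite !mem_cat => /or3P[] /mapP [i Hi ->] //.
by apply: PE; move: Hi; rewrite mem_filter => /andP[].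
Qed.

Lemma E6_ind (P : M -> Prop) : P 0 -> (forall c x y, P x -> P y -> P (c *: x + y)) ->
  (forall x y, P x -> P y -> P (brk x y)) -> (forall i, P (F i)) -> (forall i, P (E i)) ->
  forall x, x \in L -> P x.
Proof.
move=> P0 PL PB PF PE; apply: lie_closure_ind => // x.
by rewrite mem_cat => /orP[] /mapP [i Hi ->].
Qed.

Lemma P1_sub_E6 x : x \in P1 -> x \in L.
Proof.
move: x; apply: P1_ind; first exact: mem0v.
- by move=> c x y Lx Ly; rewrite rpredD ?rpredZ.
- exact: E6_brk.
- exact: F_in_E6.
- by move=> i; have := E6_brk (E_in_E6 i) (F_in_E6 i); rewrite brk_EF.
- by move=> i _; apply: E_in_E6.
Qed.

Local Opaque lieE6 lieP1.

Lemma tangent_ind (P : M -> Prop) : P (E ord0) ->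
  (forall x i, i != ord0 -> P x -> P (brk x (E i))) -> forall l, P (tv l).
Proof.
move=> P0 PE l; rewrite /tangent_vector; have := @tangent_word_ord l.
suff: (forall i, i \in tangent_word l -> exists2 j : 'I_6, i = j & j != ord0) ->
  sin 27 (foldl (fun s i => sbrack s (E27 i)) (E27 0) (tangent_word l)) /\
  P (g27 (foldl (fun s i => sbrack s (E27 i)) (E27 0) (tangent_word l))).
  by move=> H1 /H1 [].
elim/last_ind: (tangent_word l) => [_|s i IH Hs] /=.
  by split; [exact: (E27_in ord0) | rewrite -(cheE_sparse ord0)].
have [|s27 Ps] := IH; first by move=> k ks; apply: Hs; rewrite mem_rcons inE ks orbT.
have [|j -> j0] := Hs i; first by rewrite mem_rcons inE eqxx.
rewrite foldl_rcons sin_brack ?E27_in //; split=> //.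
by rewrite -brk_sparse ?E27_in // -cheE_sparse; apply: PE.
Qed.

Lemma tangent_in_E6 l : tv l \in L.
Proof.
apply: (tangent_ind (P := fun x => x \in L)); first exact: E_in_E6.
by move=> x i _ Lx; apply: E6_brk => //; apply: E_in_E6.
Qed.

(** [f_0] commutes with the [e_i] of the Levi factor, so along the words it only
    meets [e_0], where it gives an element of the torus. *)
Lemma brk_F0_tangent l : brk (F ord0) (tv l) \in P1.
Proof.
apply: (tangent_ind (P := fun x => brk (F ord0) x \in P1)).
  by rewrite brkC brk_EF rpredN H_in_P1.
move=> x i i0 Px; have Hi := P1_brk Px (E_in_P1 i0).
move: (brk_F0E i0) Hi; move: (F ord0) (E i) => f e fe.
by rewrite brk_jacobi fe brk0r subr0.
Qed.

Lemma brk_H_tangent i l : brk (H i) (tv (l : 'I_16)) = (spw i l)%:~R *: tv l.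
Proof.
rewrite /brk mul_diag_mx mul_mx_diag; apply/matrixP => k m.
rewrite [LHS]mxE ![in LHS]mxE [RHS]mxE.
have [E0|km] := eqVneq (tv l k m) 0.
  by move: E0; rewrite !mxE => ->; rewrite !(mulr0, mul0r) subr0.
have := tangent_wt i km; rewrite !mxE => ->.
by rewrite rmorphD /=; ring.
Qed.

(** Membership in the sum of [lieP1] and the span of the 16 root vectors, which
    turns out to be all of [lieE6]. *)
Definition splits (z : M) : Prop :=
  exists p (c : 'I_16 -> C), p \in P1 /\ z = p + \sum_l c l *: tv l.

Lemma splits_lin c x y : splits x -> splits y -> splits (c *: x + y).
Proof.
move=> [p [a [pP ->]]] [q [b [qP ->]]].
exists (c *: p + q), (fun l => c * a l + b l); split; first by rewrite rpredD ?rpredZ.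
rewrite scalerDr addrACA; congr (_ + _); rewrite scaler_sumr -big_split /=.
by apply: eq_bigr => l _; rewrite scalerDl scalerA.
Qed.

Lemma splits_P1 p : p \in P1 -> splits p.
Proof.
move=> pP; exists p, (fun=> 0); split=> //.
by rewrite big1 ?addr0 // => l _; rewrite scale0r.
Qed.

Lemma splits_tangent (c : 'I_16 -> C) : splits (\sum_l c l *: tv l).
Proof. by exists 0, c; rewrite mem0v add0r. Qed.

Lemma splits_tv (l : 'I_16) : splits (tv l).
Proof.
exists 0, (fun m => (m == l)%:R); rewrite mem0v add0r (bigD1 l) //= eqxx scale1r.
by split=> //; rewrite big1 ?addr0 // => m /negPf ->; rewrite scale0r.
Qed.

(** The elements whose brackets preserve this sum form a Lie algebra, so it is
    enough to find the generators of [lieE6] among them. *)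
Definition stabilizes_splits (x : M) : Prop := forall z, splits z -> splits (brk x z).

Lemma stabilizes_gen x : (forall p, p \in P1 -> splits (brk x p)) ->
  (forall l : 'I_16, splits (brk x (tv l))) -> stabilizes_splits x.
Proof.
move=> xP xT z [p [c [pP ->]]].
have -> : brk x (p + \sum_l c l *: tv l) = 1 *: brk x p + \sum_l c l *: brk x (tv l).
  rewrite -[p in LHS]scale1r brkDr brk_sumr; congr (_ + _).
  by apply: eq_bigr => l _; rewrite brkZr.
apply: splits_lin; first exact: xP.
apply: (big_ind splits); first by apply: splits_P1; apply: mem0v.
  by move=> a b; have := @splits_lin 1 a b; rewrite scale1r.
move=> l _; rewrite -[_ *: _]addr0; apply: splits_lin => //.
by apply: splits_P1; apply: mem0v.
Qed.

Lemma stabilizes_lin c x y : stabilizes_splits x -> stabilizes_splits y ->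
  stabilizes_splits (c *: x + y).
Proof. by move=> sx sy z sz; rewrite brkDl; apply: splits_lin; [apply: sx | apply: sy]. Qed.

Lemma stabilizes_brk x y : stabilizes_splits x -> stabilizes_splits y ->
  stabilizes_splits (brk x y).
Proof.
move=> sx sy z sz; rewrite brk_jacobi addrC -scaleN1r.
by apply: splits_lin; [apply/sy/sx | apply/sx/sy].
Qed.

Lemma stabilizes0 : stabilizes_splits 0.
Proof. by move=> z _; rewrite brk0l; apply/splits_P1/mem0v. Qed.

Lemma stabilizes_P1 x : x \in P1 -> stabilizes_splits x.
Proof.
move: x; apply: P1_ind; first exact: stabilizes0.
- exact: stabilizes_lin.
- exact: stabilizes_brk.
- move=> i; apply: stabilizes_gen => [p pP|l].
    by apply/splits_P1/P1_brk => //; apply: F_in_P1.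
  have [->|i0] := eqVneq i ord0; first exact/splits_P1/brk_F0_tangent.
  by rewrite brk_F_tangent //; apply: splits_tangent.
- move=> i; apply: stabilizes_gen => [p pP|l].
    by apply/splits_P1/P1_brk => //; apply: H_in_P1.
  rewrite brk_H_tangent -[_ *: _]addr0; apply: splits_lin; first exact: splits_tv.
  exact/splits_P1/mem0v.
- move=> i i0; apply: stabilizes_gen => [p pP|l].
    by apply/splits_P1/P1_brk => //; apply: E_in_P1.
  by rewrite brk_E_tangent; apply: splits_tangent.
Qed.

Lemma tv0 : tv 0%N = E ord0.
Proof. by rewrite cheE_sparse. Qed.

Lemma splits_E i : splits (E i).
Proof.
have [->|i0] := eqVneq i ord0; last exact/splits_P1/E_in_P1.
rewrite -tv0; exact: (splits_tv ord0).
Qed.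

(** For [e_0] the bracket with [p] in [lieP1] is, up to sign, the bracket of [p]
    with [e_0], which is the first root vector. *)
Lemma stabilizes_E i : stabilizes_splits (E i).
Proof.
have [->|i0] := eqVneq i ord0; last exact/stabilizes_P1/E_in_P1.
apply: stabilizes_gen => [p pP|l]; last by rewrite brk_E_tangent; apply: splits_tangent.
rewrite brkC -scaleN1r -[_ *: _]addr0; apply: splits_lin; last exact/splits_P1/mem0v.
exact: (stabilizes_P1 pP (splits_E ord0)).
Qed.

Lemma E6_splits x : x \in L -> splits x.
Proof.
move=> xL; suff [] : splits x /\ stabilizes_splits x by [].
move: x xL; apply: E6_ind.
- by split; [apply/splits_P1/mem0v | apply: stabilizes0].
- move=> c x y [sx tx] [sy ty].
  by split; [apply: splits_lin | apply: stabilizes_lin].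
- by move=> x y [sx tx] [sy ty]; split; [apply: tx | apply: stabilizes_brk].
- by move=> i; split; [apply/splits_P1/F_in_P1 | apply/stabilizes_P1/F_in_P1].
- by move=> i; split; [apply: splits_E | apply: stabilizes_E].
Qed.

(** The class of [z] modulo [lieP1] is read off from the first row of [z]. *)
Definition tcoord (z : M) (l : 'I_16) : C := z 0 (o27 l).

(** Row 0 holds the components on the highest weight vector. *)
Lemma P1_row0 x : x \in P1 -> forall m, m != 0 -> x 0 m = 0.
Proof.
move: x; apply: P1_ind.
- by move=> m _; rewrite mxE.
- by move=> c x y Hx Hy m m0; rewrite !mxE Hx // Hy // mulr0 addr0.
- have row0M (x y : M) m : (forall k, k != 0 -> x 0 k = 0) -> y 0 m = 0 ->
      (x *m y) 0 m = 0.
    move=> Hx Hy; rewrite mxE big1 // => k _.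
    by have [->|k0] := eqVneq k 0; rewrite ?Hy ?mulr0 // Hx // mul0r.
  by move=> x y Hx Hy m m0; rewrite /brk mxE [X in _ + X]mxE !row0M ?subrr ?Hx ?Hy.
- move=> i m m0; rewrite cheF_sparse mxE.
  by have /andP[/all_ord /(_ m) /eqP -> _] := all_ord row0_ok i.
- by move=> i m m0; rewrite !mxE eq_sym (negPf m0) mulr0n.
- move=> i i0 m m0; rewrite cheE_sparse mxE.
  have /andP[_ /orP[/eqP H1|/all_ord /(_ m) /eqP -> //]] := all_ord row0_ok i.
  by move: i0; rewrite -val_eqE /= H1.
Qed.

Lemma spin_index_ord (l : 'I_16) : (0 < nth 0%N spin_index l < 27)%N.
Proof. by have := all_ord (P := fun l => (0 < nth 0%N spin_index l < 27)%N) (n := 16) isT l. Qed.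

Lemma o27K (l : 'I_16) : o27 l = nth 0%N spin_index l :> nat.
Proof. by rewrite inordK //; case/andP: (spin_index_ord l). Qed.

Lemma tcoord_P1 x l : x \in P1 -> tcoord x l = 0.
Proof.
move=> xP; apply: P1_row0 => //; rewrite -val_eqE /= o27K.
by case/andP: (spin_index_ord l); rewrite lt0n.
Qed.

Lemma tcoord_tv (l m : 'I_16) : tcoord (tv l) m = (l == m)%:R.
Proof.
rewrite /tcoord tangent_row o27K.
by rewrite (@nth_uniq _ 0%N spin_index m l (ltn_ord m) (ltn_ord l) isT) eq_sym.
Qed.

Lemma tcoord_lin c x y l : tcoord (c *: x + y) l = c * tcoord x l + tcoord y l.
Proof. by rewrite /tcoord !mxE. Qed.

Lemma tcoord_addP1 x p l : p \in P1 -> tcoord (x + p) l = tcoord x l.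
Proof. by move=> /(tcoord_P1 l) p0; rewrite /tcoord mxE [X in _ + X]p0 addr0. Qed.

Lemma tcoord_sum (c : 'I_16 -> C) (f : 'I_16 -> M) m :
  tcoord (\sum_l c l *: f l) m = \sum_l c l * tcoord (f l) m.
Proof. by rewrite /tcoord summxE; apply: eq_bigr => l _; rewrite mxE. Qed.

Lemma E6_decomp z : z \in L -> exists2 p, p \in P1 & z = p + \sum_l tcoord z l *: tv l.
Proof.
move=> /E6_splits [p [c [pP ->]]]; exists p => //; congr (_ + _).
apply: eq_bigr => l _; congr (_ *: _).
rewrite -[p]scale1r tcoord_lin tcoord_P1 // mulr0 add0r tcoord_sum.
rewrite (bigD1 l) //= tcoord_tv eqxx mulr1 big1 ?addr0 // => m /negPf ml.
by rewrite tcoord_tv ml mulr0.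
Qed.

(** * The action of the group on the quotient *)

Definition normalizes (g : M) : Prop :=
  [/\ g \in unitmx, forall z, z \in L -> g *m z *m invmx g \in L
    & forall z, z \in P1 -> g *m z *m invmx g \in P1].

Lemma exp_normalizes (A : M) t : A *m A = 0 -> A \in P1 -> normalizes (1%:M + t *: A).
Proof.
move=> A2 AP; have AL := P1_sub_E6 AP; have [u _] := exp_inv t A2.
have closed (U : {vspace M}) z : (forall x, x \in U -> brk A x \in U) -> z \in U ->
    (1%:M + t *: A) *m z *m invmx (1%:M + t *: A) \in U.
  move=> UA Uz; rewrite conj_exp //.
  by rewrite !rpredD ?rpredZ ?UA.
split; first exact: u.
  by move=> z; apply: closed => x xL; exact: (E6_brk AL xL).
move=> z; apply: closed => x xP; exact: (P1_brk AP xP).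
Qed.

Lemma rootE_normalizes i t : i != ord0 -> normalizes (Defs.rootE i t).
Proof. by move=> i0; apply: exp_normalizes; [apply: E_sq | apply: E_in_P1]. Qed.

Lemma rootF_normalizes i t : normalizes (rootF i t).
Proof. by apply: exp_normalizes; [apply: F_sq | apply: F_in_P1]. Qed.

Lemma wt27_E (i j : 'I_6) k m : E i k m != 0 -> wt27 k 0 j = wt27 m 0 j + cartanE6 i j.
Proof.
rewrite mxE; case: (wt27 k =P _) => [-> _|_]; last by rewrite eqxx.
by rewrite !mxE.
Qed.

Lemma cochar_E (i j : 'I_6) (t : C) : t != 0 ->
  cochar i t *m E j *m invmx (cochar i t) = t ^ cartanE6 j i *: E j.
Proof.
move=> t0; apply: (@conj_diag _ _ (fun k => wt27 k 0 i)) => // k m.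
exact: wt27_E.
Qed.

Lemma cochar_F (i j : 'I_6) (t : C) : t != 0 ->
  cochar i t *m F j *m invmx (cochar i t) = t ^ (- cartanE6 j i) *: F j.
Proof.
move=> t0; apply: (@conj_diag _ _ (fun k => wt27 k 0 i)) => // k m.
by rewrite mxE => /(wt27_E i) ->; rewrite addrK.
Qed.

Lemma cochar_H (i j : 'I_6) (t : C) : t != 0 ->
  cochar i t *m H j *m invmx (cochar i t) = t ^ 0 *: H j.
Proof.
move=> t0; apply: (@conj_diag _ _ (fun k => wt27 k 0 i)) => // k m.
by rewrite mxE; case: (k =P m) => [-> _|_]; rewrite ?addr0 // mulr0n eqxx.
Qed.

Lemma cochar_tv (i : 'I_6) (t : C) (l : 'I_16) : t != 0 ->
  cochar i t *m tv l *m invmx (cochar i t) = t ^ spw i l *: tv l.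
Proof.
move=> t0; apply: (@conj_diag _ _ (fun k => wt27 k 0 i)) => // k m.
exact: tangent_wt.
Qed.

Lemma cochar_normalizes i (t : C) : t != 0 -> normalizes (cochar i t).
Proof.
move=> t0; have u : cochar i t \in unitmx.
  rewrite unitmxE det_diag unitfE prodf_seq_neq0; apply/allP => k _ /=.
  by rewrite mxE expfz_neq0.
split; first exact: u.
  apply: E6_ind.
  - by rewrite mulmx0 mul0mx mem0v.
  - by move=> c x y Hx Hy; rewrite conjDr; exact: (memvD (memvZ c Hx) Hy).
  - by move=> x y Hx Hy; rewrite (brk_conj _ _ u); exact: E6_brk Hx Hy.
  - by move=> j; rewrite cochar_F //; apply/rpredZ/F_in_E6.
  - by move=> j; rewrite cochar_E //; apply/rpredZ/E_in_E6.
apply: P1_ind.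
- by rewrite mulmx0 mul0mx mem0v.
- by move=> c x y Hx Hy; rewrite conjDr; exact: (memvD (memvZ c Hx) Hy).
- by move=> x y Hx Hy; rewrite (brk_conj _ _ u); exact: P1_brk Hx Hy.
- by move=> j; rewrite cochar_F //; apply/rpredZ/F_in_P1.
- by move=> j; rewrite cochar_H //; apply/rpredZ/H_in_P1.
- by move=> j j0; rewrite cochar_E //; apply/rpredZ/E_in_P1.
Qed.

Lemma normalizesM g h : normalizes g -> normalizes h -> normalizes (g *m h).
Proof.
move=> [gu gL gP] [hu hL hP]; have E1 z := conjM z gu hu.
split; first by rewrite unitmx_mul gu.
  by move=> z zL; rewrite E1; apply/gL/hL.
by move=> z zP; rewrite E1; apply/gP/hP.
Qed.

Lemma normalizes1 : normalizes 1%:M.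
Proof.
split; first exact: unitmx1.
  by move=> z; rewrite invmx1 mulmx1 mul1mx.
by move=> z; rewrite invmx1 mulmx1 mul1mx.
Qed.

(** Rows hold the images of the root vectors, so this is an antimorphism. *)
Definition tmx (g : M) : 'M[C]_16 := \matrix_(l, m) tcoord (g *m tv l *m invmx g) m.

Lemma tcoord_conj g z m : normalizes g -> z \in L ->
  tcoord (g *m z *m invmx g) m = \sum_l tcoord z l * tmx g l m.
Proof.
move=> [gu gL gP] zL; have [p pP {1}->] := E6_decomp zL.
rewrite -[p]scale1r conjDr tcoord_lin tcoord_P1 ?gP // mulr0 add0r.
rewrite mulmx_sumr mulmx_suml /tcoord summxE; apply: eq_bigr => l _.
by rewrite -scalemxAr -scalemxAl mxE [tmx _ _ _]mxE.
Qed.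

(** The quadratic term of [conj_exp] vanishes on the quotient, where [A] acts by a
    matrix of square zero. *)
Lemma tmx_exp (A : M) (a : 'M[C]_16) t : A *m A = 0 -> a *m a = 0 ->
  (forall l : 'I_16, brk A (tv l) = \sum_m a l m *: tv m) ->
  tmx (1%:M + t *: A) = 1%:M + t *: a.
Proof.
move=> A2 a2 Aa; apply/matrixP => l m; rewrite mxE conj_exp // Aa.
have -> : brk A (\sum_m a l m *: tv m) = 0.
  rewrite brk_sumr; under eq_bigr do rewrite brkZr Aa scaler_sumr.
  rewrite exchange_big big1 //= => k _; under eq_bigr do rewrite scalerA.
  rewrite -scaler_suml; have /matrixP/(_ l k) := a2; rewrite !mxE => ->.
  exact: scale0r.
rewrite scaler0 addr0 addrC tcoord_lin tcoord_tv tcoord_sum (bigD1 m) //= big1.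
  by rewrite tcoord_tv eqxx mulr1 addr0 [RHS]mxE addrC; congr (_ + _); rewrite mxE.
by move=> k /negPf km; rewrite tcoord_tv km mulr0.
Qed.

Lemma tmx_rootE i t : tmx (Defs.rootE i t) = 1%:M + t *: Emx C i.
Proof.
apply: tmx_exp; [exact: E_sq | exact: Emx_sq | exact: brk_E_tangent].
Qed.

Lemma tmx_rootF i t : i != ord0 -> tmx (rootF i t) = 1%:M + t *: (Emx C i)^T.
Proof.
move=> i0; apply: tmx_exp; first exact: F_sq.
  by rewrite -trmx_mul Emx_sq trmx0.
by move=> l; apply: brk_F_tangent.
Qed.

Lemma tmx_rootF0 t : tmx (rootF ord0 t) = 1%:M.
Proof.
apply/matrixP => l m; rewrite [LHS]mxE [RHS]mxE (conj_exp t (tv l) K0 (F_sq ord0)).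
have F0 := brk_F0_tangent l; have F00 := P1_brk (F_in_P1 ord0) F0.
by rewrite (tcoord_addP1 _ _ (memvZ _ F00)) (tcoord_addP1 _ _ (memvZ _ F0)) tcoord_tv.
Qed.

Lemma tmx_cochar i (t : C) : t != 0 -> tmx (cochar i t) = tor (spw i) t.
Proof.
move=> t0; apply/matrixP => l m; rewrite mxE cochar_tv // !mxE.
by rewrite /tcoord mxE -/(tcoord _ _) tcoord_tv mulr_natr.
Qed.

Local Notation T := (TX R).
Local Notation n := (\dim T).
Local Notation pi z := (addv_pi1 L P1 z).

(** [TX] is a complement of [lieP1] in [lieE6] which need not be spanned by the root
    vectors.  The matrices [toS] and [ofS] change between its basis and the classes
    of the root vectors modulo [lieP1]. *)
Definition toS : 'M[C]_(n, 16) := \matrix_(i, l) tcoord (vbasis T)`_i l.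
Definition ofS : 'M[C]_(16, n) := \matrix_(l, j) coord (vbasis T) j (pi (tv l)).

Lemma L_addP1 z : z \in L -> z \in (L + P1)%VS.
Proof. by move=> zL; apply: (subvP (addvSl _ _)). Qed.

Lemma pi_P1 p : p \in P1 -> pi p = 0.
Proof. by move=> pP; apply: addv_pi1_eq0 => //; apply/L_addP1/P1_sub_E6. Qed.

Lemma pi_T z : z \in T -> pi z = z.
Proof. by move=> zT; apply: daddv_pi_id; rewrite ?capv_diff. Qed.

Lemma pi_in_T z : pi z \in T.
Proof. exact: memv_pi. Qed.

Lemma T_sub_L z : z \in T -> z \in L.
Proof. by move=> zT; apply: (subvP (diffvSl _ _)); apply: zT. Qed.

Lemma pi_decomp z : z \in L -> pi z = \sum_l tcoord z l *: pi (tv l).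
Proof.
move=> zL; have [p pP {1}->] := E6_decomp zL.
rewrite linearD /= pi_P1 // add0r linear_sum; apply: eq_bigr => l _.
by rewrite linearZ.
Qed.

Lemma tcoord_pi z l : z \in L -> tcoord (pi z) l = tcoord z l.
Proof.
move=> /L_addP1 /addv_pi1_decomp [q qP zE].
transitivity (tcoord (pi z + q) l); first by rewrite tcoord_addP1.
by rewrite -zE.
Qed.

Lemma basis_in_T (i : 'I_n) : (vbasis T)`_i \in T.
Proof. by apply: vbasis_mem; rewrite mem_nth // size_tuple. Qed.

Lemma coord_pi z j : z \in L ->
  coord (vbasis T) j (pi z) = \sum_l tcoord z l * ofS l j.
Proof.
move=> zL; rewrite pi_decomp // linear_sum; apply: eq_bigr => l _.
by rewrite linearZ /= mxE.
Qed.

Lemma ofS_toS : ofS *m toS = 1%:M.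
Proof.
apply/matrixP => l m; rewrite [LHS]mxE [RHS]mxE -[RHS]tcoord_tv.
rewrite -(tcoord_pi m (tangent_in_E6 l)) [in RHS](coord_vbasis (pi_in_T (tv l))).
rewrite /tcoord summxE; apply: eq_bigr => j _.
by rewrite [ofS _ _]mxE [toS _ _]mxE [RHS]mxE.
Qed.

Lemma toS_ofS : toS *m ofS = 1%:M.
Proof.
apply/matrixP => i j; rewrite !mxE; under eq_bigr do rewrite mxE.
rewrite -coord_pi ?T_sub_L ?basis_in_T // pi_T ?basis_in_T // coord_free //.
exact: basis_free (vbasisP T).
Qed.

Lemma adTX_E g : normalizes g -> adTX g = toS *m tmx g *m ofS.
Proof.
move=> gn; have [gu gL gP] := gn; apply/matrixP => i j; rewrite [LHS]mxE.
have bL : (vbasis T)`_i \in L by apply/T_sub_L/basis_in_T.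
rewrite coord_pi ?gL // [RHS]mxE; apply: eq_bigr => m _; congr (_ * _).
rewrite tcoord_conj // [RHS]mxE; apply: eq_bigr => l _.
by rewrite [toS _ _]mxE.
Qed.

Lemma tmxM g h : normalizes g -> normalizes h -> tmx (g *m h) = tmx h *m tmx g.
Proof.
move=> gn hn; have [gu gL gP] := gn; have [hu hL hP] := hn.
apply/matrixP => l m; rewrite !mxE.
rewrite (conjM _ gu hu) tcoord_conj // ?hL ?tangent_in_E6 //; apply: eq_bigr => k _.
by rewrite [tmx h _ _]mxE.
Qed.
End Tangent.

(** * The decomposition of the symmetric algebra of the half-spin module *)

Section SpinModule.
Variable K : numClosedFieldType.
Local Notation S := {mpoly K[16]}.
Local Notation levi := {i : 'I_6 | i != ord0}.
Local Notation o := spin_ord.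

Definition spinEi (i : levi) : 'M[K]_16 := Emx K (val i).
Definition spin_stable : (S -> Prop) -> Prop := stable spinEi spw.
Definition spin_gen : nat * nat -> S -> Prop := gen spinEi (hwv K).

Let sq (i : levi) : spinEi i *m spinEi i = 0. Proof. exact: Emx_sq. Qed.

Let real (i : levi) l m : (spinEi i l m)^* = spinEi i l m.
Proof. exact: Emx_real. Qed.

Let wt (i : levi) j l m : spinEi i l m != 0 -> spw j m = spw j l + cartanE6 (val i) j.
Proof. exact: Emx_wt. Qed.

Let comm (i k : levi) : (spinEi k)^T *m spinEi i - spinEi i *m (spinEi k)^T =
  if i == k then cartan K (spw (val i)) else 0.
Proof. by rewrite Emx_comm ?(valP i) ?(valP k). Qed.

Let depth (i : levi) (l m : 'I_16) : spinEi i l m != 0 -> spin_depth l = (spin_depth m).+1.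
Proof. exact: (@Emx_depth K (val i)). Qed.

Lemma spin_node_levi i : i \in spin_nodes -> exists j : levi, i = val j :> nat.
Proof.
move=> Hi; have i6 : (i < 6)%N.
  by move: Hi; rewrite !inE; do 4![case/orP => [/eqP->//|]] => /eqP->.
have i0 : Ordinal i6 != ord0 by rewrite -val_eqE /=; apply: contraL Hi => /eqP ->.
by exists (exist _ (Ordinal i6) i0).
Qed.

Lemma levi_spin_node (j : levi) : nat_of_ord (val j) \in spin_nodes.
Proof. by case: j => [[[|[|[|[|[|[|]]]]]] ?] ?]. Qed.

Lemma killedE (p : S) : killed p <-> Ekill spinEi p.
Proof.
split=> [kp i|kp i Hi]; first by apply: kp; apply: levi_spin_node.
by have [j ->] := spin_node_levi Hi; apply: kp.
Qed.

Let kill c : Ekill spinEi (hwv K c).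
Proof. by apply/killedE/killed_hwv. Qed.

Let cls (v : S) mu : v != 0 -> Ekill spinEi v -> weightvec spw v mu ->
  exists c z, v = z *: hwv K c.
Proof. by move=> v0 /killedE kv; apply: killed_weight_hwv. Qed.

Lemma spin_has_hwv (N : S -> Prop) p : spin_stable N -> N p -> p != 0 ->
  exists c, N (hwv K c).
Proof. exact: (stable_has_h sq wt depth cls). Qed.

Lemma spin_gen_stable c : spin_stable (spin_gen c).
Proof. exact: (gen_stable sq wt comm kill (@hwv_weight K)). Qed.

Lemma spin_gen_irreducible c (N : S -> Prop) p : spin_stable N ->
  (forall q, N q -> spin_gen c q) -> N p -> p != 0 -> forall q, spin_gen c q -> N q.
Proof.
exact: (gen_irreducible sq real wt comm depth (@hwv_neq0 K) kill (@hwv_weight K) cls eta_inj).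
Qed.

Section Degree.
Variables (r : nat) (T : finType) (psi : T -> nat * nat).
Hypothesis psi_inj : injective psi.
Hypothesis psi_deg : forall c, (c.1 + 2 * c.2)%N = r <-> exists t, psi t = c.

Lemma spin_decomposition (p : S) : p \is r.-homog ->
  exists y : T -> S, (forall t, spin_gen (psi t) (y t)) /\ p = \sum_t y t.
Proof.
exact: (decomposition sq real wt comm depth (@hwv_neq0 K) kill (@hwv_weight K)
  (@hwv_homog K) cls psi_deg).
Qed.

Lemma spin_gen_homog t (p : S) : spin_gen (psi t) p -> p \is r.-homog.
Proof.
move/(gen_homog (@hwv_homog K)); have -> // : ((psi t).1 + 2 * (psi t).2)%N = r.
by apply/psi_deg; exists t.
Qed.

Lemma spin_decomposition_direct (y : T -> S) :
  (forall t, spin_gen (psi t) (y t)) -> \sum_t y t = 0 -> forall t, y t = 0.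
Proof.
exact: (decomposition_direct real wt comm kill (@hwv_weight K) eta_inj psi_inj).
Qed.
End Degree.

Lemma weightvec_unique (p : S) mu nu : p != 0 -> weightvec spw p mu ->
  weightvec spw p nu -> mu =1 nu.
Proof.
move=> p0 pm pn j; have lp : p@_(mlead p) != 0 by rewrite mleadc_eq0.
by rewrite -(pm j _ lp) (pn j _ lp).
Qed.

(** Extract the coefficient of [t] from the exponential series, which is constant.
    The terms of [v] are those of the series without the constant one. *)
Lemma fixed_der (A : 'M[K]_16) (p : S) : A *m A = 0 ->
  (forall t, lsub (1%:M + t *: A) p = p) -> der A p = 0.
Proof.
move=> A2 fp; have [m Hm] := lsub_exp (pchar_num K) A2 p.
pose v k : S := if k is k'.+1 then (k`!%:R)^-1 *: iter k (der A) p else 0.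
have s0 : subspace (fun q : S => q = 0).
  by split=> // c x y -> ->; rewrite scaler0 addr0.
have := subspace_coef (n := m.+2) (v := v) s0.
move=> H; have {}H : v 1%N = 0.
  apply: (H _ 1%N) => // t _; have mm : (m <= m.+2)%N by rewrite -addn2 leq_addr.
  have := Hm m.+2 t mm; rewrite fp big_ord_recl /= expr0 fact0 invr1 !scale1r => E.
  rewrite big_ord_recl /= scaler0 add0r; have /eqP := E.
  by rewrite -subr_eq0 opprD addrA subrr sub0r oppr_eq0 => /eqP.
by move: H; rewrite /v /= factS fact0 muln1 invr1 scale1r.
Qed.

(** The conditions on the group are turned into conditions on the Lie algebra and
    on monomials, to which [killed_weight_hwv] applies. *)
Lemma fixed_weight_hwv (p : S) mu : p != 0 ->
  (forall (i : 'I_6) t, i != ord0 -> lsub (1%:M + t *: Emx K i) p = p) ->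
  (forall j t, t != 0 -> lsub (tor (spw j) t) p = t ^ mu j *: p) ->
  exists c z, [/\ z != 0, p = z *: hwv K c & mu =1 eta c].
Proof.
move=> p0 fp /tor_weightvec wp.
have kp : killed p.
  move=> i /spin_node_levi [j ->].
  by apply: fixed_der => [|t]; [apply: Emx_sq | apply: fp; apply: (valP j)].
have [c [z pz]] := killed_weight_hwv p0 kp wp.
have z0 : z != 0 by apply: contraNneq p0 => z0; rewrite pz z0 scale0r.
exists c, z; split=> //; apply: (@weightvec_unique p) => //.
move=> j m; rewrite pz mcoeffZ mulf_eq0 negb_or => /andP[_].
exact: (@hwv_weight K).
Qed.

Lemma hwv_fixed c (i : 'I_6) t : i != ord0 ->
  lsub (1%:M + t *: Emx K i) (hwv K c) = hwv K c.
Proof.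
move=> i0; apply: lsub_fix; [exact: pchar_num | exact: Emx_sq |].
by apply: killed_hwv; apply: (levi_spin_node (exist _ i i0)).
Qed.
End SpinModule.

(** * Irreducible semi-invariants *)

(** For complex coefficients this is [mpoly_irreducible] by definition. *)
Definition irreducible_mpoly (K : fieldType) n (p : {mpoly K[n]}) : Prop :=
  [/\ p != 0, p \isn't a GRing.unit
    & forall a b : {mpoly K[n]}, p = a * b -> a \is a GRing.unit \/ b \is a GRing.unit].

Section Irreducible.
Variables (K : fieldType).

Lemma mpoly_unit_size n (p : {mpoly K[n]}) : msize p = 1%N -> p \is a GRing.unit.
Proof.
move/eqP/msize_poly1P => [c c0 ->].
by apply/unitrP; exists c^-1%:MP; rewrite -!mpolyCM mulVf // mulfV.
Qed.

Lemma mpoly_unit_homog n d (p : {mpoly K[n]}) : p \is a GRing.unit -> p \is d.-homog ->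
  d = 0%N.
Proof.
move=> up ph; have /unitrP [q [qp _]] := up.
have p0 : p != 0 by apply: contraTneq up => ->; rewrite unitr0.
have q0 : q != 0.
  by apply: contra_eq_neq qp => ->; rewrite mul0r eq_sym oner_neq0.
have := msizeM q0 p0; rewrite qp msize1.
have := mpolySpred mdeg q0; have := mpolySpred mdeg p0 => -> ->.
rewrite addnS /= => E; have p1 : msize p = 1%N.
  by rewrite (mpolySpred mdeg p0); move: E; lia.
have pm : mlead p \in msupp p by rewrite mlead_supp.
by have := mlead_deg p0; rewrite p1 -(dhomog_mf ph pm) => -[].
Qed.

Lemma msize_factors n (a b : {mpoly K[n]}) : a * b != 0 -> (msize (a * b) <= 3)%N ->
  [\/ a \is a GRing.unit, b \is a GRing.unit | msize a = 2 /\ msize b = 2].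
Proof.
rewrite mulf_eq0 negb_or => /andP[a0 b0]; rewrite msizeM //.
have : (0 < msize a)%N by rewrite lt0n msize_poly_eq0.
have : (0 < msize b)%N by rewrite lt0n msize_poly_eq0.
move=> Hb Ha Hab; have [a1|a1] := eqVneq (msize a) 1%N.
  by apply: Or31; apply: mpoly_unit_size.
have [b1|b1] := eqVneq (msize b) 1%N; first by apply: Or32; apply: mpoly_unit_size.
apply: Or33; move: (msize a) (msize b) Hb Ha Hab a1 b1 => x y; lia.
Qed.

(** An invertible substitution is a ring automorphism. *)
Lemma lsub_irreducible m n (A : 'M[K]_(m, n)) (B : 'M[K]_(n, m)) p :
  A *m B = 1%:M -> B *m A = 1%:M -> irreducible_mpoly p -> irreducible_mpoly (lsub A p).
Proof.
move=> AB BA [p0 pu pab].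
have K1 q : lsub B (lsub A q) = q by rewrite lsub_comp AB lsub1.
have K2 q : lsub A (lsub B q) = q by rewrite lsub_comp BA lsub1.
split.
- by apply: contraNneq p0 => H; rewrite -(K1 p) H raddf0.
- apply: contra pu => up; rewrite -(K1 p); exact: rmorph_unit.
- move=> a b E; have E' : p = lsub B a * lsub B b.
    by rewrite -[LHS]K1 E; apply: (rmorphM (lsub B)).
  have [ua|ub] := pab _ _ E'; [left | right].
    rewrite -(K2 a); exact: rmorph_unit.
  rewrite -(K2 b); exact: rmorph_unit.
Qed.

(** Irreducibility of a quadratic form is tested on second derivatives: those of a
    product of two affine forms are symmetric expressions in their coefficients. *)
Lemma mderiv_affine n (p : {mpoly K[n]}) i : (msize p <= 2)%N -> p^`M(i) = (p@_U_(i))%:MP.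
Proof.
move=> p2; apply/mpolyP => m; rewrite mcoeff_deriv mcoeffC.
have [->|m0] := eqVneq m 0%MM; first by rewrite add0m mnm0E mulr1n mulr1.
rewrite mulr0 memN_msupp_eq0 ?mul0rn //; apply: msize_mdeg_ge.
by apply: leq_trans p2 _; rewrite mdegD mdeg1 addn1 ltnS lt0n mdeg_eq0.
Qed.

Lemma mderiv2_affineM n (a b : {mpoly K[n]}) i j : (msize a <= 2)%N -> (msize b <= 2)%N ->
  (a * b)^`M(i)^`M(j) = (a@_U_(i) * b@_U_(j) + a@_U_(j) * b@_U_(i))%:MP.
Proof.
move=> a2 b2; rewrite mderivM (mderiv_affine i a2) (mderiv_affine i b2) [a * _]mulrC.
rewrite !mul_mpolyC mderivD !mderivZ (mderiv_affine j a2) (mderiv_affine j b2).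
by rewrite -!mul_mpolyC -!mpolyCM -mpolyCD [b@__ * _]mulrC.
Qed.
End Irreducible.

(** The symmetric form of a product of two linear forms [a] and [b] vanishes on
    two vectors orthogonal to an isotropic vector which is not in its radical. *)
Lemma rank_two_form (K : numFieldType) (ax bx az bz ay by_ au bu : K) :
  ax * bx + ax * bx = 0 -> ax * bz + az * bx = 1 -> ax * by_ + ay * bx = 0 ->
  ax * bu + au * bx = 0 -> ay * bu + au * by_ = 0.
Proof.
move=> xx xz xy xu; have : (ax * bx) *+ 2 == 0 by rewrite mulr2n xx.
rewrite mulrn_eq0 mulf_eq0 /= => /orP[] /eqP x0; rewrite x0 ?(mul0r, mulr0, add0r, addr0) in xz xy xu.
  have bx0 : bx != 0 by apply: contra_eq_neq xz => ->; rewrite mulr0 eq_sym oner_neq0.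
  move/eqP: xy; move/eqP: xu; rewrite !mulf_eq0 !(negPf bx0) !orbF => /eqP-> /eqP->.
  by rewrite !mul0r addr0.
have ax0 : ax != 0 by apply: contra_eq_neq xz => ->; rewrite mul0r eq_sym oner_neq0.
move/eqP: xy; move/eqP: xu; rewrite !mulf_eq0 !(negPf ax0) /= => /eqP-> /eqP->.
by rewrite !mulr0 addr0.
Qed.

Section SpinIrreducible.
Variable K : numClosedFieldType.
Local Notation S := {mpoly K[16]}.
Local Notation o := spin_ord.

Lemma homog_msize_le n d (p : {mpoly K[n]}) : p != 0 -> p \is d.-homog -> msize p = d.+1.
Proof.
move=> p0 ph; rewrite -(mlead_deg p0); congr _.+1.
by apply: (dhomog_mf ph); apply: mlead_supp.
Qed.

Lemma Xtop_irreducible : irreducible_mpoly (Xtop K).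
Proof.
split; first exact: Xtop_neq0.
  by apply/negP => /mpoly_unit_homog /(_ (Xtop_homog K)).
move=> a b E; have ab0 := Xtop_neq0 K.
have := homog_msize_le ab0 (Xtop_homog K); rewrite E in ab0 * => ab2.
have ab3 : (msize (a * b) <= 3)%N by rewrite ab2.
have [ua|ub|[a2 b2]] := msize_factors ab0 ab3; [by left | by right |].
rewrite mulf_eq0 negb_or in ab0; have /andP[a0 b0] := ab0.
by move: ab2; rewrite msizeM // a2 b2.
Qed.

Lemma mderiv2_XX (k l i j : 'I_16) : ('X_k * 'X_l : S)^`M(i)^`M(j) =
  ((k == i)%:R * (l == j)%:R + (k == j)%:R * (l == i)%:R)%:MP.
Proof. by rewrite mderiv2_affineM ?msizeX ?mdeg1 // !mcoeffXU. Qed.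

(** If [quad] were a product of two affine forms, its second derivatives in the
    variables 15, 6, 8 and 14 would form a matrix of rank at most 2. *)
Lemma quad_irreducible : irreducible_mpoly (quad K).
Proof.
split; first exact: quad_neq0.
  by apply/negP => /mpoly_unit_homog /(_ (quad_homog K)).
move=> a b E; have ab0 := quad_neq0 K.
have := homog_msize_le ab0 (quad_homog K); rewrite E in ab0 * => ab2.
have ab3 : (msize (a * b) <= 3)%N by rewrite ab2.
have [ua|ub|[a2' b2']] := msize_factors ab0 ab3; [by left | by right |].
have a2 : (msize a <= 2)%N by rewrite a2'.
have b2 : (msize b <= 2)%N by rewrite b2'.
pose u k := a@_U_(o k); pose v k := b@_U_(o k).
have D i j : (i < 16)%N -> (j < 16)%N -> u i * v j + u j * v i =
    ((6 == i) * (15 == j) + (6 == j) * (15 == i))%N%:R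
    - ((8 == i) * (14 == j) + (8 == j) * (14 == i))%N%:R
    + ((10 == i) * (13 == j) + (10 == j) * (13 == i))%N%:R
    - ((11 == i) * (12 == j) + (11 == j) * (12 == i))%N%:R.
  move=> i16 j16; have := congr1 (fun p : S => p^`M(o i)^`M(o j)) E.
  rewrite mderiv2_affineM // /quad !(mderivB, mderivD) !mderiv2_XX.
  rewrite -!(mpolyCB, mpolyCD) => /(congr1 (mcoeff 0%MM)); rewrite !mcoeffC eqxx !mulr1 => <-.
  by rewrite -!val_eqE /= !spin_ordK // !natrD !natrM.
have xx := D 15%N 15%N isT isT; have xz := D 15%N 6%N isT isT.
have xy := D 15%N 8%N isT isT; have xy' := D 15%N 14%N isT isT.
have yy' := D 8%N 14%N isT isT.
rewrite /= !(mul0n, muln0, add0n, addn0, mul1n, subr0, addr0, add0r, sub0r) in xx xz xy xy' yy'.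
have : (u 8%N * v 14%N + u 14%N * v 8%N == 0) by apply/eqP/(rank_two_form xx xz xy xy').
by rewrite yy' oppr_eq0 oner_eq0.
Qed.

Lemma hwv_irreducible c : irreducible_mpoly (hwv K c) <-> c = (1, 0)%N \/ c = (0, 1)%N.
Proof.
split; last first.
  by case=> ->; rewrite /hwv /= expr0 expr1 ?mulr1 ?mul1r;
    [apply: Xtop_irreducible | apply: quad_irreducible].
have nu d : hwv K d \is a GRing.unit -> d = (0, 0)%N.
  by move=> /mpoly_unit_homog /(_ (hwv_homog K d)); case: d => [x y] /=; case: x y => [|x] [|y].
have XE : hwv K (1, 0)%N = Xtop K by rewrite /hwv /= expr0 expr1 mulr1.
have qE : hwv K (0, 1)%N = quad K by rewrite /hwv /= expr0 expr1 mul1r.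
case: c => [[|x] [|y]] [h0 hu hab].
- by rewrite /hwv /= !expr0 mulr1 unitr1 in hu.
- right; have := hab (hwv K (0, 1)%N) (hwv K (0, y)%N).
  rewrite qE {1}/hwv {1}/hwv /= expr0 !mul1r exprS => /(_ erefl) [].
    by rewrite -qE => /nu.
  by move/nu => [->].
- left; have := hab (hwv K (1, 0)%N) (hwv K (x, 0)%N).
  rewrite XE {1}/hwv {1}/hwv /= expr0 !mulr1 exprS => /(_ erefl) [].
    by rewrite -XE => /nu.
  by move/nu => [->].
- have := hab (hwv K (1, 0)%N) (hwv K (x, y.+1)%N).
  rewrite XE {1}/hwv {1}/hwv /= exprS mulrA => /(_ erefl) [].
    by rewrite -XE => /nu.
  by move/nu.
Qed.
End SpinIrreducible.

(** * Transfer to the tangent bundle *)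

Section Transfer.
Variable R : realType.
Local Notation C := R[i].
Local Notation M27 := 'M[C]_27.
Local Notation n := (\dim (TX R)).
Local Notation M := {mpoly C[n]}.
Local Notation S := {mpoly C[16]}.
Local Notation act := (@symTX_act R).

Definition to_spin : M -> S := lsub (toS R).
Definition of_spin : S -> M := lsub (ofS R).

Lemma to_of q : to_spin (of_spin q) = q.
Proof. by rewrite /to_spin /of_spin lsub_comp ofS_toS lsub1. Qed.

Lemma of_to p : of_spin (to_spin p) = p.
Proof. by rewrite /to_spin /of_spin lsub_comp toS_ofS lsub1. Qed.

Lemma to_spin0 : to_spin 0 = 0. Proof. exact: rmorph0. Qed.
Lemma of_spin0 : of_spin 0 = 0. Proof. exact: rmorph0. Qed.

Lemma to_spinP c p q : to_spin (c *: p + q) = c *: to_spin p + to_spin q.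
Proof. exact: linearP. Qed.

Lemma of_spinP c p q : of_spin (c *: p + q) = c *: of_spin p + of_spin q.
Proof. exact: linearP. Qed.

Lemma of_spinZ c p : of_spin (c *: p) = c *: of_spin p.
Proof. exact: linearZ. Qed.

Lemma act_of g q : normalizes g -> act g (of_spin q) = of_spin (lsub (tmx g) q).
Proof.
move=> gn; have E : ofS R *m adTX g = tmx g *m ofS R.
  by rewrite adTX_E // !mulmxA ofS_toS mul1mx.
transitivity (lsub (ofS R *m adTX g) q); first exact: lsub_comp.
rewrite E; apply/esym; exact: lsub_comp.
Qed.

Lemma act_to g p : normalizes g -> to_spin (act g p) = lsub (tmx g) (to_spin p).
Proof. by move=> gn; rewrite -{1}[p]of_to act_of // to_of. Qed.

Lemma actM g h p : normalizes g -> normalizes h -> act (g *m h) p = act g (act h p).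
Proof.
move=> gn hn; rewrite -[p]of_to (act_of _ (normalizesM gn hn)) (act_of _ hn).
by rewrite (act_of _ gn) (tmxM gn hn) lsub_comp.
Qed.

Lemma act1 p : act 1%:M p = p.
Proof.
rewrite -[p]of_to act_of; last exact: normalizes1.
suff -> : tmx (1%:M : M27) = 1%:M by rewrite lsub1.
by apply/matrixP => l m; rewrite mxE invmx1 mulmx1 mul1mx tcoord_tv mxE.
Qed.

Definition gens (g : M27) : Prop :=
  [\/ exists i t, t != 0 /\ g = cochar i t, exists i t, g = rootF i t
    | exists i t, i != ord0 /\ g = Defs.rootE i t].

Definition levi_gens (g : M27) : Prop :=
  [\/ exists i t, t != 0 /\ g = cochar i t, exists i t, i != ord0 /\ g = rootF i t
    | exists i t, i != ord0 /\ g = Defs.rootE i t].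

Lemma gens_normalizes g : gens g -> normalizes g.
Proof.
case=> [[i [t [t0 ->]]]|[i [t ->]]|[i [t [i0 ->]]]].
- exact: cochar_normalizes.
- exact: rootF_normalizes.
- exact: rootE_normalizes.
Qed.

Lemma cochar_inv i (t : C) : t != 0 -> invmx (cochar i t) = cochar i t^-1.
Proof.
move=> t0; have [u _ _] := cochar_normalizes i t0.
apply: (can_inj (mulKmx u)); rewrite mulmxV // /cochar mulmx_diag.
apply/matrixP => k m; rewrite !mxE exprz_inv -expfzDr // subrr expr0z.
by [].
Qed.

Lemma rootE_inv i (t : C) : invmx (Defs.rootE i t) = Defs.rootE i (- t).
Proof. by have [_ ->] := exp_inv t (E_sq R i); rewrite /Defs.rootE scaleNr. Qed.

Lemma rootF_inv i (t : C) : invmx (rootF i t) = rootF i (- t).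
Proof. by have [_ ->] := exp_inv t (F_sq R i); rewrite /rootF scaleNr. Qed.

Lemma gens_inv g : gens g -> gens (invmx g).
Proof.
case=> [[i [t [t0 ->]]]|[i [t ->]]|[i [t [i0 ->]]]].
- by apply: Or31; exists i, t^-1; rewrite invr_eq0 cochar_inv.
- by apply: Or32; exists i, (- t); rewrite rootF_inv.
- by apply: Or33; exists i, (- t); rewrite rootE_inv.
Qed.

(** The closure under inverses is proved along with the claim, since an element
    and its inverse are treated symmetrically by the induction. *)
Lemma groupP1_closed (N : M -> Prop) : (forall g p, gens g -> N p -> N (act g p)) ->
  forall g p, groupP1 g -> N p -> N (act g p).
Proof.
move=> gN g p Gg; move: p.
suff [] : (normalizes g /\ forall p, N p -> N (act g p)) /\
  (normalizes (invmx g) /\ forall p, N p -> N (act (invmx g) p)) by case.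
have gX h : gens h -> normalizes h /\ forall p, N p -> N (act h p).
  by move=> Xh; split; [apply/gens_normalizes/Xh | move=> p; apply: gN].
elim: Gg => [x Xx||x y _ [[xn xN] [xn' xN']] _ [[yn yN] [yn' yN']]|x _ [Hx Hx']].
- by split; apply: gX => //; apply: gens_inv.
- rewrite invmx1; split; (split; first exact: normalizes1); by move=> p; rewrite act1.
- have [xu _ _] := xn; have [yu _ _] := yn.
  rewrite (invmxM xu yu); split; (split; first exact: normalizesM).
    by move=> p Np; rewrite (actM p xn yn); apply/xN/yN.
  by move=> p Np; rewrite (actM p yn' xn'); apply/yN'/xN'.
- by rewrite invmxK.
Qed.

Lemma stable_submodule (N : S -> Prop) : spin_stable N ->
  is_submodule (@groupP1 R) act (fun p => N (to_spin p)).
Proof.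
move=> [[N0 NL] NE NF NT]; split.
- by rewrite to_spin0.
- by move=> c x y Nx Ny; rewrite to_spinP; apply: NL.
apply: groupP1_closed => g p Xg Np; rewrite act_to; last exact: gens_normalizes.
case: Xg => [[i [t [t0 ->]]]|[i [t ->]]|[i [t [i0 ->]]]].
- by rewrite tmx_cochar //; apply: NT.
- have [->|i0] := eqVneq i ord0; first by rewrite tmx_rootF0 lsub1.
  by rewrite tmx_rootF //; apply: (NF (exist _ i i0)).
- by rewrite tmx_rootE; apply: (NE (exist _ i i0)).
Qed.

(** The group [G] is meant to be [P_1] or its Levi factor: the same spaces are stable
    under both. *)
Lemma submodule_stable (G : M27 -> Prop) (N : M -> Prop) :
  (forall g, levi_gens g -> G g) ->
  is_submodule G act N -> spin_stable (fun q => N (of_spin q)).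
Proof.
move=> levG [N0 NL NG]; split.
- split; first by rewrite of_spin0.
  by move=> c x y Nx Ny; rewrite of_spinP; apply: NL.
- move=> [i i0] t p Np; rewrite /spinEi /= -tmx_rootE -(act_of p (rootE_normalizes t i0)).
  by apply: (NG _ _ _ Np); apply/levG/Or33; exists i, t.
- move=> [i i0] t p Np; rewrite /spinEi /= -(tmx_rootF t i0) -(act_of p (rootF_normalizes i t)).
  by apply: (NG _ _ _ Np); apply/levG/Or32; exists i, t.
- move=> j t p t0 Np; rewrite -(tmx_cochar j t0) -(act_of p (cochar_normalizes j t0)).
  by apply: (NG _ _ _ Np); apply/levG/Or31; exists j, t.
Qed.

Lemma levi_in_P1 g : levi_gens g -> groupP1 g.
Proof.
by move=> Hg; apply: Sgen_in; case: Hg => [H|[i [t [_ ->]]]|H];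
  [apply: Or31 | apply: Or32; exists i, t | apply: Or33].
Qed.

Lemma levi_in_levi g : levi_gens g -> leviP1 g.
Proof. by move=> Hg; apply: Sgen_in. Qed.

Lemma of_spin_neq0 q : q != 0 -> of_spin q != 0.
Proof. by apply: contra_neq => H; rewrite -[q]to_of H to_spin0. Qed.

Lemma to_spin_neq0 p : p != 0 -> to_spin p != 0.
Proof. by apply: contra_neq => H; rewrite -[p]of_to H of_spin0. Qed.

Definition hw_weight (c : nat * nat) : weight :=
  fweight 2 *+ c.1 + (fweight 6 + fweight 1) *+ c.2.

Lemma hw_weightE c j : hw_weight c 0 j = eta c j.
Proof.
have E k : fweight k ord0 j = (j == inord k.-1)%:R by rewrite mxE.
have MnE (v : weight) k : (v *+ k) 0 j = v 0 j * k%:Z.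
  by elim: k => [|k IH]; rewrite ?mulr0n ?mxE ?mulr0 // mulrS mxE IH; ring.
rewrite /hw_weight [LHS]mxE !MnE [(fweight 6 + _) _ _]mxE !E /eta -!val_eqE /= !inordK //.
by case: j {E MnE} => [[|[|[|[|[|[|]]]]]] ?] //=; ring.
Qed.

Lemma hwv_is_hwv c : is_hwv act (hw_weight c) (of_spin (hwv C c)).
Proof.
split; first exact/of_spin_neq0/hwv_neq0.
- move=> i t i0; rewrite act_of; last exact: rootE_normalizes.
  by rewrite tmx_rootE hwv_fixed.
- move=> j t t0; rewrite act_of; last exact: cochar_normalizes.
  by rewrite tmx_cochar // tor_hwv // hw_weightE of_spinZ.
Qed.

Lemma is_hwv_hwv lambda v : is_hwv act lambda v ->
  exists c z, [/\ z != 0, v = z *: of_spin (hwv C c) & lambda = hw_weight c].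
Proof.
move=> [v0 vE vT]; have [||c [z [z0 E eq]]] := @fixed_weight_hwv _ _ (lambda 0) (to_spin_neq0 v0).
- move=> i t i0; rewrite -tmx_rootE -act_to ?vE //; exact: rootE_normalizes.
- move=> j t t0; rewrite -tmx_cochar // -act_to ?vT //; last exact: cochar_normalizes.
  exact: linearZ.
exists c, z; split=> //; first by rewrite -of_spinZ -E of_to.
by apply/rowP => j; rewrite hw_weightE eq.
Qed.

(** The copy of [E_lambda] for [lambda] the weight [hw_weight c]. *)
Definition comp (c : nat * nat) (p : M) : Prop := spin_gen c (to_spin p).

Lemma comp_is_E c : is_E (@groupP1 R) act (hw_weight c) (comp c).
Proof.
have hc : comp c (of_spin (hwv C c)) by rewrite /comp to_of; apply: gen_h.
split; last by exists (of_spin (hwv C c)); split=> //; apply: hwv_is_hwv.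
split; first exact/stable_submodule/spin_gen_stable.
  by exists (of_spin (hwv C c)); split=> //; apply/of_spin_neq0/hwv_neq0.
move=> N' /(submodule_stable levi_in_P1) stN N'c.
case: (classic (exists2 x, N' x & x != 0)) => [[x N'x x0]|none]; last first.
  by left=> x N'x; apply/eqP; apply: contraT => x0; case: none; exists x.
right=> p cp; rewrite -[p]of_to.
apply: (spin_gen_irreducible stN (c := c) (p := to_spin x)) => //.
- by move=> q /N'c; rewrite /comp to_of.
- by rewrite of_to.
- exact: to_spin_neq0.
Qed.

Section Degree.
Variable r : nat.

Definition expo (t : exponents r) : nat * nat :=
  (nat_of_ord (val t).1, nat_of_ord (val t).2).

Lemma expo_inj : injective expo.
Proof. by move=> [[a b] ab] [[a' b'] ab'] [/= E1 E2]; apply/val_inj/eqP; rewrite xpair_eqE -!val_eqE /= E1 E2 !eqxx. Qed.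

Lemma expo_deg c : (c.1 + 2 * c.2)%N = r <-> exists t, expo t = c.
Proof.
split=> [E|[[[a b] /= ab] <-]]; last exact/eqP.
have c1 : (c.1 < r.+1)%N by rewrite -E ltnS leq_addr.
have c2 : (c.2 < r.+1)%N by rewrite -E ltnS mul2n -addnn addnA leq_addl.
have Hc : ((Ordinal c1, Ordinal c2).1 + 2 * (Ordinal c1, Ordinal c2).2 == r)%N by rewrite /= E.
by exists (exist _ (Ordinal c1, Ordinal c2) Hc); rewrite /expo /= -surjective_pairing.
Qed.

Lemma comp_direct_sum : direct_sum (fun t => comp (expo t)) (SymTX_deg (R := R) r).
Proof.
split.
- move=> x; split.
    move=> xr; have : to_spin x \is r.-homog by apply: lsub_homog.
    move=> /(spin_decomposition expo_deg) [y [gy xy]].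
    exists (fun t => of_spin (y t)); split=> [t|]; first by rewrite /comp to_of.
    by rewrite -[x]of_to xy /of_spin raddf_sum.
  move=> [y [cy ->]]; apply: rpred_sum => t _; rewrite -[y t]of_to.
  exact/lsub_homog/(spin_gen_homog expo_deg (cy t)).
- move=> y cy y0 t; rewrite -[y t]of_to.
  have := @spin_decomposition_direct C _ expo expo_inj (fun t => to_spin (y t)) cy.
  have <- : to_spin (\sum_t y t) = \sum_t to_spin (y t) by apply: raddf_sum.
  by rewrite y0 => /(_ to_spin0 t) ->; apply: of_spin0.
Qed.
End Degree.

(** An isomorphism maps a highest weight vector of [N1] to one of the same weight
    in [N2], which is a multiple of the former because weights are distinct.  So
    [N1] and [N2] have a nonzero intersection, and are equal by irreducibility. *)
Lemma multiplicity_free_TX : multiplicity_free (@leviP1 R) act.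
Proof.
move=> N1 N2 [sub1 [x [N1x x0]] irr1] [sub2 _ irr2] [phi [phiL phiG phi0 phiN]].
have st1 := submodule_stable levi_in_levi sub1.
have [c N1c] : exists c, N1 (of_spin (hwv C c)).
  apply: (spin_has_hwv st1 (p := to_spin x)); first by rewrite of_to.
  exact: to_spin_neq0.
set v := of_spin (hwv C c) in N1c; have [v0 vE vT] := hwv_is_hwv c.
have N2v : N2 (phi v) by apply/phiN; exists v.
have G g : levi_gens g -> leviP1 g := @levi_in_levi g.
have hphi : is_hwv act (hw_weight c) (phi v).
  split.
  - by apply: contra_neq v0 => /(phi0 _ N1c).
  - move=> i t i0; rewrite -phiG ?vE //; apply/G/Or33; by exists i, t.
  - move=> j t t0; rewrite -phiG ?vT //; last by apply/G/Or31; exists j, t.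
    have [N10 _ _] := sub1; have phi00 : phi 0 = 0.
      have := phiL (-1) v v N1c N1c; rewrite !scaleN1r addNr => ->.
      by rewrite addNr.
    by have := phiL (t ^ hw_weight c 0 j) v 0 N1c N10; rewrite phi00 !addr0.
have [d [z [z0 phiE cd]]] := is_hwv_hwv hphi.
have cd' : c = d by apply: eta_inj => j; rewrite -!hw_weightE cd.
have N2c : N2 v.
  have [N20 N2L _] := sub2.
  have -> : v = z^-1 *: phi v + 0 by rewrite phiE -cd' scalerA mulVf // scale1r addr0.
  by apply: N2L.
have sub12 : is_submodule (@leviP1 R) act (fun p => N1 p /\ N2 p).
  have [N10 N1L N1G] := sub1; have [N20 N2L N2G] := sub2.
  split; first by split.
    by move=> k p q [p1 p2] [q1 q2]; split; [apply: N1L | apply: N2L].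
  by move=> g p Gg [p1 p2]; split; [apply: N1G | apply: N2G].
have [|H|H1] := irr1 _ sub12; first by move=> p [].
  by case/eqP: v0; apply: H.
have [|H|H2] := irr2 _ sub12; first by move=> p [].
  by case/eqP: v0; apply: H.
by move=> p; split=> [/H1 []|/H2 []].
Qed.

Lemma of_spin_irreducible q : irreducible_mpoly q <-> irreducible_mpoly (of_spin q).
Proof.
split; first by apply: lsub_irreducible; [apply: ofS_toS | apply: toS_ofS].
move=> H; rewrite -[q]to_of.
by apply: lsub_irreducible H; [apply: toS_ofS | apply: ofS_toS].
Qed.

Lemma irreducible_scale m (z : C) (p : {mpoly C[m]}) : z != 0 ->
  irreducible_mpoly (z *: p) -> irreducible_mpoly p.
Proof.
move=> z0 [p0 pu pab].
have zu : (z%:MP : {mpoly C[m]}) \is a GRing.unit.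
  by apply: mpoly_unit_size; rewrite msizeC z0.
split.
- by apply: contraNneq p0 => ->; rewrite scaler0.
- by apply: contra pu => pu; rewrite -mul_mpolyC unitrM zu.
- move=> a b E; have E' : z *: p = z%:MP * a * b by rewrite -mulrA -E mul_mpolyC.
  by case: (pab _ _ E') => [|bu]; [rewrite unitrM zu; left | right].
Qed.

Lemma fundamental_TX (lambda : weight) d : is_fundamental_hw act lambda d <->
  (lambda = fweight 2 /\ d = 1%N) \/ (lambda = fweight 6 + fweight 1 /\ d = 2%N).
Proof.
have w10 : hw_weight (1, 0)%N = fweight 2 by rewrite /hw_weight mulr1n mulr0n addr0.
have w01 : hw_weight (0, 1)%N = fweight 6 + fweight 1.
  by rewrite /hw_weight mulr1n mulr0n add0r.
have hom c : of_spin (hwv C c) \is (c.1 + 2 * c.2)%N.-homog.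
  exact/lsub_homog/hwv_homog.
split.
- move=> [v [/is_hwv_hwv [c [z [z0 -> ->]]] vI vd]].
  have dE : d = (c.1 + 2 * c.2)%N.
    apply: (dhomog_uniq _ vd); last by apply: rpredZ; apply: hom.
    by rewrite scaler_eq0 negb_or z0; apply/of_spin_neq0/hwv_neq0.
  have /hwv_irreducible [E|E] : irreducible_mpoly (hwv C c).
    by apply/of_spin_irreducible/(irreducible_scale z0).
  - by left; rewrite dE E w10.
  - by right; rewrite dE E w01.
- case=> [[-> ->]|[-> ->]].
    exists (of_spin (hwv C (1, 0)%N)); split; last exact: hom.
      by rewrite -w10; apply: hwv_is_hwv.
    by apply/of_spin_irreducible/hwv_irreducible; left.
  exists (of_spin (hwv C (0, 1)%N)); split; last exact: hom.
    by rewrite -w01; apply: hwv_is_hwv.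
  by apply/of_spin_irreducible/hwv_irreducible; right.
Qed.
End Transfer.

Theorem proposition5p21 (R : realType) :
  (forall r : nat,
     exists W : exponents r -> SymTX R -> Prop,
       (forall ij : exponents r, is_E (groupP1 (R := R)) (symTX_act (R := R))
          (fweight 2 *+ (val ij).1 + (fweight 6 + fweight 1) *+ (val ij).2)
          (W ij)) /\
       direct_sum W (SymTX_deg r)) /\
  multiplicity_free (leviP1 (R := R)) (symTX_act (R := R)) /\
  (forall (lambda : weight) (d : nat),
     is_fundamental_hw (symTX_act (R := R)) lambda d <->
     (lambda = fweight 2 /\ d = 1%N) \/
     (lambda = fweight 6 + fweight 1 /\ d = 2%N)).
Proof.
split; last by split; [apply: multiplicity_free_TX | apply: fundamental_TX].
move=> r; exists (fun t => @comp R (expo t)); split; last exact: comp_direct_sum.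
by move=> t; apply: comp_is_E.
Qed.
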